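(* Let $\mathcal{H}$ be one of the following Hilbert modules of holomorphic functions on the unit disk $\mathbb{D}$: the Hardy module $H^2$, the Bergman module $A^2$, or a weighted Bergman module $A^2_\alpha$ with $\alpha>-1$. Let $\Theta=\{\theta_1,\theta_2\}$ and $\Phi=\{\varphi_1,\varphi_2\}$, with $\theta_1,\theta_2,\varphi_1,\varphi_2$ bounded holomorphic functions on $\mathbb{D}$, both satisfy the corona condition. Then the quotient Hilbert modules $\mathcal{H}_\Theta$ and $\mathcal{H}_\Phi$ are isomorphic if and only if $$\nabla^2 \log \frac{|\theta_1(z)|^2+|\theta_2(z)|^2}{|\varphi_1(z)|^2+|\varphi_2(z)|^2}=0 \quad\text{for all } z\in\mathbb{D}.$$
   Context: $\mathbb{D}$ is the open unit disk in $\mathbb{C}$. $H^2$ is the Hardy space of holomorphic $f$ on $\mathbb{D}$ with $\|f\|_2^2=\sup_{0<r<1}\frac{1}{2\pi}\int_0^{2\pi}|f(re^{i\theta})|^2\,d\theta<\infty$. For $\alpha>-1$, $A^2_\alpha$ is the weighted Bergman space of holomorphic $f$ on $\mathbb{D}$ with $\|f\|_{2,\alpha}^2=\frac1\pi\int_{\mathbb{D}}|f(z)|^2(\alpha+1)(1-|z|^2)^\alpha\,dA(z)<\infty$, where $dA$ is area measure; $A^2=A^2_0$ is the Bergman space. Each is a Hilbert module over $\mathbb{C}[z]$ via $p\cdot f=pf$ (i.e. the coordinate function acts by $M_z f=zf$). $\nabla^2=4\partial\bar\partial$ is the Laplacian. A pair $\Theta=\{\theta_1,\theta_2\}$ of bounded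 holomorphic functions on $\mathbb{D}$ is viewed as the bounded holomorphic function $\Theta(z)=\theta_1(z)\otimes e_1+\theta_2(z)\otimes e_2$ with values in the bounded operators from $\mathbb{C}$ to $\mathbb{C}^2$, where $\{e_1,e_2\}$ is an orthonormal basis of $\mathbb{C}^2$. It satisfies the corona condition if there is $\epsilon>0$ with $|\theta_1(z)|^2+|\theta_2(z)|^2\ge\epsilon$ for all $z\in\mathbb{D}$. For such $\Theta$, let $M_\Theta:\mathcal{H}\to\mathcal{H}\otimes\mathbb{C}^2$, $M_\Theta f=\theta_1 f\otimes e_1+\theta_2 f\otimes e_2$; under the corona condition its range $\Theta\mathcal{H}$ is closed. The quotient Hilbert module is $\mathcal{H}_\Theta=(\mathcal{H}\otimes\mathbb{C}^2)/\Theta\mathcal{H}$ with the induced action of $\mathbb{C}[z]$; equivalently it is the Hilbert space $(\operatorname{ran} M_\Theta)^\perp\subseteq\mathcal{H}\otimes\mathbb{C}^2$ on which the coordinate function acts by the compression $N_z=P_{(\operatorname{ran} M_\Theta)^\perp}(M_z\otimes I_{\mathbb{C}^2})|_{(\operatorname{ran} M_\Theta)^\perp}$. Two Hilbert modules over $\mathbb{C}[z]$ are isomorphic if there is a unitary operator $X$ between them with $X(p\cdot f)=p\cdot(Xf)$ for all $p\in\mathbb{C}[z]$ and all $f$. *)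

(* Defs.v *)
(* MathComp-Analysis; the complex numbers over R : realType are R[i]. *)
From HB Require Import structures.
From mathcomp Require Import all_boot all_order all_algebra complex.
From mathcomp Require Import all_classical all_reals all_analysis.

Set Implicit Arguments.
Unset Strict Implicit.
Unset Printing Implicit Defensive.

Import Order.TTheory GRing.Theory Num.Theory.
Import numFieldNormedType.Exports.

Local Open Scope classical_set_scope.
Local Open Scope ring_scope.
Local Open Scope complex_scope.

Section Disk.
Variable R : realType.
Local Notation C := R[i].

(* The modulus with values in R; the generic norm `|z| on R[i] has values in
   R[i]. *)
Definition modulus (z : C) : R := Normc.normc z.

Definition disk : set C := [set z | modulus z < 1].

(* Complex differentiability: the scalars, the domain and the codomain are all
   R[i], so the difference quotient is taken over complex increments. *)
Definition holomorphic (f : C -> C) : Prop :=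
  forall z, disk z -> derivable (f : C^o -> C^o) z 1.

Definition bounded_holomorphic (f : C -> C) : Prop :=
  holomorphic f /\ exists B : R, forall z, disk z -> modulus (f z) <= B.

Definition corona (t1 t2 : C -> C) : Prop :=
  exists2 e : R, 0 < e &
    forall z, disk z -> e <= modulus (t1 z) ^+ 2 + modulus (t2 z) ^+ 2.

Definition dx (f : C -> C) (z : C) : C :=
  derive1 (fun t : R => complex.Re (f (t +i* complex.Im z))) (complex.Re z) +i*
  derive1 (fun t : R => complex.Im (f (t +i* complex.Im z))) (complex.Re z).

Definition dy (f : C -> C) (z : C) : C :=
  derive1 (fun t : R => complex.Re (f (complex.Re z +i* t))) (complex.Im z) +i*
  derive1 (fun t : R => complex.Im (f (complex.Re z +i* t))) (complex.Im z).

Definition dd (f : C -> C) (z : C) : C := 2^-1 * (dx f z - 'i%C * dy f z).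

Definition ddbar (f : C -> C) (z : C) : C := 2^-1 * (dx f z + 'i%C * dy f z).

Definition laplacian (u : C -> R) (z : C) : C :=
  4 * dd (ddbar (fun w => (u w)%:C)) z.

End Disk.

(* The data of a Hilbert module over C[z]: a subset hcar of an ambient complex
   vector space, an inner product (linear in the first variable) and an action
   of C[z]; hip and hact are meaningful on hcar only. *)
Record hmod (R : realType) (V : lmodType R[i]) := HMod {
  hcar : set V;
  hip : V -> V -> R[i];
  hact : {poly R[i]} -> V -> V
}.

Section Modules.
Variable R : realType.
Local Notation C := R[i].

(* On hcar M, a bijective linear map preserving inner products is a unitary. *)
Definition isomorphic (V W : lmodType C) (M : hmod V) (N : hmod W) : Prop :=
  exists X : V -> W,
    [/\ set_bij (hcar M) (hcar N) X,
        forall (a : C) f g, hcar M f -> hcar M g ->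
          X (a *: f + g) = a *: X f + X g,
        forall f g, hcar M f -> hcar M g -> hip N (X f) (X g) = hip M f g &
        forall (p : {poly C}) f, hcar M f -> X (hact M p f) = hact N p (X f)].

(* M (x) C^2, where (f1, f2) stands for f1 (x) e_1 + f2 (x) e_2. *)
Definition tensorC2 (V : lmodType C) (M : hmod V) : hmod (V * V)%type :=
  @HMod R (V * V)%type
    [set f | hcar M f.1 /\ hcar M f.2]
    (fun f g => hip M f.1 g.1 + hip M f.2 g.2)
    (fun p f => (hact M p f.1, hact M p f.2)).

Definition orthocomplement (V : lmodType C) (M : hmod V) (S : set V) : set V :=
  [set f | hcar M f /\ forall s, S s -> hip M f s = 0].

Definition orthproj (V : lmodType C) (M : hmod V) (S : set V) (f : V) : V :=
  xget 0 [set g | S g /\ forall s, S s -> hip M (f - g) s = 0].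

(* The quotient of M by a closed submodule S, realized on the orthogonal
   complement of S, on which p acts by the compression of its action on M. *)
Definition quotient (V : lmodType C) (M : hmod V) (S : set V) : hmod V :=
  HMod (orthocomplement M S) (hip M)
    (fun p f => orthproj M (orthocomplement M S) (hact M p f)).

(* The inner product of a norm, N f being the square of the norm of f. *)
Definition polarization (N : (C -> C) -> \bar R) (f g : C -> C) : C :=
  4^-1 * \sum_(k < 4)
    'i%C ^+ k * (fine (N (fun z => f z + 'i%C ^+ k * g z)))%:C.

(* The module of the holomorphic functions on the disk of finite norm. A
   function on the disk is represented by its extension by 0 to C, so that
   equality of functions on the disk is Leibniz equality. *)
Definition function_module (N : (C -> C) -> \bar R) : hmod (C -> C) :=
  @HMod R (C -> C)
    [set f | [/\ holomorphic f, forall z, ~ disk z -> f z = 0 &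
                 (N f < +oo)%E]]
    (polarization N)
    (fun p f z => p.[z] * f z).

Definition hardy_norm2 (f : C -> C) : \bar R :=
  ereal_sup [set ((2 * pi)^-1%:E *
    \int[lebesgue_measure]_(t in `[0%R, (2 * pi)%R])
      (modulus (f ((r * cos t) +i* (r * sin t))) ^+ 2)%:E)%E | r in `]0, 1[].

Definition bergman_norm2 (alpha : R) (f : C -> C) : \bar R :=
  (pi^-1%:E *
   \int[lebesgue_measure \x lebesgue_measure]_(p in
        [set p : R * R | disk (p.1 +i* p.2)])
     (modulus (f (p.1 +i* p.2)) ^+ 2 *
      ((alpha + 1) * (1 - modulus (p.1 +i* p.2) ^+ 2) `^ alpha))%:E)%E.

Definition hardy : hmod (C -> C) := function_module hardy_norm2.

Definition weighted_bergman (alpha : R) : hmod (C -> C) :=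
  function_module (bergman_norm2 alpha).

Definition bergman : hmod (C -> C) := weighted_bergman 0.

Definition ranM (H : hmod (C -> C)) (t1 t2 : C -> C) :
    set ((C -> C) * (C -> C)) :=
  [set (fun z => t1 z * f z, fun z => t2 z * f z) | f in hcar H].

Definition quotient_module (H : hmod (C -> C)) (t1 t2 : C -> C) :
    hmod ((C -> C) * (C -> C))%type :=
  quotient (tensorC2 H) (ranM H t1 t2).

End Modules.

Arguments hardy {R}.
Arguments bergman {R}.

(* Main.v *)
(* Both kinds of modules are weighted l^2 spaces of Taylor coefficients, by Cauchy's theorem and
   the rotation invariance of the measures; this makes them Hilbert spaces in which the
   polynomials are dense, and the range of M_Theta is complete by the corona condition.

   If X is an isomorphism of the quotients, then for each w the character
   (f1, f2) |-> phi2(w) f1(w) - phi1(w) f2(w) of H_Phi, pulled back by X and by the projection onto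
   H_Theta, is a bounded functional on H (x) C^2 on which p acts by p(w). Hence it is evaluation
   at w followed by a linear form, which kills Theta(w), so that it equals
   c(w) (theta2(w) f1(w) - theta1(w) f2(w)) for a holomorphic c. Since X is unitary, comparing norms
   gives |Phi|^2 = |c|^2 |Theta|^2, and log |c|^2 is harmonic.

   Conversely, if the logarithm of the ratio is harmonic, then d/dz of it has a holomorphic
   primitive, whose exponential G satisfies |Theta|^2 = |G Phi|^2. By polarization Theta = U G Phi
   for a constant unitary matrix U; as G and 1/G are bounded, U maps the range of M_Phi onto that
   of M_Theta and induces the isomorphism. *)
From HB Require Import structures.
Require Import Defs.
From mathcomp Require Import all_boot all_order all_algebra complex.
From mathcomp Require Import all_classical all_reals all_analysis.
From mathcomp Require Import measurable_realfun ring lra.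

Set Implicit Arguments.
Unset Strict Implicit.
Unset Printing Implicit Defensive.

Import Order.TTheory GRing.Theory Num.Theory.
Import numFieldNormedType.Exports.

Local Open Scope classical_set_scope.
Local Open Scope ring_scope.
Local Open Scope complex_scope.

(** * Wirtinger derivatives *)

(** Coefficients alone do not control multiplication by a bounded function, nor the lower bound on
    [ranM]. Both come from the last clause of [diag_norm], a domination principle checked on the
    integrals. Its lower bound on the weights makes every coefficient sequence of bounded energy the
    Taylor sequence of a function on the whole disk.

    The norm comparison uses no reproducing kernel. Let K be the squared norm of evaluation at w on
    H. Then [wedge t1 t2 w] has squared norm K |Theta(w)|^2 on H (x) C^2, and the same on the
    quotient because it kills the range of M_Theta. The isometry X equates K |Phi(w)|^2 with
    |c(w)|^2 K |Theta(w)|^2, and K cancels.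

    The obstacle is regularity. The formula for c contains conjugates, and holomorphy is bare
    complex differentiability at each point. Hence a calculus of Wirtinger derivatives, which treats
    holomorphic functions, their conjugates and moduli alike, and Goursat's theorem as the source of
    all power series. *)

Section Modulus.
Variable R : realType.
Local Notation C := R[i].
Implicit Types (z w : C) (x : R).

Lemma normE z : `|z| = (modulus z)%:C.
Proof. by case: z. Qed.

Lemma modulus0 : modulus (0 : C) = 0.
Proof. exact: Normc.normc0. Qed.

Lemma modulus1 : modulus (1 : C) = 1.
Proof. exact: Normc.normc1. Qed.

Lemma modulusM z w : modulus (z * w) = modulus z * modulus w.
Proof. exact: Normc.normcM. Qed.

Lemma modulusN z : modulus (- z) = modulus z.
Proof. exact: normcN. Qed.

Lemma modulusV z : modulus z^-1 = (modulus z)^-1.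
Proof. exact: Normc.normcV. Qed.

Lemma modulusX z n : modulus (z ^+ n) = modulus z ^+ n.
Proof.
elim: n => [|n IH]; first by rewrite !expr0 modulus1.
by rewrite !exprS modulusM IH.
Qed.

Lemma modulus_ge0 z : 0 <= modulus z.
Proof. by case: z => a b; apply: sqrtr_ge0. Qed.
#[local] Hint Extern 0 (is_true (_ <= modulus _)) => exact: modulus_ge0 : core.

Lemma le_modulusD z w : modulus (z + w) <= modulus z + modulus w.
Proof. exact: le_normcD. Qed.

Lemma modulusBC z w : modulus (z - w) = modulus (w - z).
Proof. by rewrite -modulusN opprB. Qed.

Lemma le_modulusB z w : modulus (z - w) <= modulus z + modulus w.
Proof. by rewrite -(modulusN w) le_modulusD. Qed.

Lemma modulus_eq0 z : (modulus z == 0) = (z == 0).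
Proof.
by apply/eqP/eqP => [/Normc.eq0_normc //|->]; exact: modulus0.
Qed.

Lemma modulus_gt0 z : (0 < modulus z) = (z != 0).
Proof. by rewrite lt_def modulus_eq0 modulus_ge0 andbT. Qed.

Lemma modulus_conj z : modulus (conjc z) = modulus z.
Proof. by case: z => a b; rewrite /modulus /= sqrrN. Qed.

Lemma modulus_real x : modulus x%:C = `|x|.
Proof. by rewrite /modulus /= expr0n /= addr0 sqrtr_sqr. Qed.

Lemma modulus_i : modulus ('i%C : C) = 1.
Proof. by rewrite /modulus /= expr0n /= add0r expr1n sqrtr1. Qed.

Lemma sqr_modulus z : modulus z ^+ 2 = complex.Re z ^+ 2 + complex.Im z ^+ 2.
Proof. by case: z => a b; rewrite /modulus /= sqr_sqrtr// addr_ge0 ?sqr_ge0. Qed.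

Lemma mul_conj z : z * conjc z = (modulus z ^+ 2)%:C.
Proof.
rewrite sqr_modulus; case: z => a b; apply/eqP.
by rewrite eq_complex /=; apply/andP; split; apply/eqP; ring.
Qed.

Lemma Re_le_modulus z : `|complex.Re z| <= modulus z.
Proof.
rewrite -(@ler_pXn2r _ 2)// ?nnegrE// sqr_modulus real_normK ?num_real//.
by rewrite lerDl sqr_ge0.
Qed.

Lemma Im_le_modulus z : `|complex.Im z| <= modulus z.
Proof.
rewrite -(@ler_pXn2r _ 2)// ?nnegrE// sqr_modulus real_normK ?num_real//.
by rewrite lerDr sqr_ge0.
Qed.

Lemma complexReIm z : z = (complex.Re z)%:C + 'i%C * (complex.Im z)%:C.
Proof. exact: complexE. Qed.

Lemma modulus_le_ReIm z : modulus z <= `|complex.Re z| + `|complex.Im z|.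
Proof.
rewrite {1}(complexReIm z) (le_trans (le_modulusD _ _))//.
by rewrite modulusM modulus_i mul1r !modulus_real.
Qed.

Lemma le_modulus_sum (I : Type) (r : seq I) (P : pred I) (F : I -> C) :
  modulus (\sum_(i <- r | P i) F i) <= \sum_(i <- r | P i) modulus (F i).
Proof.
elim/big_rec2 : _ => [|i y1 y2 _ H]; first by rewrite modulus0.
by rewrite (le_trans (le_modulusD _ _))// lerD2l.
Qed.

Lemma cReD z w : complex.Re (z + w) = complex.Re z + complex.Re w.
Proof. by case: z w => a b [c d]. Qed.
Lemma cImD z w : complex.Im (z + w) = complex.Im z + complex.Im w.
Proof. by case: z w => a b [c d]. Qed.
Lemma cReN z : complex.Re (- z) = - complex.Re z.
Proof. by case: z. Qed.
Lemma cImN z : complex.Im (- z) = - complex.Im z.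
Proof. by case: z. Qed.
Lemma cReM z w : complex.Re (z * w) =
  complex.Re z * complex.Re w - complex.Im z * complex.Im w.
Proof. by case: z w => a b [c d]. Qed.
Lemma cImM z w : complex.Im (z * w) =
  complex.Re z * complex.Im w + complex.Im z * complex.Re w.
Proof. by case: z w => a b [c d]. Qed.
Lemma cRe_sum (I : Type) (r : seq I) (P : pred I) (F : I -> C) :
  complex.Re (\sum_(i <- r | P i) F i) = \sum_(i <- r | P i) complex.Re (F i).
Proof. exact: (big_morph _ cReD erefl). Qed.
Lemma cIm_sum (I : Type) (r : seq I) (P : pred I) (F : I -> C) :
  complex.Im (\sum_(i <- r | P i) F i) = \sum_(i <- r | P i) complex.Im (F i).
Proof. exact: (big_morph _ cImD erefl). Qed.
Lemma complex_ext z w : complex.Re z = complex.Re w ->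
  complex.Im z = complex.Im w -> z = w.
Proof. by case: z w => a b [c d] /= -> ->. Qed.

End Modulus.
#[global] Hint Extern 0 (is_true (_ <= modulus _)) => exact: modulus_ge0 : core.

Section Wirtinger.
Variable R : realType.
Local Notation C := R[i].
Implicit Types (f g : C -> C) (z h a b : C).

(* [a] and [b] are the Wirtinger derivatives of [f] at [z]. *)
Definition wd f z a b := forall e : R, 0 < e -> exists2 d : R, 0 < d &
  forall h, modulus h < d ->
    modulus (f (z + h) - f z - (a * h + b * conjc h)) <= e * modulus h.

Lemma wd_eq f z a b a' b' : a = a' -> b = b' -> wd f z a b -> wd f z a' b'.
Proof. by move=> <- <-. Qed.

Lemma wd_near f g z a b :
  (exists2 d : R, 0 < d & forall h, modulus h < d -> f (z + h) = g (z + h)) ->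
  wd f z a b -> wd g z a b.
Proof.
move=> [d d0 fg] Hf e e0; have [d' d'0 H] := Hf e e0.
exists (Num.min d d'); first by rewrite lt_min d0.
move=> h; rewrite lt_min => /andP[h1 h2].
rewrite -(fg h)//; have := fg 0; rewrite modulus0 addr0 => /(_ d0) <-.
exact: H.
Qed.

Lemma disk_near z : disk z -> exists2 d : R, 0 < d &
  forall h, modulus h < d -> disk (z + h).
Proof.
rewrite /disk /= => z1; exists (1 - modulus z); first by rewrite subr_gt0.
by move=> h hd; rewrite (le_lt_trans (le_modulusD _ _))// -ltrBrDl.
Qed.

Lemma wd_disk f g z a b : disk z -> (forall w, disk w -> f w = g w) ->
  wd f z a b -> wd g z a b.
Proof.
move=> Dz fg; apply: wd_near; have [d d0 H] := disk_near Dz.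
by exists d => // h /H; exact: fg.
Qed.

Lemma wd_cst c z : wd (fun=> c) z 0 0.
Proof.
move=> e e0; exists 1 => // h _.
by rewrite subrr !mul0r addr0 subr0 modulus0 mulr_ge0 ?(ltW e0).
Qed.

Lemma wd_id z : wd id z 1 0.
Proof.
move=> e e0; exists 1 => // h _.
by rewrite /= (_ : _ - _ = 0) ?modulus0 ?mulr_ge0 ?(ltW e0)//; ring.
Qed.

Lemma wd_conj f z a b : wd f z a b -> wd (fun w => conjc (f w)) z (conjc b) (conjc a).
Proof.
move=> Hf e e0; have [d d0 H] := Hf e e0; exists d => // h hd.
rewrite -modulus_conj; rewrite -(modulus_conj h) in hd *.
rewrite modulus_conj in hd *.
rewrite (_ : conjc _ = f (z + h) - f z - (a * h + b * conjc h)); first exact: H.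
by rewrite !rmorphB rmorphD !rmorphM /= !conjcK; ring.
Qed.

Lemma wdD f g z a b a' b' : wd f z a b -> wd g z a' b' ->
  wd (fun w => f w + g w) z (a + a') (b + b').
Proof.
move=> Hf Hg e e0; have e2 : 0 < e / 2 by rewrite divr_gt0.
have [d d0 H] := Hf _ e2; have [d' d'0 H'] := Hg _ e2.
exists (Num.min d d'); first by rewrite lt_min d0.
move=> h; rewrite lt_min => /andP[/H h1 /H' h2].
rewrite (_ : _ - _ = (f (z + h) - f z - (a * h + b * conjc h)) +
   (g (z + h) - g z - (a' * h + b' * conjc h))); last by ring.
rewrite (le_trans (le_modulusD _ _))// (le_trans (lerD h1 h2))//.
by rewrite -mulrDl -splitr.
Qed.

Lemma wd_lip f z a b : wd f z a b -> exists2 K : R, 0 < K &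
  exists2 d : R, 0 < d & forall h, modulus h < d ->
    modulus (f (z + h) - f z) <= K * modulus h.
Proof.
move=> Hf; have [d d0 H] := Hf 1 ltr01.
exists (1 + (modulus a + modulus b)); first by rewrite ltr_pwDl ?addr_ge0.
exists d => // h /H h1.
rewrite -(subrK (a * h + b * conjc h) (f (z + h) - f z)).
rewrite mul1r in h1; rewrite (le_trans (le_modulusD _ _))//.
rewrite [leRHS]mulrDl mul1r lerD// [leRHS]mulrDl.
rewrite (le_trans (le_modulusD _ _))//.
by rewrite !modulusM modulus_conj.
Qed.

Lemma wdM f g z a b a' b' : wd f z a b -> wd g z a' b' ->
  wd (fun w => f w * g w) z (a * g z + f z * a') (b * g z + f z * b').
Proof.
move=> Hf Hg e e0.
have [K K0 [k k0 HK]] := wd_lip Hf; have [L L0 [l l0 HL]] := wd_lip Hg.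
(* [M] shares [e / 2] between the two first-order errors. The radius [r] below makes the product of
   the increments, at most [K * L] times |h|^2, cost the other [e / 2]. *)
pose M := modulus (f z) + modulus (g z) + 1.
have M0 : 0 < M by rewrite ltr_wpDl ?addr_ge0.
have e2 : 0 < e / 2 / M by rewrite !divr_gt0.
have [d d0 H] := Hf _ e2; have [d' d'0 H'] := Hg _ e2.
pose r := e / 2 / (K * L).
have r0 : 0 < r by rewrite !divr_gt0// mulr_gt0.
exists (Num.min (Num.min (Num.min k l) (Num.min d d')) r).
  by rewrite !lt_min k0 l0 d0 d'0.
move=> h; rewrite !lt_min => /andP[/andP[/andP[/HK h1 /HL h2]]].
move=> /andP[/H h3 /H' h4] hr.
rewrite (_ : _ - _ = g z * (f (z + h) - f z - (a * h + b * conjc h)) +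
   f z * (g (z + h) - g z - (a' * h + b' * conjc h)) +
   (f (z + h) - f z) * (g (z + h) - g z)); last by ring.
rewrite (splitr e) [leRHS]mulrDl (le_trans (le_modulusD _ _))// lerD//.
  rewrite (le_trans (le_modulusD _ _))// !modulusM.
  apply: (@le_trans _ _ ((modulus (g z) + modulus (f z)) *
     (e / 2 / M * modulus h))).
    by rewrite mulrDl lerD// ler_wpM2l.
  rewrite mulrA ler_wpM2r// mulrCA ler_piMr ?divr_ge0 ?ltW//.
  by rewrite ltr_pdivrMr// mul1r /M; lra.
rewrite modulusM (le_trans (ler_pM _ _ h1 h2))//.
rewrite mulrACA mulrA ler_wpM2r//.
by rewrite mulrC -ler_pdivlMr ?mulr_gt0// ltW.
Qed.

Lemma wdZ c f z a b : wd f z a b -> wd (fun w => c * f w) z (c * a) (c * b).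
Proof.
move=> Hf; have := wdM (wd_cst c z) Hf.
by apply: wd_eq; rewrite mul0r add0r.
Qed.

Lemma wdN f z a b : wd f z a b -> wd (fun w => - f w) z (- a) (- b).
Proof.
move=> /(wdZ (-1)); rewrite !mulN1r; apply: wd_near; exists 1 => // h _.
by rewrite mulN1r.
Qed.

Lemma wdB f g z a b a' b' : wd f z a b -> wd g z a' b' ->
  wd (fun w => f w - g w) z (a - a') (b - b').
Proof. by move=> Hf /wdN; exact: wdD. Qed.

Lemma wd_modulus2 f z a b : wd f z a b ->
  wd (fun w => (modulus (f w) ^+ 2)%:C) z (a * conjc (f z) + f z * conjc b)
     (b * conjc (f z) + f z * conjc a).
Proof.
move=> Hf; have := wdM Hf (wd_conj Hf).
by apply: wd_near; exists 1 => // h _; rewrite mul_conj.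
Qed.

Lemma is_derive_eps (phi : R -> R) (x d : R) : is_derive x (1 : R) phi d ->
  forall e : R, 0 < e -> exists2 r : R, 0 < r & forall k, `|k| < r ->
   `|phi (x + k) - phi x - d * k| <= e * `|k|.
Proof.
move=> [Hd <-] e e0.
have : (fun k => k^-1 *: ((phi \o shift x) (k *: (1 : R)) - phi x)) @ 0^'
  --> 'D_1 phi x by exact: Hd.
move/cvgrPdist_le => /(_ e e0); rewrite /dnbhs near_withinE.
move=> /nbhs_ballP[r /= r0 H]; exists r => // k kr.
have [->|k0] := eqVneq k 0.
  by rewrite addr0 subrr mulr0 subr0 normr0 mulr0.
have := H k; rewrite /ball /= sub0r normrN => /(_ kr k0).
rewrite /= /GRing.scale /= mulr1 => h.
rewrite (_ : _ - _ = - k * ('D_1 phi x - k^-1 * (phi (k + x) - phi x))).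
  by rewrite normrM normrN mulrC ler_wpM2r.
by rewrite mulrBr mulNr mulrA mulNr divff// [x + k]addrC; ring.
Qed.

(** Outer functions of one real variable suffice: 1/f, log |f|^2 and the complex exponential are all
    assembled from real functions of |f|^2 or of real and imaginary parts. *)
Lemma wd_real_comp (r : C -> R) (phi : R -> R) z a b d :
  wd (fun w => (r w)%:C) z a b -> is_derive (r z) (1 : R) phi d ->
  wd (fun w => (phi (r w))%:C) z (d%:C * a) (d%:C * b).
Proof.
move=> Hr Hphi e e0.
have [K K0 [k k0 HK]] := wd_lip Hr.
have e2 : 0 < e / 2 / K by rewrite !divr_gt0.
have [s s0 Hs] := is_derive_eps Hphi e2.
have e3 : 0 < e / 2 / (`|d| + 1) by rewrite !divr_gt0// ltr_wpDl.
have [l l0 Hl] := Hr _ e3.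
exists (Num.min (Num.min k l) (s / K)).
  by rewrite !lt_min k0 l0 divr_gt0.
move=> h; rewrite !lt_min => /andP[/andP[/HK h1 /Hl h2]] hs.
pose q := r (z + h) - r z.
have qE : (q%:C : C) = (r (z + h))%:C - (r z)%:C by rewrite rmorphB.
rewrite -qE modulus_real in h1.
have /Hs h3 : `|q| < s.
  by rewrite (le_lt_trans h1)// mulrC -ltr_pdivlMr.
rewrite (_ : r z + q = r (z + h)) in h3; last by rewrite /q; ring.
rewrite (_ : _ - _ = (phi (r (z + h)) - phi (r z) - d * q)%:C +
  d%:C * ((r (z + h))%:C - (r z)%:C - (a * h + b * conjc h))); last first.
  by rewrite !rmorphB rmorphM /= qE; ring.
rewrite (splitr e) mulrDl (le_trans (le_modulusD _ _))// lerD//.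
  rewrite modulus_real (le_trans h3)//.
  rewrite (le_trans (ler_wpM2l (ltW e2) h1))// mulrA divfK ?gt_eqF//.
rewrite modulusM modulus_real (le_trans (ler_wpM2l _ h2))// mulrA ler_wpM2r//.
rewrite mulrCA ler_piMr ?divr_ge0 ?(ltW e0)// ler_pdivrMr ?mul1r ?ltr_wpDl//.
by rewrite lerDl.
Qed.

Lemma wd_ext_fun f g z a b : f =1 g -> wd f z a b -> wd g z a b.
Proof. by move=> /funext ->. Qed.

(** Uses 1/f = conj f / |f|^2: the real chain rule handles 1/|f|^2 and the product rule the rest. *)
Lemma wd_inv f z a b : f z != 0 -> wd f z a b ->
  wd (fun w => (f w)^-1) z (- a / f z ^+ 2) (- b / f z ^+ 2).
Proof.
move=> f0 Hf; have Hm := wd_modulus2 Hf.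
have m0 : modulus (f z) ^+ 2 != 0 by rewrite sqrf_eq0 modulus_eq0.
have D : is_derive (modulus (f z) ^+ 2) (1 : R) (fun x : R => x^-1)
  (- ((modulus (f z) ^+ 2) ^- 2)).
  by apply: is_derive_eq; [exact: is_deriveV|rewrite /GRing.scale/= mulr1].
have := wdM (wd_conj Hf) (wd_real_comp Hm D).
have c0 : conjc (f z) != 0 by rewrite conjc_eq0.
move=> H; have : wd (fun w => (f w)^-1) z
  (conjc b * ((modulus (f z) ^+ 2)^-1)%:C +
        conjc (f z) *
        ((- (modulus (f z) ^+ 2) ^- 2)%:C * (a * conjc (f z) + f z * conjc b)))
   (conjc a * ((modulus (f z) ^+ 2)^-1)%:C +
        conjc (f z) *
        ((- (modulus (f z) ^+ 2) ^- 2)%:C * (b * conjc (f z) + f z * conjc a))).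
  apply: wd_ext_fun H => w.
  (* At a zero of [f] both sides are 0, since inversion sends 0 to 0; the identity therefore holds
     at every point. *)
  have [->|w0] := eqVneq (f w) 0; first by rewrite conjc0 mul0r invr0.
  rewrite rmorphV/= ?unitfE ?sqrf_eq0 ?modulus_eq0// -mul_conj.
  by rewrite invfM mulrCA divff ?mulr1// conjc_eq0.
have E2 : (modulus (f z) ^+ 2 ^+ 2)%:C = (f z * conjc (f z)) ^+ 2.
  by rewrite mul_conj rmorphXn.
rewrite !rmorphN !fmorphV /= E2 -mul_conj.
by apply: wd_eq; field; rewrite f0 c0.
Qed.

Lemma eps_is_derive (phi : R -> R) (x d : R) :
  (forall e : R, 0 < e -> exists2 r : R, 0 < r & forall k, `|k| < r ->
   `|phi (x + k) - phi x - d * k| <= e * `|k|) -> is_derive x (1 : R) phi d.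
Proof.
move=> H.
have C : (fun k => k^-1 *: ((phi \o shift x) (k *: (1 : R)) - phi x)) @ 0^'
  --> d.
  apply/cvgrPdist_le => e e0; have [r r0 Hr] := H e e0.
  rewrite /dnbhs near_withinE; apply/nbhs_ballP; exists r => // k.
  rewrite /ball /= sub0r normrN => kr k0.
  have := Hr k kr; rewrite /= /GRing.scale /= mulr1 [x + k]addrC.
  rewrite -ler_pdivrMr ?normr_gt0// -normfV -normrM distrC [in _ <= e]mulrBl.
  by rewrite mulfK// [k^-1 * _]mulrC distrC.
split; first by apply/cvg_ex; exists d.
exact: cvg_lim.
Qed.

Lemma wd_derive_x f z a b : wd f z a b -> dx f z = a + b.
Proof.
move=> H; have zE : complex.Re z +i* complex.Im z = z by case: z {H}.
have tE t : (complex.Re z + t) +i* complex.Im z = z + t%:C.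
  by case: z {H zE} => x y; apply: complex_ext; rewrite ?cReD ?cImD //= addr0.
rewrite /dx !derive1E; apply: complex_ext => /=.
  apply: derive_val; apply: eps_is_derive => e e0.
  have [d d0 Hd] := H e e0; exists d => // k kd.
  rewrite -modulus_real in kd; rewrite tE zE -[`|k|]modulus_real.
  apply: le_trans (Hd _ kd); apply: le_trans (Re_le_modulus _).
  rewrite le_eqVlt; apply/orP; left; apply/eqP; congr (`| _ |).
  by rewrite !(cReD, cReN, cReM, cImD, cImN, cImM) /=; ring.
apply: derive_val; apply: eps_is_derive => e e0.
have [d d0 Hd] := H e e0; exists d => // k kd.
rewrite -modulus_real in kd; rewrite tE zE -[`|k|]modulus_real.
apply: le_trans (Hd _ kd); apply: le_trans (Im_le_modulus _).
rewrite le_eqVlt; apply/orP; left; apply/eqP; congr (`| _ |).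
by rewrite !(cReD, cReN, cReM, cImD, cImN, cImM) /=; ring.
Qed.

Lemma wd_derive_y f z a b : wd f z a b -> dy f z = 'i%C * (a - b).
Proof.
move=> H; have zE : complex.Re z +i* complex.Im z = z by case: z {H}.
have tE t : complex.Re z +i* (complex.Im z + t) = z + 'i%C * t%:C.
  by case: z {H zE} => x y; apply: complex_ext;
    rewrite !(cReD, cImD, cReM, cImM) /=; ring.
have mE (t : R) : modulus ('i%C * t%:C) = `|t|.
  by rewrite modulusM modulus_i mul1r modulus_real.
rewrite /dy !derive1E; apply: complex_ext => /=.
  apply: derive_val; apply: eps_is_derive => e e0.
  have [d d0 Hd] := H e e0; exists d => // k kd.
  rewrite -mE in kd; rewrite tE zE -[`|k|]mE.
  apply: le_trans (Hd _ kd); apply: le_trans (Re_le_modulus _).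
  rewrite le_eqVlt; apply/orP; left; apply/eqP; congr (`| _ |).
  by rewrite rmorphM /= !(cReD, cReN, cReM, cImD, cImN, cImM) /=; ring.
apply: derive_val; apply: eps_is_derive => e e0.
have [d d0 Hd] := H e e0; exists d => // k kd.
rewrite -mE in kd; rewrite tE zE -[`|k|]mE.
apply: le_trans (Hd _ kd); apply: le_trans (Im_le_modulus _).
rewrite le_eqVlt; apply/orP; left; apply/eqP; congr (`| _ |).
by rewrite rmorphM /= !(cReD, cReN, cReM, cImD, cImN, cImM) /=; ring.
Qed.

(** Solves dx f = a + b and dy f = i (a - b) for a. With it the operators of the statement, built on
    [derive1], are computed through [wd], which guarantees that the partial derivatives exist. *)
Lemma wd_dd f z a b : wd f z a b -> dd f z = a.
Proof.
move=> H; rewrite /dd (wd_derive_x H) (wd_derive_y H) mulrA -expr2 sqr_i.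
by field.
Qed.

Lemma wd_ddbar f z a b : wd f z a b -> ddbar f z = b.
Proof.
move=> H; rewrite /ddbar (wd_derive_x H) (wd_derive_y H) mulrA -expr2 sqr_i.
by field.
Qed.

Lemma wd_derivable f z a : wd f z a 0 -> derivable (f : C^o -> C^o) z 1.
Proof.
move=> H; apply/cvg_ex; exists a; apply/cvgrPdist_le => e e0.
(* The generic norm on [C] takes values in [C], so this [e] is a complex number; being positive, it
   is real. *)
have [d' dE] : exists d' : R, e = d'%:C.
  by apply/complex_realP; rewrite gtr0_real.
move: e0; rewrite dE ltcR => e0; have [r r0 Hr] := H _ e0.
rewrite /dnbhs near_withinE; apply/nbhs_ballP; exists r%:C; first by rewrite /= ltcR.
move=> k; rewrite /ball /= sub0r normrN normE ltcR => kr k0.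
have := Hr k kr; rewrite addrC /= /GRing.scale /= mulr1 normE lecR.
rewrite -ler_pdivrMr ?modulus_gt0// -modulusV -modulusM modulusBC => h.
rewrite (le_trans _ h)// le_eqVlt; apply/orP; left; apply/eqP; congr modulus.
by rewrite mul0r addr0 [- _ + _]addrC [RHS]mulrBl mulfK// [k + z]addrC [k^-1 * _]mulrC.
Qed.

Lemma derivable_wd f z : derivable (f : C^o -> C^o) z 1 ->
  exists a, wd f z a 0.
Proof.
move=> /cvg_ex [a Ha]; exists a => e e0.
move/cvgrPdist_le: Ha => /(_ e%:C); rewrite ltcR => /(_ e0).
rewrite /dnbhs near_withinE => /nbhs_ballP[r /= r0 H].
have [r' rE] : exists r' : R, r = r'%:C.
  by apply/complex_realP; rewrite gtr0_real.
move: r0 H; rewrite rE ltcR => r0 H; exists r' => // k kr.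
have [->|k0] := eqVneq k 0.
  by rewrite addr0 subrr conjc0 !mulr0 addr0 subrr modulus0 mulr0.
have := H k; rewrite /ball /= sub0r normrN normE ltcR => /(_ kr k0).
rewrite normE lecR /= /GRing.scale /= mulr1 => h.
rewrite (_ : _ - _ = - k * (a - k^-1 * (f (k + z) - f z))).
  by rewrite modulusM modulusN mulrC ler_wpM2r.
by rewrite [k + z]addrC; field.
Qed.

End Wirtinger.

(** * Curve integrals and Goursat's theorem *)

Section Bisection.
Variable R : realType.

(** The left endpoints increase and stay below every right endpoint, so their supremum lies in all
    the intervals. *)
Let nested_point (u : nat -> R) (q : nat -> R) :
  (forall n, u n <= u n.+1) -> (forall n, u n.+1 + q n.+1 <= u n + q n) ->
  (forall n, 0 <= q n) -> exists x, forall n, u n <= x <= u n + q n.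
Proof.
move=> u1 u2 q0.
have mu : {homo u : m n / (m <= n)%N >-> m <= n}.
  by apply: homo_leq u1 => // ? ? ?; exact: le_trans.
have mv : {homo (fun n => u n + q n) : m n / (m <= n)%N >-> n <= m}.
  by apply: homo_leq u2 => // y x z xy yz; exact: le_trans yz xy.
have uv m n : u m <= u n + q n.
  rewrite (le_trans (mu _ _ (leq_maxl m n)))//.
  by rewrite (le_trans _ (mv _ _ (leq_maxr m n)))// lerDl.
exists (sup (range u)) => n; apply/andP; split.
  apply: ub_le_sup; last by exists n.
  by exists (u 0 + q 0) => _ [m _ <-].
by apply: ge_sup; [exists (u 0), 0%N|move=> _ [m _ <-]].
Qed.

(** Goursat's argument with the integrals stripped off. If J of the unit square were positive, one
    quarter of each square would carry at least a quarter of its value, so J of the n-th square is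
    at least J(unit) times its area. Near the common point of the squares this contradicts the
    second hypothesis. *)
Lemma square_bisection (J : R -> R -> R -> R) :
  (forall a c l, 0 < l -> 0 <= a -> a + l <= 1 -> 0 <= c -> c + l <= 1 ->
     J a c l <= J a c (l / 2) + J (a + l / 2) c (l / 2) +
       J a (c + l / 2) (l / 2) + J (a + l / 2) (c + l / 2) (l / 2)) ->
  (forall x y, 0 <= x <= 1 -> 0 <= y <= 1 -> forall e, 0 < e ->
     exists2 d, 0 < d & forall a c l, 0 < l -> l < d ->
       0 <= a -> a + l <= 1 -> 0 <= c -> c + l <= 1 ->
       a <= x <= a + l -> c <= y <= c + l -> J a c l <= e * l ^+ 2) ->
  J 0 0 1 <= 0.
Proof.
move=> Jsub Jloc; rewrite leNgt; apply/negP => j0.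
pose l (n : nat) : R := 2^-1 ^+ n.
have l0 n : 0 < l n by rewrite exprn_gt0.
have lS n : l n.+1 = l n / 2 by rewrite /l exprS mulrC.
pose ok n (p : R * R) :=
  [/\ 0 <= p.1, p.1 + l n <= 1, 0 <= p.2 & p.2 + l n <= 1].
(* Keeping [ok] under the existential makes the relation total, as [choice] demands; [(0, 0)] below
   is a dummy value. *)
have step (np : nat * (R * R)) : exists q : R * R, ok np.1 np.2 ->
    [/\ q.1 = np.2.1 \/ q.1 = np.2.1 + l np.1.+1,
        q.2 = np.2.2 \/ q.2 = np.2.2 + l np.1.+1 &
        J np.2.1 np.2.2 (l np.1) <= 4 * J q.1 q.2 (l np.1.+1)].
  case: np => n [a c] /=.
  have [[a0 al c0 cl]|] := pselect (ok n (a, c)); last by exists (0, 0).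
  rewrite lS; have := Jsub _ _ _ (l0 n) a0 al c0 cl.
  rewrite /= => H.
  have [h1|h1] := leP (J a c (l n)) (4 * J a c (l n / 2)).
    by exists (a, c) => _; split; [left|left|].
  have [h2|h2] := leP (J a c (l n)) (4 * J (a + l n / 2) c (l n / 2)).
    by exists (a + l n / 2, c) => _; split; [right|left|].
  have [h3|h3] := leP (J a c (l n)) (4 * J a (c + l n / 2) (l n / 2)).
    by exists (a, c + l n / 2) => _; split; [left|right|].
  have [h4|h4] :=
    leP (J a c (l n)) (4 * J (a + l n / 2) (c + l n / 2) (l n / 2)).
    by exists (a + l n / 2, c + l n / 2) => _; split; [right|right|].
  by exfalso; lra.
have [f Hf] := choice step.
pose u := fix u n := if n is m.+1 then f (m, u m) else (0 : R, 0 : R).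
have hok n : ok n (u n).
  elim: n => [|n IH]; first by split; rewrite /= /l ?expr0 ?add0r.
  have [+ + _] := Hf (n, u n) IH; rewrite /= -/(u n.+1).
  move: IH (l0 n) (lS n) => [/= h1 h2 h3 h4] ln lSn H1 H2.
  split; rewrite -/(u n.+1).
  - by case: H1 => ->; lra.
  - by case: H1 => ->; lra.
  - by case: H2 => ->; lra.
  - by case: H2 => ->; lra.
have H1 n : (u n).1 <= (u n.+1).1 /\ (u n.+1).1 + l n.+1 <= (u n).1 + l n.
  have [+ _ _] := Hf (n, u n) (hok n); rewrite /= lS; have := l0 n.
  by move=> ? [] ->; split; lra.
have H2 n : (u n).2 <= (u n.+1).2 /\ (u n.+1).2 + l n.+1 <= (u n).2 + l n.
  have [_ + _] := Hf (n, u n) (hok n); rewrite /= lS; have := l0 n.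
  by move=> ? [] ->; split; lra.
have HJ n : J 0 0 1 * l n ^+ 2 <= J (u n).1 (u n).2 (l n).
  elim: n => [|n IH]; first by rewrite /l !expr0 expr1n mulr1.
  have [_ _ /=] := Hf (n, u n) (hok n); rewrite -/(u n.+1) => H.
  rewrite lS expr_div_n; move: IH; rewrite lS in H; lra.
have [x Hx] := nested_point (fun n => (H1 n).1) (fun n => (H1 n).2)
  (fun n => ltW (l0 n)).
have [y Hy] := nested_point (fun n => (H2 n).1) (fun n => (H2 n).2)
  (fun n => ltW (l0 n)).
have x01 : 0 <= x <= 1 by have := Hx 0; rewrite /= /l expr0 add0r.
have y01 : 0 <= y <= 1 by have := Hy 0; rewrite /= /l expr0 add0r.
(* Any positive constant below [J 0 0 1] in the local bound contradicts [HJ]. *)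
have j2 : 0 < J 0 0 1 / 2 by rewrite divr_gt0.
have [d d0 Hd] := Jloc x y x01 y01 _ j2.
have : l @ \oo --> (0 : R).
  by apply: cvg_expr; rewrite ger0_norm//; lra.
move=> /cvgrPdist_lt /(_ d d0)[N _ /(_ N (leqnn _))] /=.
rewrite sub0r normrN gtr0_norm// => lN.
have [h1 h2 h3 h4] := hok N.
have := Hd _ _ _ (l0 N) lN h1 h2 h3 h4 (Hx N) (Hy N).
move/(le_trans (HJ N)); rewrite ler_pM2r ?exprn_gt0//.
by lra.
Qed.

End Bisection.

Section Curves.
Variable R : realType.
Local Notation C := R[i].
Local Notation mu := (@lebesgue_measure R).
Implicit Types (g G : R -> C) (f : C -> C) (t : R).

Definition cderiv G t (d : C) :=
  is_derive t (1 : R) (fun x => complex.Re (G x)) (complex.Re d) /\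
  is_derive t (1 : R) (fun x => complex.Im (G x)) (complex.Im d).

Lemma cderiv_eq G t d d' : d = d' -> cderiv G t d -> cderiv G t d'.
Proof. by move=> ->. Qed.

Lemma cderiv_cst (c : C) t : cderiv (fun=> c) t 0.
Proof. by split; exact: is_derive_cst. Qed.

Lemma cderiv_id t : cderiv (fun x => x%:C) t 1.
Proof. by split => /=; [exact: is_derive_id|exact: is_derive_cst]. Qed.

Lemma cderivD G H t d d' : cderiv G t d -> cderiv H t d' ->
  cderiv (fun x => G x + H x) t (d + d').
Proof.
move=> [G1 G2] [H1 H2]; split.
  rewrite cReD (_ : (fun x => _) = (fun x => complex.Re (G x)) +
    (fun x => complex.Re (H x))); first exact: is_deriveD.
  by apply/funext => x; rewrite cReD.
rewrite cImD (_ : (fun x => _) = (fun x => complex.Im (G x)) +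
  (fun x => complex.Im (H x))); first exact: is_deriveD.
by apply/funext => x; rewrite cImD.
Qed.

Lemma cderivM G H t d d' : cderiv G t d -> cderiv H t d' ->
  cderiv (fun x => G x * H x) t (d * H t + G t * d').
Proof.
move=> [G1 G2] [H1 H2]; split.
  rewrite (_ : (fun x => _) = (fun x => complex.Re (G x)) *
    (fun x => complex.Re (H x)) - (fun x => complex.Im (G x)) *
    (fun x => complex.Im (H x))); last by apply/funext => x; rewrite cReM.
  apply: (is_derive_eq (is_deriveB (is_deriveM G1 H1) (is_deriveM G2 H2))).
  by rewrite cReD !cReM /GRing.scale /=; ring.
rewrite (_ : (fun x => _) = (fun x => complex.Re (G x)) *
  (fun x => complex.Im (H x)) + (fun x => complex.Im (G x)) *
  (fun x => complex.Re (H x))); last by apply/funext => x; rewrite cImM.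
apply: (is_derive_eq (is_deriveD (is_deriveM G1 H2) (is_deriveM G2 H1))).
by rewrite cImD !cImM /GRing.scale /=; ring.
Qed.

Lemma cderivZ (c : C) G t d : cderiv G t d ->
  cderiv (fun x => c * G x) t (c * d).
Proof.
move=> H; have := cderivM (cderiv_cst c t) H.
by apply: cderiv_eq; rewrite mul0r add0r.
Qed.

Definition expi t : C := cos t +i* sin t.

Lemma modulus_expi t : modulus (expi t) = 1.
Proof. by rewrite /modulus /= cos2Dsin2 sqrtr1. Qed.

Lemma expiD s t : expi (s + t) = expi s * expi t.
Proof.
by apply: complex_ext; rewrite ?(cReM, cImM) /= ?cosD ?sinD //; ring.
Qed.

Lemma expi0 : expi 0 = 1.
Proof. by rewrite /expi cos0 sin0. Qed.

Lemma expi2pi : expi (2 * pi) = 1.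
Proof.
by rewrite /expi mulr_natl cos2pi sin2pi.
Qed.

Lemma expi_neq0 t : expi t != 0.
Proof. by rewrite -modulus_eq0 modulus_expi oner_eq0. Qed.

Lemma expiMn t n : expi (t *+ n) = expi t ^+ n.
Proof.
elim: n => [|n IH]; first by rewrite mulr0n expi0 expr0.
by rewrite mulrS expiD IH exprS.
Qed.

Lemma cderiv_expi (k : R) t :
  cderiv (fun x => expi (k * x)) t (k%:C * 'i%C * expi (k * t)).
Proof.
have D : is_derive t (1 : R) (fun x => k * x) k.
  rewrite (_ : (fun x => _) = k *: (id : R -> R))//.
  by apply: is_derive_eq; rewrite /GRing.scale /= mulr1.
split.
  have := @is_derive1_comp R cos (fun x => k * x) t (- sin (k * t)) k.
  rewrite /=; move=> /(_ (is_derive_cos _) D) H.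
  by apply: (is_derive_eq H); rewrite /=; ring.
have := @is_derive1_comp R sin (fun x => k * x) t (cos (k * t)) k.
rewrite /=; move=> /(_ (is_derive_sin _) D) H.
by apply: (is_derive_eq H); rewrite /=; ring.
Qed.

Definition ccont g t := forall e : R, 0 < e -> exists2 d : R, 0 < d &
  forall k, `|k| < d -> modulus (g (t + k) - g t) <= e.

Lemma ccont_Re g t : ccont g t -> {for t, continuous (fun x => complex.Re (g x))}.
Proof.
move=> H; apply/cvgrPdist_le => e e0; have [d d0 Hd] := H e e0.
apply/nbhs_ballP; exists d => // x; rewrite /ball /= distrC => xd.
have := Hd _ xd; rewrite [t + _]addrC subrK => h; rewrite distrC.
by rewrite -cReN -cReD (le_trans (Re_le_modulus _)).
Qed.

Lemma ccont_Im g t : ccont g t -> {for t, continuous (fun x => complex.Im (g x))}.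
Proof.
move=> H; apply/cvgrPdist_le => e e0; have [d d0 Hd] := H e e0.
apply/nbhs_ballP; exists d => // x; rewrite /ball /= distrC => xd.
have := Hd _ xd; rewrite [t + _]addrC subrK => h; rewrite distrC.
by rewrite -cImN -cImD (le_trans (Im_le_modulus _)).
Qed.

Lemma ccont_comp f g t : ccont g t ->
  (forall e : R, 0 < e -> exists2 d : R, 0 < d &
     forall h, modulus h < d -> modulus (f (g t + h) - f (g t)) <= e) ->
  ccont (fun x => f (g x)) t.
Proof.
move=> Hg Hf e e0; have [d d0 Hd] := Hf e e0.
have d2 : 0 < d / 2 by rewrite divr_gt0.
have [r r0 Hr] := Hg _ d2; exists r => // k kr.
rewrite -(subrK (g t) (g (t + k))) [_ - g t + _]addrC; apply: Hd.
by rewrite (le_lt_trans (Hr _ kr))//; lra.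
Qed.

Lemma ccont_cst (c : C) t : ccont (fun=> c) t.
Proof. by move=> e e0; exists 1 => // k _; rewrite subrr modulus0 ltW. Qed.

Lemma ccontD g h t : ccont g t -> ccont h t -> ccont (fun x => g x + h x) t.
Proof.
move=> Hg Hh e e0; have e2 : 0 < e / 2 by rewrite divr_gt0.
have [r r0 Hr] := Hg _ e2; have [s s0 Hs] := Hh _ e2.
exists (Num.min r s); first by rewrite lt_min r0.
move=> k; rewrite lt_min => /andP[/Hr h1 /Hs h2].
rewrite opprD addrACA (le_trans (le_modulusD _ _))//; lra.
Qed.

Lemma ccontM g h t : ccont g t -> ccont h t -> ccont (fun x => g x * h x) t.
Proof.
move=> Hg Hh e e0; pose M := modulus (g t) + modulus (h t) + 1.
have M0 : 0 < M by rewrite ltr_wpDl ?addr_ge0.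
pose e' := Num.min 1 (e / M).
have e'0 : 0 < e' by rewrite lt_min ltr01 divr_gt0.
have [r r0 Hr] := Hg _ e'0; have [s s0 Hs] := Hh _ e'0.
exists (Num.min r s); first by rewrite lt_min r0.
move=> k; rewrite lt_min => /andP[/Hr h1 /Hs h2].
rewrite (_ : _ - _ = (g (t + k) - g t) * (h (t + k) - h t) +
   (g (t + k) - g t) * h t + g t * (h (t + k) - h t)); last by ring.
rewrite (le_trans (le_modulusD _ _))//.
rewrite (@le_trans _ _ (e' * 1 + e' * modulus (h t) + modulus (g t) * e'))//.
  rewrite lerD ?modulusM ?ler_wpM2l//.
  rewrite (le_trans (le_modulusD _ _))// lerD ?modulusM ?ler_wpM2r//.
  by rewrite ler_pM// (le_trans h2)// /e' ge_min lexx.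
rewrite (_ : _ + _ = e' * M); last by rewrite /M; ring.
by rewrite -ler_pdivlMr// /e' ge_min lexx orbT.
Qed.

Lemma cderiv_eps G t d : cderiv G t d -> forall e : R, 0 < e ->
  exists2 r : R, 0 < r & forall k, `|k| < r ->
   modulus (G (t + k) - G t - d * k%:C) <= e * `|k|.
Proof.
move=> [H1 H2] e e0; have e2 : 0 < e / 2 by rewrite divr_gt0.
have [r r0 Hr] := is_derive_eps H1 e2; have [s s0 Hs] := is_derive_eps H2 e2.
exists (Num.min r s); first by rewrite lt_min r0.
move=> k; rewrite lt_min => /andP[/Hr h1 /Hs h2].
rewrite (le_trans (modulus_le_ReIm _))//.
rewrite (splitr e) mulrDl.
have -> : complex.Re (G (t + k) - G t - d * k%:C) =
  complex.Re (G (t + k)) - complex.Re (G t) - complex.Re d * k.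
  by rewrite !(cReD, cReN, cReM) /=; ring.
have -> : complex.Im (G (t + k) - G t - d * k%:C) =
  complex.Im (G (t + k)) - complex.Im (G t) - complex.Im d * k.
  by rewrite !(cImD, cImN, cImM) /=; ring.
exact: lerD.
Qed.

Lemma cderiv_ccont G t d : cderiv G t d -> ccont G t.
Proof.
move=> HG e e0; have [r r0 Hr] := cderiv_eps HG ltr01.
exists (Num.min r (e / (1 + modulus d))).
  by rewrite lt_min r0 divr_gt0// ltr_pwDl.
move=> k; rewrite lt_min => /andP[/Hr h1 h2].
rewrite -(subrK (d * k%:C) (_ - _)) (le_trans (le_modulusD _ _))//.
move: h2; rewrite ltr_pdivlMr ?ltr_pwDl// => h2.
rewrite modulusM modulus_real (le_trans _ (ltW h2))// mulrDr lerD//.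
  by rewrite mulr1 (le_trans h1)// mul1r.
by rewrite mulrC.
Qed.

Definition cint (a b : R) g : C :=
  (\int[mu]_(t in `[a, b]) complex.Re (g t)) +i*
  (\int[mu]_(t in `[a, b]) complex.Im (g t)).

Lemma eq_cint a b g h : (forall t, a <= t <= b -> g t = h t) ->
  cint a b g = cint a b h.
Proof.
move=> gh; congr (_ +i* _); apply: eq_Rintegral => t;
  by rewrite inE /= in_itv /= => /gh ->.
Qed.

Let within_itv (g : R -> R) a b :
  (forall t, a <= t <= b -> {for t, continuous g}) ->
  {within `[a, b], continuous g}.
Proof.
move=> H; apply: continuous_in_subspaceT => t; rewrite inE /= in_itv /=.
exact: H.
Qed.

Let itg (g : R -> R) a b :
  (forall t, a <= t <= b -> {for t, continuous g}) ->
  mu.-integrable `[a, b] (EFin \o g).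
Proof.
move=> H; apply: continuous_compact_integrable; first exact: segment_compact.
exact: within_itv.
Qed.

(** The continuity is two-sided even at the endpoints, since curves are functions on the whole
    line. *)
Definition ccont_on a b g := forall t, a <= t <= b -> ccont g t.

Lemma cintD a b g h : ccont_on a b g -> ccont_on a b h ->
  cint a b (fun t => g t + h t) = cint a b g + cint a b h.
Proof.
move=> Hg Hh; apply: complex_ext => /=.
  under eq_Rintegral do rewrite cReD.
  by rewrite RintegralD//; apply: itg => t /[dup] /Hg ? /Hh ?; exact: ccont_Re.
under eq_Rintegral do rewrite cImD.
by rewrite RintegralD//; apply: itg => t /[dup] /Hg ? /Hh ?; exact: ccont_Im.
Qed.

Lemma cintZ a b (c : C) g : ccont_on a b g ->
  cint a b (fun t => c * g t) = c * cint a b g.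
Proof.
move=> Hg.
have I1 : mu.-integrable `[a, b] (EFin \o (fun t => complex.Re (g t))).
  by apply: itg => t /Hg; exact: ccont_Re.
have I2 : mu.-integrable `[a, b] (EFin \o (fun t => complex.Im (g t))).
  by apply: itg => t /Hg; exact: ccont_Im.
have Z (k : R) (u : R -> R) : mu.-integrable `[a, b] (EFin \o u) ->
   mu.-integrable `[a, b] (EFin \o (fun t => k * u t)).
  move=> Iu; rewrite (_ : _ \o _ = (fun t => k%:E * (u t)%:E)%E); last first.
    by apply/funext => t /=; rewrite EFinM.
  exact: integrableZl.
apply: complex_ext => /=.
  under eq_Rintegral do rewrite cReM.
  rewrite RintegralB//; [|exact: Z|exact: Z].
  by rewrite !RintegralZl// cReM.
under eq_Rintegral do rewrite cImM.
rewrite RintegralD//; [|exact: Z|exact: Z].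
by rewrite !RintegralZl// cImM.
Qed.

Lemma cint_split a c b g : a <= c -> c <= b -> ccont_on a b g ->
  cint a b g = cint a c g + cint c b g.
Proof.
move=> ac cb Hg.
have S (u : R -> R) : (forall t, a <= t <= b -> {for t, continuous u}) ->
  \int[mu]_(t in `[a, b]) u t =
  \int[mu]_(t in `[a, c]) u t + \int[mu]_(t in `[c, b]) u t.
  move=> Hu; have := @Rintegral_itvB R u (BLeft a) (BRight b) c (itg Hu).
  rewrite !bnd_simp => /(_ ac cb) /eqP; rewrite subr_eq => /eqP ->.
  rewrite addrC; congr (_ + _).
  apply: Rintegral_itv_obnd_cbnd; apply: integrableS (itg Hu) => //.
  apply: subset_itv; rewrite bnd_simp//.
apply: complex_ext => /=; apply: S => t /Hg; [exact: ccont_Re|exact: ccont_Im].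
Qed.

(** The factor 2 is the price of bounding real and imaginary parts separately. *)
Lemma le_modulus_cint a b g (M : R) : a <= b -> ccont_on a b g ->
  (forall t, a <= t <= b -> modulus (g t) <= M) ->
  modulus (cint a b g) <= 2 * M * (b - a).
Proof.
move=> ab Hg HM.
have B (u : R -> R) : (forall t, a <= t <= b -> {for t, continuous u}) ->
  (forall t, a <= t <= b -> `|u t| <= M) ->
  `| \int[mu]_(t in `[a, b]) u t | <= M * (b - a).
  move=> Hu uM; rewrite (le_trans (le_normr_Rintegral _ (itg Hu)))//.
  have mab : mu `[a, b] = (b - a)%:E.
    rewrite lebesgue_measure_itv /= lte_fin.
    by case: ltP => // ba; rewrite (_ : b = a) ?subrr//; lra.
  apply: (@le_trans _ _ (\int[mu]_(t in `[a, b]) M)).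
    apply: le_Rintegral => //.
    - exact: integrable_norm (itg Hu).
    - by apply: itg => t _; exact: cvg_cst.

  rewrite Rintegral_cst//.
  by rewrite [X in fine X]mab.
rewrite (le_trans (modulus_le_ReIm _))//= -mulrA mulr_natl mulr2n lerD//.
  apply: B => t /[dup] tab /Hg => [|_]; first exact: ccont_Re.
  exact: le_trans (Re_le_modulus _) (HM _ tab).
apply: B => t /[dup] tab /Hg => [|_]; first exact: ccont_Im.
exact: le_trans (Im_le_modulus _) (HM _ tab).
Qed.

Lemma cint_FTC a b g G : a < b -> ccont_on a b g ->
  (forall t, a <= t <= b -> cderiv G t (g t)) ->
  cint a b g = G b - G a.
Proof.
move=> ab Hg HG.
have F (u U : R -> R) : (forall t, a <= t <= b -> {for t, continuous u}) ->
    (forall t, a <= t <= b -> is_derive t (1 : R) U (u t)) ->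
    \int[mu]_(t in `[a, b]) u t = U b - U a.
  move=> Hu HU; rewrite /Rintegral (@continuous_FTC2 _ u U)//.
  - exact: within_itv.
  - split.
    + by move=> t; rewrite in_itv /= => /andP[/ltW h1 /ltW h2];
        case: (HU t) => //; rewrite h1.
    + apply: cvg_at_right_filter; apply: differentiable_continuous.
      by apply/derivable1_diffP; case: (HU a) => //; rewrite lexx ltW.
    + apply: cvg_at_left_filter; apply: differentiable_continuous.
      by apply/derivable1_diffP; case: (HU b) => //; rewrite lexx ltW.
  - move=> t; rewrite in_itv /= => /andP[/ltW h1 /ltW h2].
    by rewrite derive1E; apply: derive_val; apply: HU; rewrite h1.
apply: complex_ext; rewrite ?(cReD, cImD, cReN, cImN) /=.
  apply: (F _ (fun t => complex.Re (G t))); first by move=> t /Hg; exact: ccont_Re.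
  by move=> t /HG [].
apply: (F _ (fun t => complex.Im (G t))); first by move=> t /Hg; exact: ccont_Im.
by move=> t /HG [].
Qed.

End Curves.

Section Goursat.
Variable R : realType.
Local Notation C := R[i].

Lemma cderiv_lip (G G' : R -> C) (M a b : R) : a <= b ->
  (forall t, a <= t <= b -> cderiv G t (G' t)) -> ccont_on a b G' ->
  (forall t, a <= t <= b -> modulus (G' t) <= M) ->
  modulus (G b - G a) <= 2 * M * (b - a).
Proof.
rewrite le_eqVlt => /predU1P[->|ab] HG cG HM.
  by rewrite !subrr modulus0 mulr0.
by rewrite -(cint_FTC ab cG HG) le_modulus_cint// ltW.
Qed.

(* Affine integrands are exact, so only the deviation from one contributes. *)
Lemma cint_affine_approx (g : C -> C) (G G' : R -> C) (A B : C) (a b K M : R) :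
  a < b -> (forall t, a <= t <= b -> cderiv G t (G' t)) ->
  ccont_on a b G' -> ccont_on a b (fun t => g (G t)) ->
  (forall t, a <= t <= b -> modulus (g (G t) - (A + B * G t)) <= K) ->
  (forall t, a <= t <= b -> modulus (G' t) <= M) ->
  modulus (cint a b (fun t => g (G t) * G' t) -
    ((A * G b + B / 2 * (G b * G b)) - (A * G a + B / 2 * (G a * G a)))) <=
  2 * (K * M) * (b - a).
Proof.
move=> ab HG cG' cg gK GM.
have cG : ccont_on a b G by move=> t /HG; exact: cderiv_ccont.
have cA : ccont_on a b (fun t => (A + B * G t) * G' t).
  move=> t tab; apply: ccontM (cG' _ tab); apply: ccontD; first exact: ccont_cst.
  by apply: ccontM (cG _ tab); exact: ccont_cst.
have cE : ccont_on a b (fun t => (g (G t) - (A + B * G t)) * G' t).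
  move=> t tab; apply: ccontM (cG' _ tab).
  have := ccontD (cg _ tab) (ccontM (@ccont_cst R (-1) t)
    (ccontD (@ccont_cst R A t) (ccontM (@ccont_cst R B t) (cG _ tab)))).
  by rewrite (_ : (fun _ => _) = fun t => g (G t) - (A + B * G t))//;
    apply/funext => s; rewrite mulN1r.
rewrite (@eq_cint _ a b _ (fun t => (g (G t) - (A + B * G t)) * G' t +
   (A + B * G t) * G' t)); last by move=> t _; rewrite -mulrDl subrK.
rewrite (cintD cE cA).
rewrite (@cint_FTC _ a b (fun t => (A + B * G t) * G' t)
  (fun t => A * G t + B / 2 * (G t * G t)))//.
  rewrite addrK; apply: le_modulus_cint => //; first exact: ltW.
  move=> t tab; rewrite modulusM ler_pM//; [exact: gK|exact: GM].
move=> t tab; have := cderivD (cderivZ A (HG t tab))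
  (cderivZ (B / 2) (cderivM (HG t tab) (HG t tab))).
by apply: cderiv_eq; field.
Qed.

Lemma ccont_wd (g : C -> C) (G : R -> C) t : ccont G t ->
  (exists a b, wd g (G t) a b) -> ccont (fun x => g (G x)) t.
Proof.
move=> cG [a [b Ha]]; apply: ccont_comp => // e e0.
have [K K0 [d d0 Hd]] := wd_lip Ha.
exists (Num.min d (e / K)); first by rewrite lt_min d0 divr_gt0.
move=> h; rewrite lt_min => /andP[/Hd h1 h2]; rewrite (le_trans h1)//.
by rewrite mulrC -ler_pdivlMr// ltW.
Qed.

Variables (phi phis phit : R -> R -> C) (M : R) (g : C -> C).
Hypotheses (M0 : 0 < M)
  (Hs : forall s t, 0 <= s <= 1 -> 0 <= t <= 1 ->
     cderiv (fun x => phi x t) s (phis s t))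
  (Ht : forall s t, 0 <= s <= 1 -> 0 <= t <= 1 ->
     cderiv (fun x => phi s x) t (phit s t))
  (Cs : forall s t, 0 <= s <= 1 -> 0 <= t <= 1 -> ccont (fun x => phis x t) s)
  (Ct : forall s t, 0 <= s <= 1 -> 0 <= t <= 1 -> ccont (fun x => phit s x) t)
  (Bs : forall s t, 0 <= s <= 1 -> 0 <= t <= 1 -> modulus (phis s t) <= M)
  (Bt : forall s t, 0 <= s <= 1 -> 0 <= t <= 1 -> modulus (phit s t) <= M)
  (Hg : forall s t, 0 <= s <= 1 -> 0 <= t <= 1 -> exists a, wd g (phi s t) a 0).

Let hedge c a b := cint a b (fun s => g (phi s c) * phis s c).
Let vedge c a b := cint a b (fun t => g (phi c t) * phit c t).

(** The integral of g(z) dz along the image under [phi] of the boundary of the square with lower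
    left corner (a, c) and side l, taken counterclockwise. *)
Let J a c l := hedge c a (a + l) + vedge (a + l) c (c + l)
  - hedge (c + l) a (a + l) - vedge a c (c + l).

Let Cg (G : R -> C) t : ccont G t -> (exists a, wd g (G t) a 0) ->
  ccont (fun x => g (G x)) t.
Proof. by move=> cG [a Ha]; apply: ccont_wd => //; exists a, 0. Qed.

Let Chg s c : 0 <= s <= 1 -> 0 <= c <= 1 -> ccont (fun s => g (phi s c)) s.
Proof. by move=> h1 h2; apply: Cg; [apply: cderiv_ccont; exact: Hs|exact: Hg]. Qed.

Let Cvg s c : 0 <= s <= 1 -> 0 <= c <= 1 -> ccont (fun t => g (phi s t)) c.
Proof. by move=> h1 h2; apply: Cg; [apply: cderiv_ccont; exact: Ht|exact: Hg]. Qed.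

Let hsplit c a m b : 0 <= a -> a <= m -> m <= b -> b <= 1 -> 0 <= c <= 1 ->
  hedge c a b = hedge c a m + hedge c m b.
Proof.
move=> a0 am mb b1 c01; apply: cint_split => // s /andP[s0 s1].
have s01 : 0 <= s <= 1 by apply/andP; split; lra.
by apply: ccontM; [exact: Chg|exact: Cs].
Qed.

Let vsplit c a m b : 0 <= a -> a <= m -> m <= b -> b <= 1 -> 0 <= c <= 1 ->
  vedge c a b = vedge c a m + vedge c m b.
Proof.
move=> a0 am mb b1 c01; apply: cint_split => // s /andP[s0 s1].
have s01 : 0 <= s <= 1 by apply/andP; split; lra.
by apply: ccontM; [exact: Cvg|exact: Ct].
Qed.

Let Jsub a c l : 0 < l -> 0 <= a -> a + l <= 1 -> 0 <= c -> c + l <= 1 ->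
  J a c l = J a c (l / 2) + J (a + l / 2) c (l / 2) +
       J a (c + l / 2) (l / 2) + J (a + l / 2) (c + l / 2) (l / 2).
Proof.
move=> l0 a0 al c0 cl; rewrite /J.
have <- : a + l = a + l / 2 + l / 2 by lra.
have <- : c + l = c + l / 2 + l / 2 by lra.
have [a1 a2] : a <= a + l / 2 /\ a + l / 2 <= a + l by split; lra.
have [c1 c2] : c <= c + l / 2 /\ c + l / 2 <= c + l by split; lra.
have a01 : 0 <= a <= 1 by apply/andP; split; lra.
have c01 : 0 <= c <= 1 by apply/andP; split; lra.
have al01 : 0 <= a + l <= 1 by apply/andP; split; lra.
have cl01 : 0 <= c + l <= 1 by apply/andP; split; lra.
rewrite (hsplit a0 a1 a2 al c01) (hsplit a0 a1 a2 al cl01).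
by rewrite (vsplit c0 c1 c2 cl a01) (vsplit c0 c1 c2 cl al01); ring.
Qed.

(** One coordinate is moved at a time, and each move is bounded by [cderiv_lip]. *)
Let lip s t s' t' : 0 <= s <= 1 -> 0 <= t <= 1 -> 0 <= s' <= 1 ->
  0 <= t' <= 1 ->
  modulus (phi s t - phi s' t') <= 2 * M * (`|s - s'| + `|t - t'|).
Proof.
move=> s0 t0 s0' t0'.
have sub (a b x : R) : 0 <= a <= 1 -> 0 <= b <= 1 -> a <= x <= b -> 0 <= x <= 1.
  by move=> /andP[? ?] /andP[? ?] /andP[? ?]; apply/andP; split; lra.
rewrite mulrDr -(subrK (phi s' t) (phi s t)) -addrA.
rewrite (le_trans (le_modulusD _ _))// lerD//.
  wlog ss : s s' s0 s0' / s' <= s.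
    move=> H; have /orP[|h] := le_total s' s; first exact: H.
    by rewrite modulusBC distrC H.
  rewrite ger0_norm ?subr_ge0//.
  apply: (@cderiv_lip (fun x => phi x t) (fun x => phis x t)) => // x xs.
  - by apply: Hs => //; exact: sub xs.
  - by apply: Cs => //; exact: sub xs.
  - by apply: Bs => //; exact: sub xs.
wlog ss : t t' t0 t0' / t' <= t.
  move=> H; have /orP[|h] := le_total t' t; first exact: H.
  by rewrite modulusBC distrC H.
rewrite ger0_norm ?subr_ge0//.
apply: (@cderiv_lip (fun x => phi s' x) (fun x => phit s' x)) => // x xs.
- by apply: Ht => //; exact: sub xs.
- by apply: Ct => //; exact: sub xs.
- by apply: Bt => //; exact: sub xs.
Qed.

Let Jloc x y : 0 <= x <= 1 -> 0 <= y <= 1 -> forall e, 0 < e ->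
  exists2 d, 0 < d & forall a c l, 0 < l -> l < d ->
   0 <= a -> a + l <= 1 -> 0 <= c -> c + l <= 1 ->
   a <= x <= a + l -> c <= y <= c + l -> modulus (J a c l) <= e * l ^+ 2.
Proof.
move=> x01 y01 e e0; have [B HB] := Hg x01 y01.
(* With this [A], the affine function A + B z is the first-order expansion of [g] at the point
   [phi x y]. *)
pose A := g (phi x y) - B * phi x y.
(* The small square has an image of size at most 4 M l, so each edge contributes at most 2 (e' 4 M
   l) M l = e l^2 / 4; the four edges give e l^2. *)
pose e' := e / (32 * M * M).
have e'0 : 0 < e' by rewrite divr_gt0// !mulr_gt0.
have [d d0 Hd] := HB _ e'0.
exists (d / (4 * M)); first by rewrite divr_gt0// mulr_gt0.
move=> a c l l0 ld a0 al c0 cl /andP[ax xl] /andP[cy yl].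
have near s t : a <= s <= a + l -> c <= t <= c + l ->
  modulus (g (phi s t) - (A + B * phi s t)) <= e' * (4 * M * l).
  move=> /andP[s1 s2] /andP[t1 t2].
  have H : modulus (phi s t - phi x y) <= 4 * M * l.
    apply: le_trans (lip _ _ _ _) _ => //; try by apply/andP; split; lra.
    have h1 : `|s - x| <= l by rewrite ler_norml; apply/andP; split; lra.
    have h2 : `|t - y| <= l by rewrite ler_norml; apply/andP; split; lra.
    rewrite (_ : 4 * M * l = 2 * M * (l + l)); last by ring.
    by rewrite ler_wpM2l ?mulr_ge0 ?(ltW M0)// lerD.
  have Hd' : modulus (phi s t - phi x y) < d.
    rewrite (le_lt_trans H)//; move: ld; rewrite ltr_pdivlMr ?mulr_gt0//.
    by rewrite mulrC.
  have := Hd _ Hd'; rewrite [phi x y + _]addrC subrK mul0r addr0 => h.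
  apply: (@le_trans _ _ (e' * modulus (phi s t - phi x y))).
    rewrite (_ : _ - _ = g (phi s t) - g (phi x y) - B * (phi s t - phi x y))//.
    by rewrite /A; ring.
  by rewrite ler_wpM2l// ltW.
have eh c' : c <= c' <= c + l -> modulus (hedge c' a (a + l) -
    ((A * phi (a + l) c' + B / 2 * (phi (a + l) c' * phi (a + l) c')) -
     (A * phi a c' + B / 2 * (phi a c' * phi a c')))) <=
     2 * (e' * (4 * M * l) * M) * l.
  move=> c'1; have c'01 : 0 <= c' <= 1.
    by move: c'1 => /andP[? ?]; apply/andP; split; lra.
  have in01 s : a <= s <= a + l -> 0 <= s <= 1.
    by move=> /andP[? ?]; apply/andP; split; lra.
  have := @cint_affine_approx g (fun s => phi s c') (fun s => phis s c')
    A B a (a + l) (e' * (4 * M * l)) M.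
  rewrite [a + l - a]addrC addKr; apply.
  - by rewrite ltrDl.
  - by move=> s /in01 ?; exact: Hs.
  - by move=> s /in01 ?; exact: Cs.
  - by move=> s /in01 ?; exact: Chg.
  - by move=> s ?; exact: near.
  - by move=> s /in01 ?; exact: Bs.
have ev c' : a <= c' <= a + l -> modulus (vedge c' c (c + l) -
    ((A * phi c' (c + l) + B / 2 * (phi c' (c + l) * phi c' (c + l))) -
     (A * phi c' c + B / 2 * (phi c' c * phi c' c)))) <=
     2 * (e' * (4 * M * l) * M) * l.
  move=> c'1; have c'01 : 0 <= c' <= 1.
    by move: c'1 => /andP[? ?]; apply/andP; split; lra.
  have in01 s : c <= s <= c + l -> 0 <= s <= 1.
    by move=> /andP[? ?]; apply/andP; split; lra.
  have := @cint_affine_approx g (fun s => phi c' s) (fun s => phit c' s)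
    A B c (c + l) (e' * (4 * M * l)) M.
  rewrite [c + l - c]addrC addKr; apply.
  - by rewrite ltrDl.
  - by move=> s /in01 ?; exact: Ht.
  - by move=> s /in01 ?; exact: Ct.
  - by move=> s /in01 ?; exact: Cvg.
  - by move=> s ?; exact: near.
  - by move=> s /in01 ?; exact: Bt.
have h1 := eh c; have h3 := eh (c + l); have h4 := ev a; have h2 := ev (a + l).
rewrite !lexx !lerDl (ltW l0) /= in h1 h2 h3 h4.
move: (h1 isT) (h2 isT) (h3 isT) (h4 isT) => {h1 h2 h3 h4}.
have -> : 2 * (e' * (4 * M * l) * M) * l = e * l ^+ 2 / 4.
  by rewrite /e'; field; rewrite gt_eqF.
rewrite /J; set X1 := hedge c _ _ - _; set X2 := vedge (a + l) _ _ - _.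
set X3 := hedge (c + l) _ _ - _; set X4 := vedge a _ _ - _.
move=> h1 h2 h3 h4.
(* The values of the primitive A z + B z^2 / 2 at the four corners cancel around the square. *)
rewrite (_ : _ - _ = X1 + X2 - X3 - X4); last by rewrite /X1 /X2 /X3 /X4; ring.
rewrite (le_trans (le_modulusB _ _))//.
rewrite (le_trans (lerD (le_modulusB _ _) h4))//.
rewrite (le_trans (lerD (lerD (le_modulusD _ _) h3) (lexx _)))//.
by rewrite (le_trans (lerD (lerD (lerD h1 h2) (lexx _)) (lexx _)))//; lra.
Qed.

(** Integrating over the image of a square makes the result applicable to a homotopy of closed
    curves. Differentiability of [g] is asked on the image only, so the homotopy may avoid a
    singular point. *)
Theorem goursat :
  cint 0 1 (fun t => g (phi 1 t) * phit 1 t) -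
  cint 0 1 (fun t => g (phi 0 t) * phit 0 t) =
  cint 0 1 (fun s => g (phi s 1) * phis s 1) -
  cint 0 1 (fun s => g (phi s 0) * phis s 0).
Proof.
have := @square_bisection R (fun a c l => modulus (J a c l)).
have H1 a c l : 0 < l -> 0 <= a -> a + l <= 1 -> 0 <= c -> c + l <= 1 ->
  modulus (J a c l) <= modulus (J a c (l / 2)) + modulus (J (a + l / 2) c (l / 2)) +
     modulus (J a (c + l / 2) (l / 2)) + modulus (J (a + l / 2) (c + l / 2) (l / 2)).
  move=> l0 a0 al c0 cl; rewrite (Jsub l0)//.
  by rewrite !(le_trans (le_modulusD _ _))// lerD// !(le_trans (le_modulusD _ _))//
    lerD// le_modulusD.
move=> /(_ H1 Jloc) H.
have /eqP : modulus (J 0 0 1) = 0 by apply/eqP; rewrite eq_le H modulus_ge0.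
rewrite modulus_eq0 => /eqP; rewrite /J !add0r /hedge /vedge => JE.
apply/eqP; rewrite -subr_eq0; apply/eqP.
by rewrite -[RHS]JE; ring.
Qed.

End Goursat.

(** * Power series *)

Section PowerSeries.
Variable R : realType.
Local Notation C := R[i].
Implicit Types (a b : nat -> C) (u v : nat -> C) (z w : C) (f : C -> C).

(** Phrased through real distances, so that squeeze arguments in [R] apply. *)
Definition ccvg u (l : C) := (fun n => modulus (u n - l)) @ \oo --> (0 : R).

Lemma ccvg_squeeze u l (e : nat -> R) : (forall n, modulus (u n - l) <= e n) ->
  e @ \oo --> (0 : R) -> ccvg u l.
Proof.
move=> ue e0; apply: (squeeze_cvgr _ (cvg_cst 0) e0).
by apply: nearW => n; rewrite ue modulus_ge0.
Qed.

Lemma eq_ccvg u v l : u =1 v -> ccvg u l -> ccvg v l.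
Proof. by move=> /funext ->. Qed.

Lemma ccvg_cst (c : C) : ccvg (fun=> c) c.
Proof. by rewrite /ccvg subrr modulus0; exact: cvg_cst. Qed.

Lemma ccvgD u v l m : ccvg u l -> ccvg v m -> ccvg (fun n => u n + v n) (l + m).
Proof.
move=> ul vm; apply: (@ccvg_squeeze _ _
  (fun n => modulus (u n - l) + modulus (v n - m))).
  by move=> n; rewrite opprD addrACA le_modulusD.
by rewrite -[0]addr0; apply: cvgD.
Qed.

Lemma ccvgZ (c : C) u l : ccvg u l -> ccvg (fun n => c * u n) (c * l).
Proof.
move=> ul; apply: (@ccvg_squeeze _ _ (fun n => modulus c * modulus (u n - l))).
  by move=> n; rewrite -mulrBr modulusM.
by rewrite -[0 in X in _ --> X](mulr0 (modulus c)); apply: cvgMr.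
Qed.

Lemma ccvgN u l : ccvg u l -> ccvg (fun n => - u n) (- l).
Proof.
move=> ul; rewrite -mulN1r; apply: eq_ccvg (ccvgZ (-1) ul) => n.
by rewrite mulN1r.
Qed.

Lemma ccvgB u v l m : ccvg u l -> ccvg v m -> ccvg (fun n => u n - v n) (l - m).
Proof. by move=> ul /ccvgN; exact: ccvgD. Qed.

Lemma ccvgS u l : ccvg u l -> ccvg (fun n => u n.+1) l.
Proof. by move=> ul; have := ul; rewrite /ccvg -(cvg_shiftS _ _). Qed.

Lemma ccvg_le u l (M : R) : (forall n, modulus (u n) <= M) -> ccvg u l ->
  modulus l <= M.
Proof.
move=> uM ul; rewrite -[M]addr0.
have H : (fun n => M + modulus (u n - l)) @ \oo --> M + 0.
  by apply: cvgD => //; exact: cvg_cst.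
apply: (cvgr_to_ge H); apply: nearW => n.
rewrite -{1}(subrK (u n) l) [_ + u n]addrC (le_trans (le_modulusD _ _))//.
by rewrite lerD// modulusBC.
Qed.

Lemma ccvg_unique u l m : ccvg u l -> ccvg u m -> l = m.
Proof.
move=> ul um; apply/eqP; rewrite -subr_eq0 -modulus_eq0 eq_le modulus_ge0 andbT.
have := ccvgB ul um; apply: ccvg_le => n.
by rewrite subrr modulus0.
Qed.

Lemma ccvg_bounded u l : ccvg u l -> exists M, forall n, modulus (u n) <= M.
Proof.
move=> ul; have /cvg_seq_bounded [M [_ HM]] : cvgn (fun n => modulus (u n - l)).
  by apply/cvg_ex; exists 0.
exists (M + 1 + modulus l) => n; rewrite -{1}(subrK l (u n)).
rewrite (le_trans (le_modulusD _ _))// lerD2r.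
have := HM (M + 1); rewrite ltrDl ltr01 => /(_ isT n I).
by rewrite /= ger0_norm.
Qed.

Lemma ccvg_Re u l : ccvg u l -> (fun n => complex.Re (u n)) @ \oo --> complex.Re l.
Proof.
move=> /cvgrPdist_le ul; apply/cvgrPdist_le => e /ul; apply: filterS => n.
rewrite sub0r normrN ger0_norm// => h; rewrite distrC.
by rewrite -cReN -cReD (le_trans (Re_le_modulus _)).
Qed.

Lemma ccvg_Im u l : ccvg u l -> (fun n => complex.Im (u n)) @ \oo --> complex.Im l.
Proof.
move=> /cvgrPdist_le ul; apply/cvgrPdist_le => e /ul; apply: filterS => n.
rewrite sub0r normrN ger0_norm// => h; rewrite distrC.
by rewrite -cImN -cImD (le_trans (Im_le_modulus _)).
Qed.

Lemma ReIm_ccvg u l : (fun n => complex.Re (u n)) @ \oo --> complex.Re l ->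
  (fun n => complex.Im (u n)) @ \oo --> complex.Im l -> ccvg u l.
Proof.
move=> H1 H2; apply: (@ccvg_squeeze _ _ (fun n =>
  `|complex.Re (u n) - complex.Re l| + `|complex.Im (u n) - complex.Im l|)).
  move=> n; rewrite (le_trans (modulus_le_ReIm _))//.
  by rewrite cReD cReN cImD cImN.
rewrite -[0]addr0; apply: cvgD.
  by rewrite -(normr0 R) -(subrr (complex.Re l)); apply: cvg_norm;
    apply: cvgB => //; exact: cvg_cst.
by rewrite -(normr0 R) -(subrr (complex.Im l)); apply: cvg_norm;
  apply: cvgB => //; exact: cvg_cst.
Qed.

Definition psum a z n := \sum_(k < n) a k * z ^+ k.

Definition has_ps (r : R) a f := forall z, modulus z < r -> ccvg (psum a z) (f z).

(** Abel's form of a radius of convergence at least [r]. Unlike convergence itself, it passes easily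
    to derived series. *)
Definition geo (r : R) a := forall rho : R, 0 < rho -> rho < r ->
  exists M : R, forall n, modulus (a n) * rho ^+ n <= M.

Definition shiftd a : nat -> C := fun n => n.+1%:R * a n.+1.

Lemma psumS a z n : psum a z n.+1 = psum a z n + a n * z ^+ n.
Proof. by rewrite /psum big_ord_recr. Qed.

Lemma psumSl a z n : psum a z n.+1 = a 0 + z * psum (fun k => a k.+1) z n.
Proof.
rewrite /psum big_ord_recl expr0 mulr1; congr (_ + _).
by rewrite mulr_sumr; apply: eq_bigr => i _; rewrite /= exprS mulrCA.
Qed.

Lemma has_psS r r' a f : r' <= r -> has_ps r a f -> has_ps r' a f.
Proof. by move=> rr H z zr; apply: H; exact: lt_le_trans rr. Qed.

Lemma has_ps_geo r a f : has_ps r a f -> geo r a.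
Proof.
move=> H rho rho0 rhor.
have zr : modulus rho%:C < r by rewrite modulus_real gtr0_norm.
have [M HM] := ccvg_bounded (H _ zr); exists (M + M) => n.
rewrite -[rho]gtr0_norm// -modulus_real -modulusX -modulusM.
rewrite (_ : _ * _ = psum a rho%:C n.+1 - psum a rho%:C n); last first.
  by rewrite psumS addrC addKr.
by rewrite (le_trans (le_modulusB _ _))// lerD.
Qed.

Lemma sum_geo_le (q : R) n : 0 <= q -> q < 1 -> \sum_(k < n) q ^+ k <= (1 - q)^-1.
Proof.
move=> q0 q1; have q1' : 0 < 1 - q by rewrite subr_gt0.
rewrite -[leRHS]mul1r ler_pdivlMr//.
have -> : (\sum_(k < n) q ^+ k) * (1 - q) = 1 - q ^+ n.
  elim: n => [|n IH]; first by rewrite big_ord0 mul0r expr0 subrr.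
  by rewrite big_ord_recr /= mulrDl IH exprS; ring.
by rewrite gerBl exprn_ge0.
Qed.

(** Each of the first n powers of q is at least q^n, so n q^n is below the geometric sum. *)
Lemma natM_geo_le (q : R) n : 0 <= q -> q < 1 -> n%:R * q ^+ n <= (1 - q)^-1.
Proof.
move=> q0 q1; apply: le_trans (sum_geo_le n q0 q1).
rewrite mulr_natl -[n in _ *+ n]card_ord -sumr_const ler_sum// => i _.
by apply: ler_wiXn2l => //; [exact: ltW|exact: ltnW].
Qed.

(** With s between rho and r, the new factor n is absorbed by (rho / s)^n. *)
Lemma geo_shiftd r a : geo r a -> geo r (shiftd a).
Proof.
move=> H rho rho0 rhor; pose s := (rho + r) / 2.
have [s1 s2] : rho < s /\ s < r by rewrite /s; split; lra.
have s0 : 0 < s by apply: lt_trans s1.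
have [M HM] := H s s0 s2; pose q := rho / s.
have q0 : 0 < q by rewrite divr_gt0.
have q1 : q < 1 by rewrite ltr_pdivrMr// mul1r.
exists (M * (1 - q)^-1 / rho) => n.
rewrite ler_pdivlMr// /shiftd modulusM.
have -> : modulus (n.+1%:R : C) = n.+1%:R.
  by rewrite -(rmorph_nat (real_complex R)) modulus_real ger0_norm.
rewrite -[_ * _ * rho]mulrA -exprSr (_ : rho = s * q); last first.
  by rewrite /q mulrCA divff ?mulr1// gt_eqF.
rewrite exprMn (_ : _ * _ * _ = modulus (a n.+1) * s ^+ n.+1 *
  (n.+1%:R * q ^+ n.+1)); last by ring.
apply: ler_pM => //; first by rewrite mulr_ge0// exprn_ge0// ltW.
  by rewrite mulr_ge0// exprn_ge0// ltW.
exact: natM_geo_le (ltW q0) q1.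
Qed.

Lemma psum_cauchy a z (s q M : R) m n : (m <= n)%N -> 0 <= q -> q < 1 ->
  (forall n, modulus (a n) * s ^+ n <= M) -> modulus z <= s * q ->
  modulus (psum a z n - psum a z m) <= M * q ^+ m / (1 - q).
Proof.
move=> mn q0 q1 HM zs; rewrite -(subnKC mn).
have -> : psum a z (m + (n - m)) - psum a z m =
  \sum_(k < n - m) a (m + k)%N * z ^+ (m + k).
  by rewrite /psum big_split_ord /= [X in X - _]addrC addrK.
have M0 : 0 <= M by rewrite (le_trans _ (HM 0%N))// expr0 mulr1.
rewrite (le_trans (le_modulus_sum _ _ _))//.
apply: (@le_trans _ _ (\sum_(k < n - m) M * q ^+ m * q ^+ k)).
  apply: ler_sum => k _; rewrite modulusM modulusX -mulrA -exprD.
  apply: (@le_trans _ _ (modulus (a (m + k)%N) * (s * q) ^+ (m + k))).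
    by rewrite ler_wpM2l// lerXn2r ?nnegrE// (le_trans _ zs).
  by rewrite exprMn mulrA ler_wpM2r// exprn_ge0.
by rewrite -mulr_sumr ler_wpM2l ?sum_geo_le// mulr_ge0// exprn_ge0.
Qed.

Lemma psum_tail r a f z (s q M : R) m : has_ps r a f -> modulus z < r ->
  0 <= q -> q < 1 ->
  (forall n, modulus (a n) * s ^+ n <= M) -> modulus z <= s * q ->
  modulus (f z - psum a z m) <= M * q ^+ m / (1 - q).
Proof.
move=> H zr q0 q1 HM zs.
have : ccvg (fun n => psum a z (n + m)%N) (f z).
  by have := H z zr; rewrite /ccvg -(cvg_shiftn m).
move=> /ccvgB /(_ (ccvg_cst (psum a z m))); apply: ccvg_le => n.
exact: psum_cauchy (leq_addl _ _) q0 q1 HM zs.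
Qed.

Lemma geo_radius r z : modulus z < r -> exists s q : R,
  [/\ 0 < s, s < r, 0 <= q, q < 1 & modulus z <= s * q].
Proof.
move=> zr; have z0 := modulus_ge0 z; have r0 := le_lt_trans z0 zr.
pose s := (modulus z + r) / 2.
have [s1 s2] : modulus z < s /\ s < r by rewrite /s; split; lra.
have s0 : 0 < s by exact: le_lt_trans s1.
exists s, (modulus z / s); split => //; first by rewrite divr_ge0// ltW.
  by rewrite ltr_pdivrMr// mul1r.
by rewrite mulrCA divff ?mulr1// gt_eqF.
Qed.

Lemma geo_has_ps r a : geo r a -> exists f, has_ps r a f.
Proof.
move=> H; have [f Hf] : exists f : C -> C, forall z, modulus z < r ->
    ccvg (psum a z) (f z); last by exists f.
suff /choice[f Hf] : forall z, exists l, modulus z < r -> ccvg (psum a z) l.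
  by exists f.
move=> z.
have [zr|zr] := ltP (modulus z) r; last by exists 0.
have [s [q [s0 sr q0 q1 zs]]] := geo_radius zr.
have [M HM] := H s s0 sr.
have M0 : 0 <= M by rewrite (le_trans _ (HM 0%N))// expr0 mulr1.
have B k : modulus (a k * z ^+ k) <= M * q ^+ k.
  rewrite modulusM modulusX (@le_trans _ _ (modulus (a k) * (s * q) ^+ k))//.
    by rewrite ler_wpM2l// lerXn2r ?nnegrE// (le_trans _ zs).
  by rewrite exprMn mulrA ler_wpM2r// exprn_ge0.
have S (u : nat -> R) : (forall k, `|u k| <= M * q ^+ k) -> cvgn (series u).
  move=> Hu; apply: normed_cvg; apply: (@series_le_cvg _ _ (geometric M q)).
  - by move=> n /=.
  - by move=> n; rewrite /geometric /= mulr_ge0// exprn_ge0.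
  - by move=> n; rewrite /geometric /=; exact: Hu.
  - by apply: is_cvg_geometric_series; rewrite ger0_norm.
have /cvg_ex[x Hx] := S (fun k => complex.Re (a k * z ^+ k))
  (fun k => le_trans (Re_le_modulus _) (B k)).
have /cvg_ex[y Hy] := S (fun k => complex.Im (a k * z ^+ k))
  (fun k => le_trans (Im_le_modulus _) (B k)).
exists (x +i* y) => _; apply: ReIm_ccvg => /=.
  rewrite (_ : (fun n => _) = series (fun k => complex.Re (a k * z ^+ k)))//.
  by apply/funext => n; rewrite seriesEord /psum cRe_sum.
rewrite (_ : (fun n => _) = series (fun k => complex.Im (a k * z ^+ k)))//.
by apply/funext => n; rewrite seriesEord /psum cIm_sum.
Qed.

Let monomial_taylor z h (s : R) n : modulus z <= s -> modulus (z + h) <= s ->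
  modulus ((z + h) ^+ n.+2 - z ^+ n.+2 - h * (n.+2%:R * z ^+ n.+1)) <=
  n.+2%:R * n.+1%:R * s ^+ n * modulus h ^+ 2.
Proof.
move=> zs zhs; have s0 : 0 <= s by exact: le_trans zs.
elim: n => [|n IH].
  rewrite (_ : _ - _ = h * h); last by ring.
  rewrite modulusM expr0 mulr1 -expr2 ler_peMl ?exprn_ge0//.
  by rewrite mulr1 ler1n.
rewrite (_ : _ - _ = (z + h) *
  ((z + h) ^+ n.+2 - z ^+ n.+2 - h * (n.+2%:R * z ^+ n.+1)) +
  n.+2%:R * z ^+ n.+1 * (h * h)); last first.
  by rewrite ![_ ^+ n.+3]exprS ![_ ^+ n.+2]exprS -[n.+3%:R]natr1; ring.
rewrite (le_trans (le_modulusD _ _))// modulusM.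
apply: (@le_trans _ _ (s * (n.+2%:R * n.+1%:R * s ^+ n * modulus h ^+ 2) +
   n.+2%:R * s ^+ n.+1 * modulus h ^+ 2)).
  rewrite lerD//; first by rewrite ler_pM.
  rewrite !modulusM -expr2 modulusX.
  have -> : modulus (n.+2%:R : C) = n.+2%:R.
    by rewrite -(rmorph_nat (real_complex R)) modulus_real ger0_norm.
  by rewrite ler_wpM2r ?exprn_ge0// ler_wpM2l// lerXn2r ?nnegrE.
rewrite (_ : _ + _ = n.+2%:R * n.+2%:R * s ^+ n.+1 * modulus h ^+ 2); last first.
  by rewrite [s ^+ n.+1]exprS; ring.
by rewrite !ler_wpM2r ?exprn_ge0// ler_nat.
Qed.

(** Termwise, the second-order remainder of z^n is at most n (n - 1) t^(n - 2) |h|^2. The sum of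
    these bounds converges because the twice derived series has the same radius, which leaves a
    remainder K |h|^2. *)
Lemma has_ps_wd r a f g z : has_ps r a f -> has_ps r (shiftd a) g ->
  modulus z < r -> wd f z (g z) 0.
Proof.
move=> Hf Hg zr; have [s [q [s0 sr q0 q1 zs]]] := geo_radius zr.
have sz : modulus z <= s by rewrite (le_trans zs)// ler_piMr// ltW.
have zs' : modulus z < s.
  by rewrite (le_lt_trans zs)// -[ltRHS]mulr1 ltr_pM2l.
pose t := (modulus z + s) / 2.
have [zt ts] : modulus z < t /\ t < s by rewrite /t; split; lra.
have t0 : 0 < t by exact: le_lt_trans zt.
have [M HM] := geo_shiftd (geo_shiftd (has_ps_geo Hf)) s0 sr.
have M0 : 0 <= M by rewrite (le_trans _ (HM 0%N))// expr0 mulr1.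
have p0 : 0 <= t / s by rewrite divr_ge0// ltW.
have p1 : t / s < 1 by rewrite ltr_pdivrMr// mul1r.
pose K := M / (1 - t / s).
have K0 : 0 <= K by rewrite divr_ge0// subr_ge0 ltW.
(* The indices are shifted by two because the terms of degree 0 and 1 have no second-order
   remainder. *)
have taylor h n : psum a (z + h) n.+2 - psum a z n.+2 - h * psum (shiftd a) z n.+1 =
  \sum_(k < n) a k.+2 * ((z + h) ^+ k.+2 - z ^+ k.+2 - h * (k.+2%:R * z ^+ k.+1)).
  elim: n => [|n IH].
    rewrite big_ord0 /psum !big_ord_recl !big_ord0 /= /shiftd; ring.
  rewrite big_ord_recr /= -IH [psum a _ n.+3]psumS [psum a z n.+3]psumS.
  by rewrite [psum (shiftd a) _ n.+2]psumS /shiftd; ring.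
have quad h : modulus h < t - modulus z ->
  modulus (f (z + h) - f z - h * g z) <= K * modulus h ^+ 2.
  move=> ht; have zht : modulus (z + h) <= t.
    by rewrite (le_trans (le_modulusD _ _))// -lerBrDl ltW.
  have zhr : modulus (z + h) < r by rewrite (le_lt_trans zht)// (lt_trans ts).
  have := ccvgB (ccvgB (ccvgS (ccvgS (Hf _ zhr))) (ccvgS (ccvgS (Hf _ zr))))
    (ccvgZ h (ccvgS (Hg _ zr))).
  apply: ccvg_le => n; rewrite taylor (le_trans (le_modulus_sum _ _ _))//.
  apply: (@le_trans _ _ (\sum_(k < n) M * (t / s) ^+ k * modulus h ^+ 2)).
    apply: ler_sum => k _; rewrite modulusM.
    rewrite (le_trans (ler_wpM2l _ (monomial_taylor k (ltW zt) zht)))//.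
    rewrite mulrA ler_wpM2r ?exprn_ge0//.
    apply: (@le_trans _ _ (modulus (shiftd (shiftd a) k) * s ^+ k * (t / s) ^+ k)).
      rewrite -[leRHS]mulrA -exprMn [s * _]mulrC divfK ?gt_eqF// !mulrA.
      rewrite ler_wpM2r ?exprn_ge0 ?(ltW t0)// /shiftd !modulusM.
      have N m : modulus (m%:R : C) = m%:R.
        by rewrite -(rmorph_nat (real_complex R)) modulus_real ger0_norm.
      by rewrite !N mulrA [_ * modulus _]mulrC [k.+1%:R * _]mulrC mulrA.
    by rewrite ler_wpM2r// exprn_ge0.
  rewrite -mulr_suml -mulr_sumr ler_wpM2r ?exprn_ge0// ler_wpM2l//.
  exact: sum_geo_le.
move=> e e0; exists (Num.min (t - modulus z) (e / (K + 1))).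
  by rewrite lt_min subr_gt0 zt divr_gt0// ltr_wpDl.
move=> h; rewrite lt_min => /andP[h1 h2].
rewrite mul0r addr0 [g z * h]mulrC (le_trans (quad _ h1))// expr2 mulrA.
rewrite ler_wpM2r// (@le_trans _ _ ((K + 1) * modulus h))//.
  by rewrite ler_wpM2r// lerDl.
by rewrite mulrC -ler_pdivlMr ?ltW// ltr_wpDl.
Qed.

Lemma wd_unique f z (a1 b1 a2 b2 : C) : wd f z a1 b1 -> wd f z a2 b2 -> a1 = a2.
Proof. by move=> /wd_dd <- /wd_dd. Qed.

Lemma has_ps_wdE r a f z : has_ps r a f -> modulus z < r ->
  exists2 g, has_ps r (shiftd a) g & wd f z (g z) 0.
Proof.
move=> Hf zr; have [g Hg] := geo_has_ps (geo_shiftd (has_ps_geo Hf)).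
by exists g => //; exact: has_ps_wd Hf Hg zr.
Qed.

Lemma has_ps0 r a f : 0 < r -> has_ps r a f -> a 0%N = f 0.
Proof.
move=> r0 H; have z0 : modulus (0 : C) < r by rewrite modulus0.
apply: (@ccvg_unique (fun n => psum a 0 n.+1)); last exact: ccvgS (H 0 z0).
apply: eq_ccvg (ccvg_cst (a 0%N)) => n; rewrite psumSl mul0r addr0//.
Qed.

(** The constant term is the value at 0, and both derived series represent the derivative of [f], so
    the induction is on the coefficient index. *)
Lemma has_ps_unique r s a b f : 0 < r -> 0 < s -> has_ps r a f ->
  has_ps s b f -> a = b.
Proof.
move=> r0 s0 Hf Hf'; have m0 : 0 < Num.min r s by rewrite lt_min r0.
have Ha : has_ps (Num.min r s) a f by apply: has_psS Hf; rewrite ge_min lexx.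
have Hb : has_ps (Num.min r s) b f by apply: has_psS Hf'; rewrite ge_min lexx orbT.
move: Ha Hb m0; move: (Num.min r s) => {Hf Hf' r0 s0} {}r Ha Hb r0.
apply/funext => n; elim: n a b f Ha Hb => [|n IH] a b f Ha Hb.
  by rewrite (has_ps0 r0 Ha) (has_ps0 r0 Hb).
have [g Hg] := geo_has_ps (geo_shiftd (has_ps_geo Ha)).
have [h Hh] := geo_has_ps (geo_shiftd (has_ps_geo Hb)).
have Hh' : has_ps r (shiftd b) g.
  move=> z zr; have := Hh z zr.
  by rewrite -(wd_unique (has_ps_wd Ha Hg zr) (has_ps_wd Hb Hh zr)).
have := IH _ _ _ Hg Hh'; rewrite /shiftd => /mulfI; apply.
by rewrite pnatr_eq0.
Qed.

End PowerSeries.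

(** * Cauchy's formula *)

Section Cauchy.
Variable R : realType.
Local Notation C := R[i].
Implicit Types (f : C -> C) (w z : C) (r t : R).

Lemma expi_inv t : (expi t)^-1 = expi (- t).
Proof.
apply: (mulIf (expi_neq0 t)); rewrite mulVf ?expi_neq0//.
by rewrite -expiD addNr expi0.
Qed.

Lemma ccont_on_sum (I : Type) (s : seq I) (F : I -> R -> C) a b :
  (forall i, ccont_on a b (F i)) -> ccont_on a b (fun t => \sum_(i <- s) F i t).
Proof.
move=> HF t tab; elim: s => [|i s IH].
  under eq_fun do rewrite big_nil; exact: ccont_cst.
under eq_fun do rewrite big_cons.
by apply: ccontD IH; exact: HF.
Qed.

Lemma cint_sum (I : Type) (s : seq I) (F : I -> R -> C) a b :
  (forall i, ccont_on a b (F i)) ->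
  cint a b (fun t => \sum_(i <- s) F i t) = \sum_(i <- s) cint a b (F i).
Proof.
move=> HF; elim: s => [|i s IH].
  rewrite big_nil (@eq_cint _ a b _ (fun=> 0 * 0)); last first.
    by move=> t _; rewrite big_nil mul0r.
  by rewrite cintZ ?mul0r// => t _; exact: ccont_cst.
rewrite big_cons -IH -cintD//; last exact: ccont_on_sum.
by apply: eq_cint => t _; rewrite big_cons.
Qed.

Lemma cint_expi (k a b : R) : k != 0 -> a < b -> expi (k * a) = expi (k * b) ->
  cint a b (fun t => expi (k * t)) = 0.
Proof.
move=> k0 ab E.
have kI : k%:C * 'i%C != 0 :> C.
  by rewrite -modulus_eq0 modulusM modulus_i mulr1 modulus_real normr_eq0.
have C1 t : ccont (fun t => expi (k * t)) t := cderiv_ccont (cderiv_expi k t).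
apply: (mulfI kI); rewrite mulr0 -cintZ; last by move=> t _.
rewrite (@cint_FTC _ a b _ (fun t => expi (k * t)))//.
- by rewrite E subrr.
- by move=> t _; apply: ccontM => //; exact: ccont_cst.
- by move=> t _; exact: cderiv_expi.
Qed.

Lemma ccont_on_bounded (g : R -> C) a b : a <= b -> ccont_on a b g ->
  exists M, forall t, a <= t <= b -> modulus (g t) <= M.
Proof.
move=> ab cg.
have H : {within `[a, b], continuous (fun t => modulus (g t))}.
  apply: continuous_in_subspaceT => t; rewrite inE /= in_itv /= => /cg Ht.
  apply/cvgrPdist_le => e e0; have [d d0 Hd] := Ht e e0.
  apply/nbhs_ballP; exists d => // x; rewrite /ball /= distrC => /Hd.
  rewrite [t + _]addrC subrK; apply: le_trans.
  rewrite ler_norml; apply/andP; split.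
    rewrite lerNl opprB lerBlDl -{1}(subrK (g t) (g x)) addrC.
    exact: le_modulusD.
  by rewrite lerBlDr -{1}(subrK (g x) (g t)) modulusBC le_modulusD.
have [c _ Hc] := EVT_max ab H.
by exists (modulus (g c)) => t tab; apply: Hc; rewrite in_itv.
Qed.

Let convex_lt1 (x a b : R) : 0 < x -> x <= 1 -> a < 1 -> b < 1 ->
  (1 - x) * a + x * b < 1.
Proof.
move=> x0 x1 a1 b1.
have h1 : 0 <= (1 - x) * (1 - a) by rewrite mulr_ge0 ?subr_ge0// ltW.
have h2 : 0 < x * (1 - b) by rewrite mulr_gt0 ?subr_gt0.
nra.
Qed.

Section CauchyFormula.
Variables (f : C -> C) (r : R).
Hypotheses (fh : holomorphic f) (r0 : 0 < r) (r1 : r < 1).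

(** The parameter runs over [0, 1] to match the unit square in [goursat]. *)
Let zt t : C := r%:C * expi (2 * pi * t).

Let modzt t : modulus (zt t) = r.
Proof. by rewrite modulusM modulus_expi mulr1 modulus_real gtr0_norm. Qed.

Let zt0 t : zt t != 0.
Proof. by rewrite -modulus_eq0 modzt gt_eqF. Qed.

Let dzt t : cderiv zt t ((2 * pi)%:C * 'i%C * zt t).
Proof.
have := cderivZ r%:C (cderiv_expi (2 * pi) t).
by apply: cderiv_eq; rewrite /zt; ring.
Qed.

Let czt t : ccont zt t := cderiv_ccont (dzt t).

Let ztp : zt 1 = zt 0.
Proof. by rewrite /zt mulr1 mulr0 expi2pi expi0. Qed.

Let fdisk z : modulus z < 1 -> exists a b, wd f z a b.
Proof. by move=> /fh /derivable_wd[a Ha]; exists a, 0. Qed.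

Let cft t : ccont (fun t => f (zt t)) t.
Proof. by apply: ccont_wd => //; apply: fdisk; rewrite modzt. Qed.

Let cinv t : ccont (fun t => (zt t)^-1) t.
Proof.
apply: (@ccont_wd _ (fun z => z^-1)) => //.
by eexists; eexists; apply: (@wd_inv _ id) (wd_id _).
Qed.

Let cX (g : R -> C) t n : ccont g t -> ccont (fun t => g t ^+ n) t.
Proof.
move=> cg; elim: n => [|n IH].
  under eq_fun do rewrite expr0; exact: ccont_cst.
rewrite (_ : (fun t => _) = fun t => g t * g t ^+ n); first exact: ccontM.
by apply/funext => s; rewrite exprS.
Qed.

(** Cauchy's coefficient, the integral of f(z) z^(-n-1) dz over the circle divided by 2 pi i; the
    factor 2 pi i z of dz has been cancelled. *)
Let coef n := cint 0 1 (fun t => f (zt t) * (zt t)^-1 ^+ n).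

Let cint_cst (c : C) : cint 0 1 (fun=> c) = c.
Proof.
rewrite (@cint_FTC _ 0 1 _ (fun t => c * t%:C)) ?ltr01//.
- by rewrite mulr1 mulr0 subr0.
- by move=> t _; exact: ccont_cst.
- move=> t _; have := cderivZ c (cderiv_id t).
  by apply: cderiv_eq; rewrite mulr1.
Qed.

Let cint_zX n : cint 0 1 (fun t => (zt t)^-1 ^+ n) = (n == 0)%:R.
Proof.
case: n => [|n] /=.
  rewrite (@eq_cint _ 0 1 _ (fun=> 1)); first exact: cint_cst.
  by move=> t _; rewrite expr0.
pose k : R := - (2 * pi) * n.+1%:R.
have pi0 := pi_gt0 R.
have k0 : k != 0.
  by rewrite mulf_neq0 ?pnatr_eq0// oppr_eq0 mulf_neq0// gt_eqF.
rewrite (@eq_cint _ 0 1 _ (fun t => (r%:C)^-1 ^+ n.+1 * expi (k * t))); last first.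
  move=> t _; rewrite /zt invfM exprMn expi_inv -expiMn -mulr_natr.
  by congr (_ * expi _); rewrite /k; ring.
rewrite cintZ; last by move=> t _; exact: cderiv_ccont (cderiv_expi k t).
have -> : cint 0 1 (fun t => expi (k * t)) = 0; last by rewrite mulr0.
apply: cint_expi => //; try exact: ltr01.
rewrite mulr1 mulr0 expi0 /k mulr_natr expiMn.
by rewrite -expi_inv expi2pi invr1 expr1n.
Qed.

Section Point.
Variable w : C.
Hypothesis wr : modulus w < r.

(** The difference quotient whose contour integral yields Cauchy's formula. Its value at [w] is 0 by
    the convention on division, and all curves below avoid [w]. *)
Let g z := (f z - f w) / (z - w).

Let ztw t : zt t - w != 0.
Proof. by rewrite subr_eq0; apply/eqP => E; move: wr; rewrite -E modzt ltxx. Qed.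

Let wdg z : modulus z < 1 -> z != w -> exists a, wd g z a 0.
Proof.
move=> z1 zw; have [a Ha] := derivable_wd (fh z1).
have E := wdM (wdB Ha (wd_cst (f w) z))
  (wd_inv (f := fun z => z - w) (z := z) _ (wdB (wd_id z) (wd_cst w z))).
have z0 : z - w != 0 by rewrite subr_eq0.
by eexists; apply: wd_eq (E z0) => //; rewrite !subr0 oppr0 !mul0r mulr0 addr0.
Qed.

Let cgt t : ccont (fun t => g (zt t)) t.
Proof.
apply: ccont_wd => //; have [||a Ha] := @wdg (zt t); first by rewrite modzt.
  by rewrite -subr_eq0.
by exists a, 0.
Qed.

(* Goursat on the homotopy contracting the circle to the circle of radius
   [d * r] around [w]. *)
Let contract (d : R) : 0 < d -> d < 1 ->
  cint 0 1 (fun t => g (zt t) * ((2 * pi)%:C * 'i%C * zt t)) =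
  cint 0 1 (fun t => g (w + d%:C * (zt t - w)) *
    (d%:C * ((2 * pi)%:C * 'i%C * zt t))).
Proof.
move=> d0 d1; have pi0 := pi_gt0 R.
(* The contraction factor, equal to d at s = 0 and to 1 at s = 1. *)
pose sg (s : R) : R := d + (1 - d) * s.
pose phi s t := w + (sg s)%:C * (zt t - w).
pose phis (s t : R) := (1 - d)%:C * (zt t - w).
pose phit s t := (sg s)%:C * ((2 * pi)%:C * 'i%C * zt t).
have sg01 s : 0 <= s <= 1 -> 0 < sg s /\ sg s <= 1.
  by move=> /andP[s0 s1]; rewrite /sg; split; nra.
have w1 : modulus w < 1 by exact: lt_trans r1.
(* A common bound: the derivative in s is at most 2, the derivative in t at most 2 pi, both because
   the circle and [w] lie in the unit disk. *)
pose M : R := 2 + 2 * pi.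
have M0 : 0 < M by rewrite /M; lra.
have dphis s t : cderiv (fun x => phi x t) s (phis s t).
  have D : cderiv (fun x => (sg x)%:C) s (1 - d)%:C.
    have := cderivD (cderiv_cst d%:C s) (cderivZ (1 - d)%:C (cderiv_id s)).
    rewrite add0r mulr1 (_ : (fun _ => _) = fun x => (sg x)%:C)//.
    by apply/funext => x; rewrite /sg [RHS]rmorphD [in RHS]rmorphM.
  have := cderivD (cderiv_cst w s) (cderivM D (cderiv_cst (zt t - w) s)).
  by apply: cderiv_eq; rewrite mulr0 addr0 add0r.
have dphit s t : cderiv (fun x => phi s x) t (phit s t).
  have := cderivD (cderiv_cst w t) (cderivZ (sg s)%:C
    (cderivD (dzt t) (cderiv_cst (- w) t))).
  by apply: cderiv_eq; rewrite addr0 add0r.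
have phi1 s t : 0 <= s <= 1 -> modulus (phi s t) < 1 /\ phi s t != w.
  move=> /sg01[s0 s1]; split; last first.
    rewrite /phi -subr_eq0 addrC addKr mulf_neq0//.
    by rewrite -modulus_eq0 modulus_real normr_eq0 gt_eqF.
  rewrite (_ : phi s t = (1 - sg s)%:C * w + (sg s)%:C * zt t); last first.
    by rewrite /phi rmorphB; ring.
  rewrite (le_lt_trans (le_modulusD _ _))// (modulusM (1 - sg s)%:C).
  rewrite (modulusM (sg s)%:C) !modulus_real modzt.
  rewrite ger0_norm ?subr_ge0// gtr0_norm//; exact: convex_lt1.
have := @goursat R phi phis phit M g M0 (fun s t _ _ => dphis s t)
  (fun s t _ _ => dphit s t).
have cp1 s t : ccont (fun x => phis x t) s by exact: ccont_cst.
have cp2 s t : ccont (fun x => phit s x) t.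
  apply: ccontM; first exact: ccont_cst.
  by apply: ccontM; first exact: ccont_cst.
have b1 s t : modulus (phis s t) <= M.
  rewrite modulusM modulus_real ger0_norm; last by lra.
  have : modulus (zt t - w) <= 2.
    by rewrite (le_trans (le_modulusB _ _))// modzt -[2]/(1 + 1) lerD// ltW.
  have := modulus_ge0 (zt t - w); rewrite /M; nra.
have b2 s t : 0 <= s <= 1 -> modulus (phit s t) <= M.
  move=> /sg01[s0 s1]; rewrite !modulusM !modulus_real modulus_i modulus_expi.
  rewrite !gtr0_norm ?mulr_gt0// !mulr1.
  have h1 : sg s * r <= 1 by rewrite mulr_ile1 ?(ltW s0) ?(ltW r0) ?(ltW r1).
  rewrite (_ : sg s * _ = 2 * pi * (sg s * r)); last by ring.
  by rewrite (le_trans (ler_piMr _ h1)) ?mulr_ge0 ?(ltW pi0)// /M lerDr.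
move=> /(_ (fun s t _ _ => cp1 s t) (fun s t _ _ => cp2 s t)).
move=> /(_ (fun s t _ _ => b1 s t) (fun s t s01 _ => b2 s t s01)).
have hg s t : 0 <= s <= 1 -> exists a, wd g (phi s t) a 0.
  by move=> /(phi1 s t)[h1 h2]; exact: wdg.
move=> /(_ (fun s t s01 _ => hg s t s01)).

(* The circle is closed, so the two edges t = 0 and t = 1 of the square have the same image and
   cancel. *)
rewrite (_ : (fun s => g (phi s 1) * phis s 1) =
  fun s => g (phi s 0) * phis s 0); last first.
  by apply/funext => s; rewrite /phi /phis ztp.
rewrite subrr => /eqP; rewrite subr_eq0 => /eqP.
have sg1 : sg 1 = 1 by rewrite /sg; lra.
have sg0 : sg 0 = d by rewrite /sg; lra.
rewrite (_ : (fun t => g (phi 1 t) * phit 1 t) =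
  fun t => g (zt t) * ((2 * pi)%:C * 'i%C * zt t)); last first.
  by apply/funext => t; rewrite /phi /phit sg1 !mul1r addrC subrK.
by rewrite (_ : (fun t => g (phi 0 t) * phit 0 t) =
  fun t => g (w + d%:C * (zt t - w)) * (d%:C * ((2 * pi)%:C * 'i%C * zt t)))//;
  apply/funext => t; rewrite /phi /phit sg0.
Qed.

(** Near [w] the quotient [g] is bounded, as [f] is Lipschitz there, while the contracted circle has
    length proportional to the factor [s]. The integral does not depend on [s], hence is 0. *)
Let cauchy_int : cint 0 1 (fun t => g (zt t) * zt t) = 0.
Proof.
have pi0 := pi_gt0 R.
have w1 : modulus w < 1 by exact: lt_trans r1.
have cgz : ccont_on 0 1 (fun t => g (zt t) * zt t).
  by move=> t _; exact: ccontM.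
pose I := cint 0 1 (fun t => g (zt t) * ((2 * pi)%:C * 'i%C * zt t)).
have IE : I = (2 * pi)%:C * 'i%C * cint 0 1 (fun t => g (zt t) * zt t).
  by rewrite -cintZ//; apply: eq_cint => t _; ring.
suff : I = 0.
  move/eqP; rewrite IE mulf_eq0 => /orP[|/eqP//].
  rewrite -modulus_eq0 modulusM modulus_real modulus_i mulr1 normr_eq0.
  by rewrite gt_eqF// mulr_gt0.
have [a [b Hf]] := fdisk w1; have [K K0 [d d0 HK]] := wd_lip Hf.
apply/eqP; rewrite -modulus_eq0 eq_le modulus_ge0 andbT; apply/ler_addgt0Pl => e e0.
rewrite addr0.
(* The three bounds give s < 1, keep the small circle within the Lipschitz radius [d] (as |z - w| <
   2), and make the final estimate 2 K s 2 pi at most [e]. *)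
pose s : R := Num.min (Num.min (1 / 2) (d / 2)) (e / (4 * pi * K)).
have s0 : 0 < s by rewrite !lt_min !divr_gt0// !mulr_gt0.
have s1 : s < 1.
  by rewrite /s !gt_min ltr_pdivrMr ?mul1r ?ltr1n.
have sd : s <= d / 2 by rewrite /s !ge_min lexx orbT.
have se : s <= e / (4 * pi * K) by rewrite /s !ge_min lexx orbT.
have nz t : s%:C * (zt t - w) != 0.
  by rewrite mulf_neq0// -modulus_eq0 modulus_real normr_eq0 gt_eqF.
have small t : modulus (s%:C * (zt t - w)) < d.
  rewrite modulusM modulus_real gtr0_norm//.
  have : modulus (zt t - w) < 2.
    by apply: le_lt_trans (le_modulusB _ _) _; rewrite modzt -[2]/(1 + 1) ltrD.
  have := modulus_ge0 (zt t - w); nra.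
rewrite /I (contract s0 s1) (le_trans (@le_modulus_cint _ 0 1 _
  (K * (s * (2 * pi))) _ _ _))//.
- move=> t _; apply: ccontM; last first.
    apply: ccontM; first exact: ccont_cst.
    by apply: ccontM; first exact: ccont_cst.
  apply: ccont_wd.
    apply: ccontD; first exact: ccont_cst.
    apply: ccontM; first exact: ccont_cst.
    by apply: ccontD; last exact: ccont_cst.
  have [||c Hc] := @wdg (w + s%:C * (zt t - w)).
  + rewrite (_ : _ + _ = (1 - s)%:C * w + s%:C * zt t); last first.
      by rewrite rmorphB; ring.
    rewrite (le_lt_trans (le_modulusD _ _))// (modulusM (1 - s)%:C).
    rewrite (modulusM s%:C) !modulus_real modzt.
    rewrite ger0_norm ?subr_ge0 ?(ltW s1)// gtr0_norm//.
    exact: convex_lt1 (ltW s1) _ _.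
  + by rewrite -subr_eq0 addrC addKr.
  + by exists c, 0.
- move=> t _; rewrite !modulusM modulusV [w + _ - w]addrC addKr.
  have := HK _ (small t).
  rewrite -ler_pdivrMr ?modulus_gt0// => h.
  rewrite ler_pM ?mulr_ge0 ?invr_ge0//.
  rewrite !modulus_real modulus_i modulus_expi !gtr0_norm ?mulr_gt0// !mulr1.
  by rewrite ler_wpM2l ?(ltW s0)// ler_piMr ?mulr_ge0// ltW.
rewrite subr0 mulr1.
move: se; rewrite ler_pdivlMr ?mulr_gt0//; nra.
Qed.

(** The factor z / (z - w) is expanded as a finite geometric sum in w / z with its exact remainder
    [rem], so that no limit is exchanged with an integral. By [cauchy_int] the left side is minus
    the integral of [rem]. *)
Let expand_bound (U : R) N : (forall t, 0 <= t <= 1 -> modulus (f (zt t) - f w) <= U) ->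
  modulus (psum coef w N.+1 - f w) <=
    2 * (U * (modulus w / r) ^+ N.+1 * (r / (r - modulus w))).
Proof.
move=> HU; pose u t := f (zt t) - f w.
have cu t : ccont u t by apply: ccontD => //; exact: ccont_cst.
have U0 : 0 <= U by rewrite (le_trans _ (HU 0 _))// lexx ler01.
have rw : 0 < r - modulus w by rewrite subr_gt0.
pose F (k : 'I_N.+1) t := w ^+ k * (u t * (zt t)^-1 ^+ k).
have cF k : ccont_on 0 1 (F k).
  move=> t _; apply: ccontM; first exact: ccont_cst.
  by apply: ccontM => //; exact: cX.
pose rem t := u t * (w / zt t) ^+ N.+1 * (zt t / (zt t - w)).
have split_ t : g (zt t) * zt t = \sum_(k < N.+1) F k t + rem t.
  have wz : 1 - w / zt t != 0.
    by rewrite -[1](divff (zt0 t)) -mulrBl mulf_neq0// invr_eq0.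
  have -> : \sum_(k < N.+1) F k t = u t * \sum_(k < N.+1) (w / zt t) ^+ k.
    by rewrite mulr_sumr; apply: eq_bigr => k _; rewrite /F exprMn; ring.
  have -> : \sum_(k < N.+1) (w / zt t) ^+ k =
      (1 - (w / zt t) ^+ N.+1) / (1 - w / zt t).
    by apply: (mulIf wz); rewrite divfK// -[1 - _ ^+ _]opprB subrX1; ring.
  rewrite /g /rem; move: ((w / zt t) ^+ N.+1) => q.
  rewrite -/(u t).
  field; rewrite ztw zt0 /=.
  done.
have crem : ccont_on 0 1 rem.
  move=> t t01; rewrite (_ : rem = fun t => g (zt t) * zt t - \sum_(k < N.+1) F k t).
    apply: ccontD; first exact: ccontM.
    apply: (@ccont_wd _ (fun z => - z)).
      by apply: (@ccont_on_sum _ _ F 0 1 cF).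
    by eexists; eexists; exact: wdN (wd_id _).
  by apply/funext => x; rewrite split_ addrC addKr.
have := cauchy_int; rewrite (@eq_cint _ 0 1 _ (fun t => \sum_(k < N.+1) F k t + rem t)).
  rewrite cintD//; last exact: ccont_on_sum.
  rewrite cint_sum//.
  (* The integral of z^(-k) over the circle vanishes except for k = 0; this is the origin of the
     single term f(w). *)
  have -> : \sum_(k < N.+1) cint 0 1 (F k) = psum coef w N.+1 - f w.
    rewrite (eq_bigr (fun k : 'I_N.+1 =>
       coef k * w ^+ k - (k == 0 :> nat)%:R * f w * w ^+ k)); last first.
      move=> k _; rewrite /F cintZ; last first.
        by move=> t _; apply: ccontM => //; exact: cX.
      rewrite (@eq_cint _ 0 1 _ (fun t => f (zt t) * (zt t)^-1 ^+ k +
        (- f w) * (zt t)^-1 ^+ k)); last by move=> t _; rewrite -mulrDl.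
      rewrite cintD; [|by move=> t _; apply: ccontM => //; exact: cX
        |by move=> t _; apply: ccontM; [exact: ccont_cst|exact: cX]].
      rewrite cintZ; last by move=> t _; exact: cX.
      by rewrite cint_zX -/(coef k); ring.
    rewrite sumrB -/(psum coef w N.+1); congr (_ - _).
    rewrite big_ord_recl /= mul1r expr0 mulr1 big1 ?addr0// => i _.
    by rewrite !mul0r.
  move/eqP; rewrite addr_eq0 => /eqP ->; rewrite modulusN.
  rewrite (le_trans (@le_modulus_cint _ 0 1 _
    (U * (modulus w / r) ^+ N.+1 * (r / (r - modulus w))) _ _ _))//.
    move=> t t01; rewrite /rem (modulusM (u t * _)) (modulusM (u t)).
    rewrite (modulusM (zt t)) modulusX (modulusM w) !modulusV modzt.
    rewrite ler_pM ?mulr_ge0 ?exprn_ge0 ?mulr_ge0 ?invr_ge0 ?(ltW r0)//.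
      by rewrite ler_wpM2r ?HU// exprn_ge0// divr_ge0// ltW.
    rewrite ler_wpM2l ?(ltW r0)// lef_pV2 ?posrE//.
      rewrite lerBlDr -{1}(modzt t) -{1}(subrK w (zt t)).
      exact: le_modulusD.
    by rewrite modulus_gt0.
  by rewrite subr0 mulr1.
by move=> t _; exact: split_.
Qed.

Lemma cauchy_taylor_at : ccvg (psum coef w) (f w).
Proof.
have c01 : ccont_on 0 1 (fun t => f (zt t) - f w).
  by move=> t _; apply: ccontD => //; exact: ccont_cst.
have [U HU] := ccont_on_bounded ler01 c01.
have q1 : `|modulus w / r| < 1.
  by rewrite ger0_norm ?divr_ge0 ?(ltW r0)// ltr_pdivrMr// mul1r.
rewrite /ccvg -cvg_shiftS /=.
have H0 : (fun N => (2 * (U * (r / (r - modulus w)))) *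
    (modulus w / r) ^+ N.+1) @ \oo --> (0 : R).
  rewrite -[0](mulr0 (2 * (U * (r / (r - modulus w))))); apply: cvgMr.
  by rewrite (cvg_shiftS (fun n => (modulus w / r) ^+ n)); exact: cvg_expr.
apply: (squeeze_cvgr _ (cvg_cst 0) H0).
apply: nearW => N; rewrite modulus_ge0 /=.
by rewrite (le_trans (expand_bound N HU))// le_eqVlt; apply/orP; left; apply/eqP; ring.
Qed.

End Point.

Lemma cauchy_taylor : has_ps r coef f.
Proof. by move=> w; exact: cauchy_taylor_at. Qed.

End CauchyFormula.

(** Each circle of radius below 1 gives its own coefficients. By uniqueness they all agree with
    those of radius 1/2, so one series serves the whole disk. *)
Theorem holomorphic_has_ps f : holomorphic f -> exists a, has_ps 1 a f.
Proof.
move=> fh.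
have H r : 0 < r -> r < 1 -> exists a, has_ps r a f.
  by move=> r0 r1; eexists; exact: cauchy_taylor.
have h0 : 0 < 2^-1 :> R by rewrite invr_gt0.
have [|a Ha] := H 2^-1 h0; first by lra.
exists a => z z1; pose r := (modulus z + 1) / 2.
have z0 := modulus_ge0 z.
have [r0 r1 zr] : [/\ 0 < r, r < 1 & modulus z < r] by rewrite /r; split; lra.
have [b Hb] := H r r0 r1.
by rewrite (has_ps_unique h0 r0 Ha Hb); exact: Hb.
Qed.

Theorem has_ps_holomorphic a f : has_ps 1 a f -> holomorphic f.
Proof.
by move=> H z z1; have [g _ /wd_derivable] := has_ps_wdE H z1.
Qed.

End Cauchy.

(** * Hardy and Bergman norms on Taylor coefficients *)

Lemma exists_between1 (R : realType) (rho : R) : 0 <= rho -> rho < 1 ->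
  exists s, [/\ rho < s, s < 1 & 0 < s].
Proof. by move=> r0 r1; exists ((rho + 1) / 2); split; lra. Qed.

Lemma conjcM (R : realType) (u v : R[i]) : conjc (u * v) = conjc u * conjc v.
Proof. exact: rmorphM. Qed.

Lemma conjcD (R : realType) (u v : R[i]) : conjc (u + v) = conjc u + conjc v.
Proof. exact: rmorphD. Qed.

Lemma conjcB (R : realType) (u v : R[i]) : conjc (u - v) = conjc u - conjc v.
Proof. exact: rmorphB. Qed.

Lemma conjcN (R : realType) (u : R[i]) : conjc (- u) = - conjc u.
Proof. exact: rmorphN. Qed.

(** * Parseval's identity over an abstract finite measure with orthogonal powers *)

Section MeanSquare.
Variable R : realType.
Local Notation C := R[i].
Context d (T : measurableType d) (mu : {measure set T -> \bar R}).
Variables (D : set T) (mD : measurable D) (Dfin : (mu D < +oo)%E).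
Implicit Types p q : T -> C.

Definition nice p := [/\ measurable_fun D (fun x => complex.Re (p x)),
  measurable_fun D (fun x => complex.Im (p x)) &
  exists K : R, forall x, D x -> modulus (p x) <= K].

Lemma nice_cst (c : C) : nice (fun=> c).
Proof. by split => //; exists (modulus c). Qed.

Lemma niceD p q : nice p -> nice q -> nice (fun x => p x + q x).
Proof.
move=> [p1 p2 [K HK]] [q1 q2 [L HL]]; split.
- by under eq_fun do rewrite cReD; exact: measurable_funD.
- by under eq_fun do rewrite cImD; exact: measurable_funD.
- by exists (K + L) => x Dx; rewrite (le_trans (le_modulusD _ _))// lerD ?HK ?HL.
Qed.

Lemma niceM p q : nice p -> nice q -> nice (fun x => p x * q x).
Proof.
move=> [p1 p2 [K HK]] [q1 q2 [L HL]]; split.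
- by under eq_fun do rewrite cReM; apply: measurable_funB; exact: measurable_funM.
- by under eq_fun do rewrite cImM; apply: measurable_funD; exact: measurable_funM.
- by exists (K * L) => x Dx; rewrite modulusM ler_pM ?HK ?HL.
Qed.

Lemma niceN p : nice p -> nice (fun x => - p x).
Proof.
move=> Hp; have := niceM (nice_cst (-1)) Hp.
by under eq_fun do rewrite mulN1r.
Qed.

Lemma niceX p n : nice p -> nice (fun x => p x ^+ n).
Proof.
move=> Hp; elim: n => [|n IH].
  by under eq_fun do rewrite expr0; exact: nice_cst.
by under eq_fun do rewrite exprS; exact: niceM.
Qed.

Lemma nice_conj p : nice p -> nice (fun x => conjc (p x)).
Proof.
move=> [p1 p2 [K HK]]; split.
- by rewrite (_ : (fun x => _) = fun x => complex.Re (p x))//;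
    apply/funext => x; case: (p x).
- rewrite (_ : (fun x => _) = fun x => - complex.Im (p x)).
    exact: measurable_funN.
  by apply/funext => x; case: (p x).
- by exists K => x Dx; rewrite modulus_conj HK.
Qed.

Lemma nice_psum (a : nat -> C) p n : nice p -> nice (fun x => psum a (p x) n).
Proof.
move=> Hp; elim: n => [|n IH].
  by under eq_fun do rewrite /psum big_ord0; exact: nice_cst.
under eq_fun do rewrite psumS.
apply: niceD IH _; apply: niceM; [exact: nice_cst|exact: niceX].
Qed.

Variables (g : T -> R) (B : R).
Hypotheses (mg : measurable_fun D g) (g0 : forall x, D x -> 0 <= g x)
  (gB : forall x, D x -> g x <= B).

(** Only real parts are integrated. Complex orthogonality is still expressible: the hypothesis
    [orth] below allows an arbitrary complex factor [c]. *)
Definition mean p := \int[mu]_(x in D) (complex.Re (p x) * g x).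

Lemma nice_integrable p : nice p ->
  mu.-integrable D (EFin \o (fun x => complex.Re (p x) * g x)).
Proof.
move=> [p1 p2 [K HK]]; apply: measurable_bounded_integrable => //.
  exact: measurable_funM.
exists (K * B); split; first exact: num_real.
move=> x Kx y /= Dy; rewrite (le_trans _ (ltW Kx))// normrM ler_pM//.
  exact: le_trans (Re_le_modulus _) (HK _ Dy).
by rewrite ger0_norm ?g0 ?gB.
Qed.

Lemma meanD p q : nice p -> nice q ->
  mean (fun x => p x + q x) = mean p + mean q.
Proof.
move=> Hp Hq; rewrite -RintegralD//; try exact: nice_integrable.
by apply: eq_Rintegral => x _; rewrite cReD mulrDl.
Qed.

Lemma meanZ (k : R) p : nice p -> mean (fun x => k%:C * p x) = k * mean p.
Proof.
move=> Hp; rewrite -RintegralZl//; last exact: nice_integrable.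
by apply: eq_Rintegral => x _; rewrite cReM /= mul0r subr0 mulrA.
Qed.

Lemma meanB p q : nice p -> nice q ->
  mean (fun x => p x - q x) = mean p - mean q.
Proof.
move=> Hp Hq; rewrite meanD//; last exact: niceN.
congr (_ + _); rewrite -mulN1r -meanZ//.
by apply: eq_Rintegral => x _; rewrite rmorphN mulN1r.
Qed.

Lemma mean_conj p : mean (fun x => conjc (p x)) = mean p.
Proof. by apply: eq_Rintegral => x _; case: (p x). Qed.

Lemma le_mean p (K : R) : nice p -> (forall x, D x -> modulus (p x) <= K) ->
  `|mean p| <= K * B * fine (mu D).
Proof.
move=> Hp HK; rewrite (le_trans (le_normr_Rintegral _ (nice_integrable Hp)))//.
rewrite -Rintegral_cst//; apply: le_Rintegral => //.
- exact: integrable_norm (nice_integrable Hp).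
- apply: measurable_bounded_integrable => //.
  exists `|K * B|; split; first exact: num_real.
  by move=> x Kx y /= _; exact: ltW.
- move=> x Dx; rewrite normrM ler_pM//.
    exact: le_trans (Re_le_modulus _) (HK _ Dx).
  by rewrite ger0_norm ?g0 ?gB.
Qed.

Lemma ler_mean p q : nice p -> nice q ->
  (forall x, D x -> complex.Re (p x) <= complex.Re (q x)) -> mean p <= mean q.
Proof.
move=> Hp Hq pq; apply: le_Rintegral => //; try exact: nice_integrable.
by move=> x Dx; rewrite ler_wpM2r ?g0 ?pq.
Qed.

Variables (zeta : T -> C) (rho : R).
Hypotheses (mRe : measurable_fun D (fun x => complex.Re (zeta x)))
  (mIm : measurable_fun D (fun x => complex.Im (zeta x)))
  (rho0 : 0 <= rho) (rho1 : rho < 1)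
  (zr : forall x, D x -> modulus (zeta x) <= rho)
  (orth : forall m n (c : C), (m < n)%N ->
     mean (fun x => c * zeta x ^+ m * conjc (zeta x ^+ n)) = 0).

Let nzeta : nice zeta.
Proof. by split => //; exists rho. Qed.

Definition moment n := mean (fun x => zeta x ^+ n * conjc (zeta x ^+ n)).

Let cross (a : nat -> C) (c : C) m n : (m <= n)%N ->
  mean (fun x => psum a (zeta x) m * conjc (c * zeta x ^+ n)) = 0.
Proof.
elim: m => [|m IH] mn.
  rewrite (_ : (fun x => _) = fun x => (0 : R)%:C * zeta x).
    by rewrite meanZ ?mul0r.
  by apply/funext => x; rewrite /psum big_ord0 !mul0r.
rewrite (_ : (fun x => _) = fun x => psum a (zeta x) m * conjc (c * zeta x ^+ n)
  + a m * conjc c * zeta x ^+ m * conjc (zeta x ^+ n)); last first.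
  by apply/funext => x; rewrite psumS !rmorphM /=; ring.
rewrite meanD.
- by rewrite IH ?add0r ?orth// ltnW.
- apply: niceM; first exact: nice_psum.
  by apply: nice_conj; apply: niceM; [exact: nice_cst|exact: niceX].
- apply: niceM; last by apply: nice_conj; exact: niceX.
  by apply: niceM; [exact: nice_cst|exact: niceX].
Qed.

(** Pythagoras: each new monomial is orthogonal to the previous partial sum, and the two cross terms
    are conjugate, so both have mean 0. *)
Lemma mean_psum (a : nat -> C) n :
  mean (fun x => psum a (zeta x) n * conjc (psum a (zeta x) n)) =
  \sum_(k < n) modulus (a k) ^+ 2 * moment k.
Proof.
elim: n => [|n IH].
  rewrite big_ord0 (_ : (fun x => _) = fun x => (0 : R)%:C * zeta x).
    by rewrite meanZ ?mul0r.
  by apply/funext => x; rewrite /psum big_ord0 !mul0r.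
rewrite big_ord_recr /= -IH.
pose S x := psum a (zeta x) n; pose t x := a n * zeta x ^+ n.
have nS : nice S by exact: nice_psum.
have nt : nice t by apply: niceM; [exact: nice_cst|exact: niceX].
have nSt : nice (fun x => S x * conjc (t x)).
  by apply: niceM => //; exact: nice_conj.
rewrite (_ : (fun x => _) = fun x => S x * conjc (S x) +
  (modulus (a n) ^+ 2)%:C * (zeta x ^+ n * conjc (zeta x ^+ n)) +
  (S x * conjc (t x) + conjc (S x * conjc (t x)))); last first.
  apply/funext => x; rewrite psumS -/(S x) -/(t x) -mul_conj.
  by rewrite conjcD (conjcM (S x)) conjcK /t !conjcM; ring.
have nSS : nice (fun x => S x * conjc (S x)).
  by apply: niceM => //; exact: nice_conj.
have nzz : nice (fun x => zeta x ^+ n * conjc (zeta x ^+ n)).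
  by apply: niceM; [exact: niceX|apply: nice_conj; exact: niceX].
have nzz' : nice (fun x =>
    (modulus (a n) ^+ 2)%:C * (zeta x ^+ n * conjc (zeta x ^+ n))).
  by apply: niceM => //; exact: nice_cst.
rewrite meanD; [|exact: niceD|by apply: niceD => //; exact: nice_conj].
rewrite (meanD nSS nzz') meanZ// meanD//; last exact: nice_conj.
by rewrite mean_conj cross// !addr0.
Qed.

Lemma nice_has_ps (a : nat -> C) f : has_ps 1 a f -> nice (fun x => f (zeta x)).
Proof.
move=> Hf; have zr1 x : D x -> modulus (zeta x) < 1.
  by move=> Dx; exact: le_lt_trans (zr Dx) rho1.
split.
- apply: (@measurable_fun_cvg _ _ _ _
    (fun n x => complex.Re (psum a (zeta x) n))).
    by move=> n; have [] := nice_psum a n nzeta.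
  by move=> x Dx; apply: ccvg_Re; exact: Hf (zr1 _ Dx).
- apply: (@measurable_fun_cvg _ _ _ _
    (fun n x => complex.Im (psum a (zeta x) n))).
    by move=> n; have [] := nice_psum a n nzeta.
  by move=> x Dx; apply: ccvg_Im; exact: Hf (zr1 _ Dx).
- have [s [rs s1 s0]] := exists_between1 rho0 rho1.
  have [M HM] := has_ps_geo Hf s0 s1.
  exists (M * (rho / s) ^+ 0 / (1 - rho / s)) => x Dx.
  rewrite -[f _]subr0 -[X in _ - X](_ : psum a (zeta x) 0 = 0).
    apply: (psum_tail 0 Hf (zr1 x Dx) _ _ HM).
    - by rewrite divr_ge0// ltW.
    - by rewrite ltr_pdivrMr ?mul1r.
    - by rewrite mulrCA divff ?mulr1 ?zr// gt_eqF.
  by rewrite /psum big_ord0.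
Qed.

(** [zeta] stays within radius rho < 1, where the partial sums converge uniformly at the geometric
    rate [e n]; hence [mean_psum] passes to the limit. *)
Theorem mean_square (a : nat -> C) f : has_ps 1 a f ->
  (fun n => \sum_(k < n) modulus (a k) ^+ 2 * moment k) @ \oo -->
  mean (fun x => f (zeta x) * conjc (f (zeta x))).
Proof.
move=> Hf; have nf := nice_has_ps Hf; have [_ _ [K HK]] := nf.
have [s [rs s1 s0]] := exists_between1 rho0 rho1.
have [M HM] := has_ps_geo Hf s0 s1; pose q := rho / s.
have q0 : 0 <= q by rewrite divr_ge0// ltW.
have q1 : q < 1 by rewrite ltr_pdivrMr ?mul1r.
have tail x n : D x -> modulus (f (zeta x) - psum a (zeta x) n) <=
    M * q ^+ n / (1 - q).
  move=> Dx; apply: (psum_tail n Hf _ q0 q1 HM).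
    exact: le_lt_trans (zr Dx) rho1.
  by rewrite /q mulrCA divff ?mulr1 ?zr// gt_eqF.
pose e n := M * q ^+ n / (1 - q).
have M0 : 0 <= M by rewrite (le_trans _ (HM 0%N))// expr0 mulr1.
have e_ge0 n : 0 <= e n.
  by rewrite /e divr_ge0 ?mulr_ge0 ?exprn_ge0// subr_ge0 ltW.
have eM n : e n <= M / (1 - q).
  by rewrite /e ler_wpM2r ?invr_ge0 ?subr_ge0 ?(ltW q1)// ler_piMr// exprn_ile1// ltW.
pose L := (K + (K + M / (1 - q))) * B * fine (mu D).
have dist n : `|mean (fun x => f (zeta x) * conjc (f (zeta x))) -
    \sum_(k < n) modulus (a k) ^+ 2 * moment k| <= L * e n.
  have nS := nice_psum a n nzeta.
  rewrite -mean_psum -meanB; try by apply: niceM => //; exact: nice_conj.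
  rewrite (_ : L * e n = (e n * (K + (K + M / (1 - q)))) * B * fine (mu D)); last first.
    by rewrite /L; ring.
  apply: le_mean.
    apply: niceD; first by apply: niceM => //; exact: nice_conj.
    by apply: niceN; apply: niceM => //; exact: nice_conj.
  move=> x Dx.
  (* Writing S for the partial sum, |f|^2 - |S|^2 = (f - S) conj f + S conj (f - S); here |f| is at
     most K and |S| at most K + M / (1 - q). *)
  rewrite (_ : _ - _ = (f (zeta x) - psum a (zeta x) n) * conjc (f (zeta x)) +
    psum a (zeta x) n * conjc (f (zeta x) - psum a (zeta x) n)); last first.
    by rewrite rmorphB /=; ring.
  rewrite (le_trans (le_modulusD _ _))// !modulusM !modulus_conj mulrDr lerD//.
    by rewrite ler_pM ?tail ?HK.
  rewrite mulrC ler_pM ?tail//.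
  rewrite -[psum _ _ _](subKr (f (zeta x))) (le_trans (le_modulusB _ _))//.
  exact: lerD (HK _ Dx) (le_trans (tail _ _ Dx) (eM n)).
have e_cvg : (fun n => L * e n) @ \oo --> (0 : R).
  rewrite -[0](mulr0 L); apply: cvgMr.
  rewrite (_ : e = fun n => M / (1 - q) * q ^+ n); last first.
    by apply/funext => n; rewrite /e; ring.
  rewrite -[0](mulr0 (M / (1 - q))); apply: cvgMr.
  by apply: cvg_expr; rewrite ger0_norm.
apply/cvgrPdist_le => eps eps0.
move/cvgrPdist_le: e_cvg => /(_ eps eps0); apply: filterS => n.
rewrite sub0r normrN => h; rewrite (le_trans (dist n))//.
exact: le_trans (ler_norm _) h.
Qed.

Lemma ler_mean_square f1 f2 f3 : holomorphic f1 -> holomorphic f2 ->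
  holomorphic f3 ->
  (forall z, disk z ->
    modulus (f1 z) ^+ 2 <= modulus (f2 z) ^+ 2 + modulus (f3 z) ^+ 2) ->
  mean (fun x => f1 (zeta x) * conjc (f1 (zeta x))) <=
  mean (fun x => f2 (zeta x) * conjc (f2 (zeta x))) +
  mean (fun x => f3 (zeta x) * conjc (f3 (zeta x))).
Proof.
move=> /holomorphic_has_ps[a1 /nice_has_ps H1].
move=> /holomorphic_has_ps[a2 /nice_has_ps H2].
move=> /holomorphic_has_ps[a3 /nice_has_ps H3] H.
have N p : nice p -> nice (fun x => p x * conjc (p x)).
  by move=> Hp; apply: niceM => //; exact: nice_conj.
rewrite -meanD; [|exact: N|exact: N].
apply: ler_mean; [exact: N|by apply: niceD; exact: N|].
move=> x Dx; rewrite cReD !mul_conj /=; apply: H.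
exact: le_lt_trans (zr Dx) rho1.
Qed.

Lemma mean_squareE (a : nat -> C) f : has_ps 1 a f ->
  (\int[mu]_(x in D) (modulus (f (zeta x)) ^+ 2 * g x)%:E =
   (mean (fun x => f (zeta x) * conjc (f (zeta x))))%:E)%E.
Proof.
move=> Hf; have nf := nice_has_ps Hf.
have nff : nice (fun x => f (zeta x) * conjc (f (zeta x))).
  by apply: niceM => //; exact: nice_conj.
rewrite /mean /Rintegral fineK; last first.
  exact: integrable_fin_num (nice_integrable nff).
by apply: eq_integral => x _; rewrite mul_conj.
Qed.

End MeanSquare.

Section DiagonalNorm.
Variable R : realType.
Local Notation C := R[i].

(* [N f] is the weighted l^2 norm of the Taylor coefficients of [f]. *)
Definition diag_norm (N : (C -> C) -> \bar R) (w : nat -> R) :=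
  [/\ forall n, 0 < w n,
      forall rho : R, 0 < rho -> rho < 1 ->
        exists2 c : R, 0 < c & forall n, c * rho ^+ n <= w n,
      forall a f, has_ps 1 a f ->
        N f = (\sum_(0 <= n <oo) (modulus (a n) ^+ 2 * w n)%:E)%E &
      forall f1 f2 f3, holomorphic f1 -> holomorphic f2 -> holomorphic f3 ->
        (forall z, disk z ->
          modulus (f1 z) ^+ 2 <= modulus (f2 z) ^+ 2 + modulus (f3 z) ^+ 2) ->
        (N f1 <= N f2 + N f3)%E].

Lemma cvg_exprn (u : nat -> R) (l : R) n : u @ \oo --> l ->
  (fun j => u j ^+ n) @ \oo --> l ^+ n.
Proof.
move=> ul; elim: n => [|n IH].
  by under eq_fun do rewrite expr0; exact: cvg_cst.
by under eq_fun do rewrite exprS; rewrite exprS; exact: cvgM.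
Qed.

(** Used with [W] the moments of a smaller circle or disk: its mean square is below the full
    weighted sum. *)
Lemma series_weight_le (v W w : nat -> R) (I : R) : (forall n, 0 <= v n) ->
  (forall n, 0 <= W n <= w n) ->
  (fun n => \sum_(k < n) v k * W k) @ \oo --> I ->
  (I%:E <= \sum_(0 <= n <oo) (v n * w n)%:E)%E.
Proof.
move=> v0 Ww HI; set S := (\sum_(_ <= _ <oo) _)%E.
have S0 : (0 <= S)%E.
  apply: nneseries_ge0 => n _ _; rewrite lee_fin mulr_ge0//.
  by have /andP[h1 h2] := Ww n; exact: le_trans h2.
have P n : ((\sum_(k < n) v k * W k)%:E <= S)%E.
  rewrite -sumEFin; apply: (@le_trans _ _ (\sum_(0 <= k < n) (v k * w k)%:E)%E).
    rewrite big_mkord; apply: lee_sum => k _.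
    by rewrite lee_fin ler_wpM2l//; have /andP[] := Ww k.
  apply: nneseries_lim_ge => k _ _; rewrite lee_fin mulr_ge0//.
  by have /andP[h1 h2] := Ww k; exact: le_trans h2.
move: S0 P; case: S => [x| |]//; last by move=> _ _; exact: leey.
rewrite lee_fin => x0 P; rewrite lee_fin.
by apply: (cvgr_to_le HI); apply: nearW => n; rewrite -lee_fin P.
Qed.

(** The converse exchange of limits. Each finite partial sum passes to the limit in j, and for fixed
    j it stays below [I j] by positivity. *)
Lemma series_weight_ge (v w : nat -> R) (W : nat -> nat -> R) (I : nat -> R)
  (X : \bar R) : (forall n, 0 <= v n) -> (forall n, 0 <= w n) ->
  (forall j n, 0 <= W j n) -> (forall n, W ^~ n @ \oo --> w n) ->
  (forall j, (fun n => \sum_(k < n) v k * W j k) @ \oo --> I j) ->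
  (forall j, ((I j)%:E <= X)%E) ->
  (\sum_(0 <= n <oo) (v n * w n)%:E <= X)%E.
Proof.
move=> v0 w0 W0 Ww HI IX.
have X0 : (0 <= X)%E.
  apply: le_trans (IX 0%N); rewrite lee_fin.
  apply: (cvgr_to_ge (HI 0%N)); apply: nearW => n.
  by rewrite sumr_ge0// => k _; rewrite mulr_ge0.
move: X0 IX; case: X => [x| |]//; last by move=> _ _; exact: leey.
rewrite lee_fin => x0 Ix.
apply: lime_le; first by apply: is_cvg_nneseries => n _ _; rewrite lee_fin mulr_ge0.
apply: nearW => n; rewrite big_mkord sumEFin lee_fin.
have Hs : (fun j => \sum_(k < n) v k * W j k) @ \oo --> \sum_(k < n) v k * w k.
  elim: (n) => [|m IH].
    by under eq_fun do rewrite big_ord0; rewrite big_ord0; exact: cvg_cst.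
  under eq_fun do rewrite big_ord_recr /=; rewrite big_ord_recr /=.
  by apply: cvgD IH _; exact: cvgMr.
apply: (cvgr_to_le Hs); apply: nearW => j.
rewrite -lee_fin (le_trans _ (Ix j))// lee_fin.
apply: (cvgr_to_ge (HI j)); exists n => // m /= nm.
rewrite -(subnKC nm) big_split_ord /= lerDl sumr_ge0// => k _.
by rewrite mulr_ge0.
Qed.

End DiagonalNorm.

(** * The Hardy norm, by mean squares over circles *)

Section Hardy.
Variable R : realType.
Local Notation C := R[i].
Local Notation mu := (@lebesgue_measure R).

Let D := `[0%R, (2 * pi)%R]%classic : set (measurableTypeR R).

Let pi0 : 0 < pi :> R := pi_gt0 R.

Let muD : mu D = (2 * pi)%:E.
Proof.
by rewrite /D lebesgue_measure_itv /= lte_fin mulr_gt0// -EFinB subr0.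
Qed.

Let Dfin : (mu D < +oo)%E. Proof. by rewrite muD ltry. Qed.

Let mD : measurable D. Proof. exact: measurable_itv. Qed.

Let mean1 := mean mu D (fun=> 1).

Definition hardy_circle (r : R) (f : C -> C) := (2 * pi)^-1 *
  mean1 (fun t => f (r%:C * expi t) * conjc (f (r%:C * expi t))).

Section Radius.
Variable r : R.
Hypotheses (r0 : 0 < r) (r1 : r < 1).

Let zeta (t : R) : C := r%:C * expi t.

Let mRe : measurable_fun D (fun t => complex.Re (zeta t)).
Proof.
under eq_fun do rewrite cReM /= mul0r subr0.
apply: measurable_funTS; apply: continuous_measurable_fun => t.
by apply: cvgMr; exact: continuous_cos.
Qed.

Let mIm : measurable_fun D (fun t => complex.Im (zeta t)).
Proof.
under eq_fun do rewrite cImM /= mul0r addr0.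
apply: measurable_funTS; apply: continuous_measurable_fun => t.
by apply: cvgMr; exact: continuous_sin.
Qed.

Let zr t : D t -> modulus (zeta t) <= r.
Proof. by rewrite modulusM modulus_expi mulr1 modulus_real gtr0_norm. Qed.

Let zz t m n : zeta t ^+ m * conjc (zeta t ^+ n) =
  (r ^+ m * r ^+ n)%:C * expi ((m%:R - n%:R) * t).
Proof.
have cz : conjc (zeta t) = r%:C * expi (- t).
  by rewrite /zeta conjcM conjc_real; congr (_ * _); rewrite /expi cosN sinN.
have cX : conjc (zeta t ^+ n) = (conjc (zeta t)) ^+ n by rewrite rmorphXn.
rewrite cX cz /zeta !exprMn rmorphM !rmorphXn /= -!expiMn mulrACA -expiD.
by congr (_ * expi _); rewrite mulrBl !mulr_natl mulNrn.
Qed.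

Let orth m n (c : C) : (m < n)%N ->
  mean1 (fun t => c * zeta t ^+ m * conjc (zeta t ^+ n)) = 0.
Proof.
move=> mn; pose k : R := m%:R - n%:R.
have k0 : k != 0 by rewrite subr_eq0 eqr_nat ltn_eqF.
(* On the circle the product of powers is a constant times e^(ikt) with k = m - n nonzero,
   integrated over a full period. *)
transitivity (complex.Re (cint 0 (2 * pi)
  (fun t => (c * (r ^+ m * r ^+ n)%:C) * expi (k * t)))).
  rewrite /mean1 /mean /=; apply: eq_Rintegral => t _.
  by rewrite mulr1 -!mulrA zz.
rewrite cintZ; last by move=> t _; exact: cderiv_ccont (cderiv_expi k t).
rewrite cint_expi ?mulr0//; first by rewrite mulr_gt0.
have e j : expi (j%:R * (2 * pi)) = 1 :> C.
  by rewrite mulr_natl expiMn expi2pi expr1n.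
by rewrite expi0 /k mulrBl expiD -expi_inv !e invr1 mulr1.
Qed.

Let momentE n : moment mu D (fun=> 1) zeta n = 2 * pi * r ^+ (2 * n).
Proof.
rewrite /moment /mean (@eq_Rintegral _ _ _ _ _ (fun=> r ^+ (2 * n))).
  rewrite Rintegral_cst// mulrC; congr (_ * _).
  by rewrite [X in fine X]muD.
move=> t _; rewrite mulr1 zz subrr mul0r expi0 mulr1 /= -exprD.
by rewrite mul2n addnn.
Qed.

Let hI f := hardy_circle r f.

Lemma hardy_circle_has_ps a f : has_ps 1 a f ->
  (fun n => \sum_(k < n) modulus (a k) ^+ 2 * r ^+ (2 * k)) @ \oo --> hI f.
Proof.
move=> Hf.
have := mean_square mD Dfin (g := fun=> 1) (B := 1) _ _ _ mRe mIm (ltW r0) r1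
  zr orth Hf.
move=> /(_ (measurable_cst _) (fun _ _ => ler01) (fun _ _ => lexx _)).
move=> H; rewrite (_ : (fun n => _) = fun n => (2 * pi)^-1 *
  \sum_(k < n) modulus (a k) ^+ 2 * moment mu D (fun=> 1) zeta k).
  exact: cvgMr.
apply/funext => n; rewrite mulr_sumr; apply: eq_bigr => k _; rewrite momentE.
by rewrite [RHS]mulrCA mulKf// mulf_neq0 ?pnatr_eq0 ?lt0r_neq0.
Qed.

Lemma hardy_circleE f : holomorphic f ->
  ((2 * pi)^-1%:E * \int[lebesgue_measure]_(t in `[0%R, (2 * pi)%R])
      (modulus (f ((r * cos t) +i* (r * sin t))) ^+ 2)%:E)%E = (hI f)%:E.
Proof.
move=> /holomorphic_has_ps[a Hf].
have := mean_squareE mD Dfin (g := fun=> 1) (B := 1) _ _ _ mRe mIm (ltW r0) r1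
  zr Hf.
move=> /(_ (measurable_cst _) (fun _ _ => ler01) (fun _ _ => lexx _)).
rewrite /hI /hardy_circle EFinM => <-; congr (_ * _)%E.
apply: eq_integral => t _; rewrite mulr1.
suff -> : zeta t = (r * cos t) +i* (r * sin t) by [].
by apply: complex_ext; rewrite ?(cReM, cImM) /=; ring.
Qed.

Lemma hardy_circle_le f1 f2 f3 : holomorphic f1 -> holomorphic f2 ->
  holomorphic f3 -> (forall z, disk z ->
    modulus (f1 z) ^+ 2 <= modulus (f2 z) ^+ 2 + modulus (f3 z) ^+ 2) ->
  hI f1 <= hI f2 + hI f3.
Proof.
move=> h1 h2 h3 H; rewrite /hI /hardy_circle -mulrDr ler_wpM2l ?invr_ge0 ?mulr_ge0 ?(ltW pi0)//.
by apply: (ler_mean_square mD Dfin (g := fun=> 1) (B := 1) _ _ _ mRe mIm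
  (ltW r0) r1 zr).
Qed.

End Radius.

Theorem hardy_diag_norm : diag_norm (@hardy_norm2 R) (fun=> 1).
Proof.
split => //.
- by move=> rho rho0 rho1; exists 1 => // n; rewrite mul1r exprn_ile1// ltW.
- move=> a f Hf; have fh := has_ps_holomorphic Hf.
  apply/eqP; rewrite eq_le; apply/andP; split.
    apply: ge_ereal_sup => _ [r /= rI <-].
    have /andP[r0 r1] : 0 < r < 1 by rewrite in_itv in rI.
    rewrite hardy_circleE//.
    apply: (@series_weight_le _ _ (fun k => r ^+ (2 * k))).
    + by move=> n; exact: sqr_ge0.
    + by move=> n; rewrite exprn_ge0 ?exprn_ile1// ltW.
    + exact: hardy_circle_has_ps.
  (* Radii increasing to 1; starting from the denominator 2 keeps the first one positive. *)
  pose r (j : nat) : R := 1 - j.+2%:R^-1.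
  have r0 j : 0 < r j by rewrite subr_gt0 invf_lt1// ltr1n.
  have r1 j : r j < 1 by rewrite ltrBlDr ltrDl invr_gt0.
  have rc : r @ \oo --> (1 : R).
    rewrite -[1]subr0; apply: cvgB; first exact: cvg_cst.
    have := @cvg_harmonic R; rewrite -(cvg_shiftS (@harmonic R)).
    exact.
  apply: (series_weight_ge (W := fun j k => r j ^+ (2 * k))
    (I := fun j => hardy_circle (r j) f)); last first.
  + move=> j; rewrite -hardy_circleE//; apply: ereal_sup_ubound.
    by exists (r j) => //=; rewrite in_itv /= r0 r1.
  + by move=> j; exact: hardy_circle_has_ps.
  + move=> n; rewrite -[1](expr1n _ (2 * n)); exact: cvg_exprn.
  + by move=> j n; rewrite exprn_ge0// ltW.
  + by [].
  + by move=> n; exact: sqr_ge0.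
- move=> f1 f2 f3 h1 h2 h3 H; apply: ge_ereal_sup => _ [r /= rI <-].
  have /andP[r0 r1] : 0 < r < 1 by rewrite in_itv in rI.
  rewrite hardy_circleE//.
  have sup f : holomorphic f -> ((hardy_circle r f)%:E <= hardy_norm2 f)%E.
    by move=> fh; rewrite -hardy_circleE//; apply: ereal_sup_ubound; exists r.
  apply: le_trans (leeD (sup _ h2) (sup _ h3)).
  by rewrite -EFinD lee_fin; exact: hardy_circle_le.
Qed.

End Hardy.

(** * Plane Lebesgue measure under shears, rotations and homotheties *)

Section PlaneMeasure.
Variable R : realType.
Local Notation mu := (@lebesgue_measure R).
Local Notation mR := (measurableTypeR R).
Local Notation mu2 := (mu \x mu)%E.

Let maff (s c : R) : measurable_fun [set: mR] (fun y : mR => s * y + c : mR).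
Proof.
apply: measurable_funD => //; apply: measurable_funM => //.
Qed.

Lemma lebesgue_measure_shift (c : R) (A : set mR) : measurable A ->
  mu ((fun y : mR => y + c : mR) @^-1` A) = mu A.
Proof.
move=> mA.
have mf : measurable_fun [set: mR] (fun y : mR => y + c : mR).
  by have := maff 1 c; under eq_fun do rewrite mul1r.
apply/esym.
apply: (@lebesgue_measure_unique R (pushforward mu (fun y : mR => y + c : mR))
  _ A mA) => _ [[a b]] _ <-.
rewrite /= /pushforward (_ : _ @^-1` _ = `]a - c, b - c]%classic).
  rewrite !lebesgue_measure_itv /= !lte_fin ltrD2r -!EFinB.
  by congr (if _ then _%:E else _); ring.
by apply/seteqP; split => y /=; rewrite !in_itv /= ltrBlDr lerBrDr.
Qed.

Lemma lebesgue_measure_scale (s : R) (A : set mR) : 0 < s -> measurable A ->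
  mu ((fun y : mR => s * y : mR) @^-1` A) = (s^-1%:E * mu A)%E.
Proof.
move=> s0 mA.
have mf : measurable_fun [set: mR] (fun y : mR => s * y : mR).
  by have := maff s 0; under eq_fun do rewrite addr0.
have H : mu A = mscale (NngNum (ltW s0))
    (pushforward mu (fun y : mR => s * y : mR)) A.
  move=> m; apply: lebesgue_measure_unique mA => _ [[a b]] _ <-.
  transitivity (s%:E * mu ((fun y : mR => (s * y)%R : mR) @^-1` `]a, b]))%E => //=.
  rewrite (_ : _ @^-1` _ = `](a / s), (b / s)]%classic).
    rewrite !lebesgue_measure_itv /= !lte_fin ltr_pM2r ?invr_gt0//.
    case: ifPn => _; last by rewrite mule0.
    by rewrite -!EFinB -EFinM -mulrBl mulrC divfK// gt_eqF.
  apply/seteqP; split => y /=; rewrite !in_itv /= ltr_pdivrMr// ler_pdivlMr//;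
    by rewrite mulrC.
rewrite (H mf) /mscale /pushforward /= muleA -EFinM mulVf ?gt_eqF// mul1e.
by [].
Qed.

(** Allows slicing in either variable: a shear along the first axis translates the horizontal
    slices, one along the second axis the vertical ones. *)
Lemma product_lebesgue_measure21 (A : set (mR * mR)) : measurable A ->
  (mu \x mu)%E A = (mu \x^ mu)%E A.
Proof.
move=> mA; apply: (@product_measure_unique _ _ _ _ R mu mu (mu \x^ mu)%E) => //.
by move=> X Y mX mY; exact: product_measure2E.
Qed.

Lemma measurable_shear_y (s : R) :
  measurable_fun [set: mR * mR] (fun p : mR * mR => (p.1, p.2 + s * p.1) : mR * mR).
Proof.
apply: measurable_fun_pair => //.
by apply: measurable_funD => //; exact: measurable_funM.
Qed.

Lemma measurable_shear_x (s : R) :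
  measurable_fun [set: mR * mR] (fun p : mR * mR => (p.1 + s * p.2, p.2) : mR * mR).
Proof.
apply: measurable_fun_pair => //.
by apply: measurable_funD => //; exact: measurable_funM.
Qed.

Lemma plane_measure_shear_y (s : R) (A : set (mR * mR)) : measurable A ->
  mu2 ((fun p : mR * mR => (p.1, p.2 + s * p.1) : mR * mR) @^-1` A) = mu2 A.
Proof.
move=> mA; rewrite /product_measure1; apply: eq_integral => x _ /=.
rewrite -[RHS](lebesgue_measure_shift (s * x)); last exact: measurable_xsection.
by congr (mu _); apply/seteqP; split => y /=; rewrite /xsection /= !inE.
Qed.

Lemma plane_measure_shear_x (s : R) (A : set (mR * mR)) : measurable A ->
  mu2 ((fun p : mR * mR => (p.1 + s * p.2, p.2) : mR * mR) @^-1` A) = mu2 A.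
Proof.
move=> mA; rewrite !product_lebesgue_measure21//; last first.
  by rewrite -[X in measurable X]setTI; exact: measurable_shear_x.
rewrite /product_measure2; apply: eq_integral => y _ /=.
rewrite -[RHS](lebesgue_measure_shift (s * y)); last exact: measurable_ysection.
by congr (mu _); apply/seteqP; split => x /=; rewrite /ysection /= !inE.
Qed.

Definition plane_rot (t : R) (p : mR * mR) : mR * mR :=
  (cos t * p.1 - sin t * p.2, sin t * p.1 + cos t * p.2).

(** A rotation by t is a product of three shears, with parameters -tan(t/2), sin t, -tan(t/2), where
    tan(t/2) = (1 - cos t) / sin t. Rotation invariance thus reduces to translations on the line. *)
Let rot_shears (t : R) : sin t != 0 ->
  let sx := fun p : mR * mR => (p.1 + - ((1 - cos t) / sin t) * p.2, p.2) : mR * mR in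
  let sy := fun p : mR * mR => (p.1, p.2 + sin t * p.1) : mR * mR in
  plane_rot t = sx \o sy \o sx.
Proof.
move=> st sx sy; apply/funext => -[x y]; rewrite /plane_rot /sx /sy /=.
have cs : sin t ^+ 2 = (1 - cos t) * (1 + cos t).
  by rewrite -[_ ^+ 2](addKr (cos t ^+ 2)) cos2Dsin2; ring.
congr (_, _).
  apply: (mulfI st).
  rewrite (_ : sin t * (cos t * x - sin t * y) = cos t * sin t * x - sin t ^+ 2 * y).
    by rewrite cs; field.
  by ring.
by field.
Qed.

Lemma measurable_rot (t : R) : measurable_fun [set: mR * mR] (plane_rot t).
Proof.
apply: measurable_fun_pair.
  by apply: measurable_funB; apply: measurable_funM.
by apply: measurable_funD; apply: measurable_funM.
Qed.

Lemma plane_measure_rot (t : R) (A : set (mR * mR)) : sin t != 0 -> measurable A ->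
  mu2 (plane_rot t @^-1` A) = mu2 A.
Proof.
move=> st mA; rewrite (rot_shears st) !comp_preimage.
have msx s (B : set (mR * mR)) : measurable B ->
  measurable ((fun p : mR * mR => (p.1 + s * p.2, p.2) : mR * mR) @^-1` B).
  by move=> mB; rewrite -[X in measurable X]setTI; exact: measurable_shear_x.
have msy s (B : set (mR * mR)) : measurable B ->
  measurable ((fun p : mR * mR => (p.1, p.2 + s * p.1) : mR * mR) @^-1` B).
  by move=> mB; rewrite -[X in measurable X]setTI; exact: measurable_shear_y.
rewrite plane_measure_shear_x; last by apply: msy; exact: msx.
by rewrite plane_measure_shear_y ?plane_measure_shear_x//; exact: msx.
Qed.

(** One factor 1/s comes from scaling the slices, the other from the change of variable in the outer
    integral. *)
Lemma plane_measure_scale (s : R) (A : set (mR * mR)) : 0 < s -> measurable A ->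
  mu2 ((fun p : mR * mR => (s * p.1, s * p.2) : mR * mR) @^-1` A) =
  (s^-1%:E * (s^-1%:E * mu2 A))%E.
Proof.
move=> s0 mA; rewrite /product_measure1.
have ms : measurable_fun [set: mR] (fun y : mR => s * y : mR).
  by have := maff s 0; under eq_fun do rewrite addr0.
transitivity (\int[mu]_x (s^-1%:E * mu (xsection A (s * x)%R)))%E.
  apply: eq_integral => x _ /=.
  by rewrite -lebesgue_measure_scale//; exact: measurable_xsection.
have mx : measurable_fun [set: mR] (fun x => mu (xsection A x)).
  exact: measurable_fun_xsection.
rewrite ge0_integralZl//; last 2 first.
- exact: (measurableT_comp mx ms).
- by rewrite lee_fin invr_ge0 ltW.
congr (_ * _)%E.
have := @ge0_integral_pushforward _ _ mR mR R _ ms mu setT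
  (fun x => mu (xsection A x)) measurableT mx (fun _ _ => measure_ge0 _ _).
rewrite preimage_setT /= => <-.
have s1 : 0 <= s^-1 by rewrite invr_ge0 ltW.
rewrite (@eq_measure_integral _ _ _ _ (mscale (NngNum s1) mu)); last first.
  by move=> B mB _; exact: (lebesgue_measure_scale s0 mB).
by rewrite ge0_integral_mscale.
Qed.

End PlaneMeasure.

(** * The weighted Bergman norms, by exhaustion of the disk *)

Section Bergman.
Variable R : realType.
Local Notation C := R[i].
Local Notation mu := (@lebesgue_measure R).
Local Notation mR := (measurableTypeR R).
Local Notation mu2 := (mu \x mu)%E.

(** Together with [powR_ge_max] this bounds the weight (1 - |z|^2)^alpha without a case distinction
    on the sign of alpha. *)
Lemma powR_le_min (a u x : R) : 0 < a -> a <= u -> u <= 1 ->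
  u `^ x <= a `^ Num.min x 0.
Proof.
move=> a0 au u1; have u0 : 0 < u by exact: lt_le_trans au.
apply: (@le_trans _ _ (u `^ Num.min x 0)).
  by apply: ger_powR; rewrite ?u0// ge_min lexx.
rewrite -[Num.min x 0]opprK !(powRN _ (- _)) lef_pV2 ?posrE ?powR_gt0//.
by apply: ge0_ler_powR => //; rewrite ?nnegrE ?oppr_ge0 ?ge_min ?lexx ?orbT// ltW.
Qed.

Lemma powR_ge_max (a u x : R) : 0 < a -> a <= u -> u <= 1 ->
  a `^ Num.max x 0 <= u `^ x.
Proof.
move=> a0 au u1; have u0 : 0 < u by exact: lt_le_trans au.
apply: (@le_trans _ _ (u `^ Num.max x 0)).
  by apply: ge0_ler_powR => //; rewrite ?nnegrE ?le_max ?lexx ?orbT// ltW.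
by apply: ger_powR; rewrite ?u0// le_max lexx.
Qed.

Let sq (p : mR * mR) : R := p.1 ^+ 2 + p.2 ^+ 2.

Let msq : measurable_fun [set: mR * mR] sq.
Proof. by apply: measurable_funD; apply: measurable_funX. Qed.

Let sq_ge0 p : 0 <= sq p. Proof. by rewrite addr_ge0// sqr_ge0. Qed.

Let zeta (p : mR * mR) : C := p.1 +i* p.2.

Let modulus_zeta p : modulus (zeta p) ^+ 2 = sq p.
Proof. by rewrite sqr_modulus. Qed.

Let dsk (s : R) : set (mR * mR) := [set p | sq p < s].

Let mdsk s : measurable (dsk s).
Proof.
rewrite (_ : dsk s = sq @^-1` `]-oo, s[%classic).
  by rewrite -[X in measurable X]setTI; exact: msq.
by apply/seteqP; split => p /=; rewrite in_itv.
Qed.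

Let area := fine (mu2 (dsk 1)).

Let dsk1_fin : (mu2 (dsk 1) < +oo)%E.
Proof.
apply: (@le_lt_trans _ _ (mu2 (`[-1, 1]%classic `*` `[-1, 1]%classic))).
  apply: le_measure; rewrite ?inE//; first exact: measurableX.
  move=> p; rewrite /dsk /sq /= !in_itv /= => H.
  have h1 : p.1 ^+ 2 <= 1 by rewrite (le_trans _ (ltW H))// lerDl sqr_ge0.
  have h2 : p.2 ^+ 2 <= 1 by rewrite (le_trans _ (ltW H))// lerDr sqr_ge0.
  have le1 (x : R) : x ^+ 2 <= 1 -> -1 <= x <= 1.
    move=> x1; rewrite -ler_norml -(@ler_pXn2r _ 2) ?nnegrE// expr1n.
    by rewrite real_normK ?num_real.
  by split; exact: le1.
rewrite product_measure1E//= !lebesgue_measure_itv /= lte_fin.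
by case: ifPn => _; rewrite ?mule0 ?ltry// -EFinB -EFinM ltry.
Qed.

Let area_gt0 : 0 < area.
Proof.
rewrite fine_gt0// dsk1_fin andbT.
apply: (@lt_le_trans _ _ (mu2 (`[0%R, 2^-1]%classic `*` `[0%R, 2^-1]%classic))).
  rewrite product_measure1E//= !lebesgue_measure_itv /= lte_fin invr_gt0 ltr0n.
  by rewrite -EFinB subr0 -EFinM lte_fin mulr_gt0 ?invr_gt0.
apply: le_measure; rewrite ?inE//; first exact: measurableX.
move=> p [/=]; rewrite !in_itv /dsk /sq /= => /andP[h1 h2] /andP[h3 h4].
have h5 : p.1 ^+ 2 <= 2^-1 ^+ 2 by rewrite lerXn2r ?nnegrE// invr_ge0.
have h6 : p.2 ^+ 2 <= 2^-1 ^+ 2 by rewrite lerXn2r ?nnegrE// invr_ge0.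
rewrite (le_lt_trans (lerD h5 h6))//; lra.
Qed.

Let dskE s : 0 < s -> mu2 (dsk s) = (s * area)%:E.
Proof.
move=> s0; pose q := Num.sqrt s.
have q0 : 0 < q by rewrite sqrtr_gt0.
have qq : q * q = s by rewrite -[LHS]/(q ^+ 2) sqr_sqrtr// ltW.
have qV : 0 < q^-1 by rewrite invr_gt0.
rewrite (_ : dsk s = (fun p : mR * mR => (q^-1 * p.1, q^-1 * p.2) : mR * mR)
  @^-1` dsk 1).
  rewrite (plane_measure_scale qV (mdsk 1)) invrK muleA -EFinM qq EFinM fineK//.
  by rewrite ge0_fin_numE.
apply/seteqP; split => p; rewrite /dsk /sq /= !exprMn -mulrDr exprVn [q ^+ 2]qq.
  by rewrite mulrC ltr_pdivrMr// mul1r.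
by rewrite mulrC ltr_pdivrMr// mul1r.
Qed.

Variable alpha : R.
Hypothesis alpha1 : -1 < alpha.

Let c0 : R := pi^-1 * (alpha + 1).
Let c0_gt0 : 0 < c0.
Proof. by rewrite mulr_gt0 ?invr_gt0 ?pi_gt0//; move: alpha1; lra. Qed.

Let wt (p : mR * mR) : R := c0 * (1 - sq p) `^ alpha.

Let mwt : measurable_fun [set: mR * mR] wt.
Proof.
apply: measurable_funM => //.
have m1 : measurable_fun [set: mR * mR] (fun p => 1 - sq p) by exact: measurable_funB.
exact: (@measurableT_comp _ _ _ _ _ _ (@powR R ^~ alpha) _ (fun p => 1 - sq p)).
Qed.

Let wt_ge0 p : 0 <= wt p.
Proof. by rewrite mulr_ge0 ?powR_ge0// ltW. Qed.

(* The disk is exhausted by the disks |z|^2 < 1 - 2^-(k+1), so that the areas of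
   the successive annuli are proportional to 2^-(k+2). *)
Let a (k : nat) : R := 2^-1 ^+ k.+1.

Let a_gt0 k : 0 < a k. Proof. by rewrite exprn_gt0// invr_gt0. Qed.
Let a_lt1 k : a k < 1. Proof. by rewrite exprn_ilt1//; lra. Qed.
Let aS k : a k.+1 = a k / 2. Proof. by rewrite /a exprS mulrC. Qed.

Let D k := dsk (1 - a k).

Let mD k : measurable (D k). Proof. exact: mdsk. Qed.

Let Dfin k : (mu2 (D k) < +oo)%E.
Proof. by rewrite dskE ?ltry// subr_gt0. Qed.

Let wt_le k p : sq p <= 1 - a k -> wt p <= c0 * a k `^ Num.min alpha 0.
Proof.
move=> pk; rewrite /wt ler_wpM2l ?(ltW c0_gt0)// powR_le_min//.
  by rewrite lerBrDl addrC -lerBrDl.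
by rewrite gerBl.
Qed.

Let wt_ge k p : sq p <= 1 - a k -> c0 * a k `^ Num.max alpha 0 <= wt p.
Proof.
move=> pk; rewrite /wt ler_wpM2l ?(ltW c0_gt0)// powR_ge_max//.
  by rewrite lerBrDl addrC -lerBrDl.
by rewrite gerBl.
Qed.

Let rho k := Num.sqrt (1 - a k).
Let rho_ge0 k : 0 <= rho k. Proof. exact: sqrtr_ge0. Qed.
Let rho_lt1 k : rho k < 1.
Proof.
rewrite -sqrtr1 ltr_sqrt// ltrBlDr ltrDl; exact: a_gt0.
Qed.

Let zeta_le k p : D k p -> modulus (zeta p) <= rho k.
Proof.
move=> Dp; rewrite -[modulus _]ger0_norm// -sqrtr_sqr modulus_zeta ler_sqrt ?ltW//.
by rewrite subr_gt0.
Qed.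

Let mRe A : measurable_fun A (fun p => complex.Re (zeta p)).
Proof. by apply: measurable_funTS; exact: measurable_fst. Qed.

Let mIm A : measurable_fun A (fun p => complex.Im (zeta p)).
Proof. by apply: measurable_funTS; exact: measurable_snd. Qed.

Let wt_D k p : D k p -> wt p <= c0 * a k `^ Num.min alpha 0.
Proof. by move=> /ltW; exact: wt_le. Qed.

Let meanD_ k := mean mu2 (D k) wt.

Let sq_rot (t : R) (p : mR * mR) : sq (plane_rot t p) = sq p.
Proof.
rewrite /sq /plane_rot /=.
have := cos2Dsin2 t; move: (cos t) (sin t) => c s cs.
rewrite (_ : _ + _ = (c ^+ 2 + s ^+ 2) * (p.1 ^+ 2 + p.2 ^+ 2)); last by ring.
by rewrite cs mul1r.
Qed.

Let zeta_rot (t : R) (p : mR * mR) : zeta (plane_rot t p) = expi t * zeta p.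
Proof.
by apply: complex_ext; rewrite !(cReM, cImM) /=; ring.
Qed.

Let nzeta k : nice (D k) zeta.
Proof. by split; [exact: mRe|exact: mIm|exists (rho k); exact: zeta_le]. Qed.

Let nmono k m n (c : C) : nice (D k) (fun p => c * zeta p ^+ m * conjc (zeta p ^+ n)).
Proof.
apply: niceM; last by apply: nice_conj; exact: niceX.
by apply: niceM; [exact: nice_cst|exact: niceX].
Qed.

(** Change of variables by a rotation, which preserves the disk, the weight and the measure and
    multiplies the monomial by a constant. *)
Let mean_mono_rot k m n (c : C) t : sin t != 0 ->
  meanD_ k (fun p => c * zeta p ^+ m * conjc (zeta p ^+ n)) =
  meanD_ k (fun p => c * (expi t ^+ m * conjc (expi t ^+ n)) * zeta p ^+ m *
    conjc (zeta p ^+ n)).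
Proof.
move=> st; pose h (p : mR * mR) : \bar R :=
  (complex.Re (c * zeta p ^+ m * conjc (zeta p ^+ n)) * wt p)%:E.
have mr := @measurable_rot R t.
have rotD : plane_rot t @^-1` D k = D k.
  by apply/seteqP; split => p; rewrite /D /dsk /= sq_rot.
have hrot p : h (plane_rot t p) = (complex.Re (c * (expi t ^+ m * conjc (expi t ^+ n)) *
    zeta p ^+ m * conjc (zeta p ^+ n)) * wt p)%:E.
  rewrite /h /wt sq_rot zeta_rot !exprMn conjcM; congr (complex.Re _ * _)%:E.
  by ring.
have mh : measurable_fun [set: mR * mR] h.
  apply/measurable_EFinP; apply: measurable_funM => //.
  have mX j : measurable_fun [set: mR * mR] (fun p => complex.Re (zeta p ^+ j)) /\
    measurable_fun [set: mR * mR] (fun p => complex.Im (zeta p ^+ j)).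
    elim: j => [|j [IH1 IH2]].
      by split; under eq_fun do rewrite expr0; exact: measurable_cst.
    split; under eq_fun do rewrite exprS.
      under eq_fun do rewrite cReM.
      by apply: measurable_funB; apply: measurable_funM.
    under eq_fun do rewrite cImM.
    by apply: measurable_funD; apply: measurable_funM.
  have [m1 m2] := mX m; have [m3 m4] := mX n.
  rewrite (_ : (fun x => _) = fun p =>
    (complex.Re c * complex.Re (zeta p ^+ m) - complex.Im c * complex.Im (zeta p ^+ m)) *
      complex.Re (zeta p ^+ n) +
    (complex.Re c * complex.Im (zeta p ^+ m) + complex.Im c * complex.Re (zeta p ^+ m)) *
      complex.Im (zeta p ^+ n)); last first.
    apply/funext => p; rewrite cReM cReM cImM.
    by case: (zeta p ^+ n) => x y /=; ring.
  apply: measurable_funD; apply: measurable_funM => //.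
    by apply: measurable_funB; apply: measurable_funM.
  by apply: measurable_funD; apply: measurable_funM.
have intg : mu2.-integrable (plane_rot t @^-1` D k) (h \o plane_rot t).
  have hE : h \o plane_rot t = EFin \o (fun p => complex.Re (c *
      (expi t ^+ m * conjc (expi t ^+ n)) * zeta p ^+ m * conjc (zeta p ^+ n)) * wt p).
    by apply/funext => p; exact: hrot.
  have H := nice_integrable (mD k) (Dfin k) (measurable_funTS mwt)
    (fun p _ => wt_ge0 p) (@wt_D k) (nmono k m n (c * (expi t ^+ m * conjc (expi t ^+ n)))).
  by rewrite rotD hE.
have := integral_pushforward mr mh intg (mD k).
rewrite rotD (@eq_measure_integral _ _ _ _ mu2); last first.
  by move=> B mB _; exact: plane_measure_rot.
move=> H; apply: (congr1 fine); apply: etrans H _.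
by apply: eq_integral => p _; exact: hrot.
Qed.

(** Rotation invariance gives mean 0 to every multiple of (1 - kappa) z^m conj(z^n), where kappa is
    the constant produced by the rotation; if kappa is not 1, dividing [c] by 1 - kappa gives the
    claim. *)
Let orth k m n (c : C) : (m < n)%N ->
  meanD_ k (fun p => c * zeta p ^+ m * conjc (zeta p ^+ n)) = 0.
Proof.
(* This angle gives kappa = e^(-i), visibly different from 1, and lies in (0, pi), so that its sine
   is nonzero. *)
move=> mn; pose t : R := (n - m)%:R^-1.
have d0 : 0 < (n - m)%:R :> R by rewrite ltr0n subn_gt0.
have t0 : 0 < t by rewrite invr_gt0.
have t1 : t <= 1 by rewrite invf_le1// ler1n subn_gt0.
have pi1 : 1 < pi :> R by rewrite (lt_le_trans _ (pi_ge2 R))// ltr1n.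
have st : sin t != 0.
  by rewrite gt_eqF// sin_gt0_pi// t0 (le_lt_trans t1).
pose kappa : C := expi t ^+ m * conjc (expi t ^+ n).
have kappaE : kappa = expi (- 1).
  have cE : conjc (expi t ^+ n) = expi (- (t *+ n)).
    by rewrite -expiMn /expi cosN sinN.
  rewrite /kappa cE -expiMn -expiD; congr expi.
  by rewrite -[in LHS](subnKC (ltnW mn)) mulrnDr opprD addNKr -mulr_natl mulfV ?gt_eqF.
have kappa1 : 1 - kappa != 0.
  rewrite subr_eq0; apply/eqP; rewrite kappaE => -[_ /eqP].
  by rewrite sinN eq_sym oppr_eq0 gt_eqF// sin_gt0_pi// ltr01.
have H c' : meanD_ k (fun p => (1 - kappa) * c' * zeta p ^+ m * conjc (zeta p ^+ n)) = 0.
  rewrite (_ : (fun p => _) = fun p => c' * zeta p ^+ m * conjc (zeta p ^+ n) -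
    c' * kappa * zeta p ^+ m * conjc (zeta p ^+ n)).
    rewrite /meanD_ (meanB (mD k) (Dfin k) (measurable_funTS mwt)
      (fun p _ => wt_ge0 p) (@wt_D k)); [|exact: nmono|exact: nmono].
    by rewrite -/(meanD_ k) (mean_mono_rot k m n c' st) subrr.
  by apply/funext => p; ring.
have := H (c / (1 - kappa)).
by rewrite mulrCA divff// mulr1.
Qed.

Let W k n := moment mu2 (D k) wt zeta n.

Let zz p n : zeta p ^+ n * conjc (zeta p ^+ n) = (sq p ^+ n)%:C.
Proof. by rewrite mul_conj modulusX exprAC modulus_zeta. Qed.

Let WE k n : W k n = \int[mu2]_(p in D k) (sq p ^+ n * wt p).
Proof. by apply: eq_Rintegral => p _; rewrite zz. Qed.

Let itg k n : mu2.-integrable (D k) (EFin \o (fun p => sq p ^+ n * wt p)).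
Proof.
have := nice_integrable (mD k) (Dfin k) (measurable_funTS mwt)
    (fun p _ => wt_ge0 p) (@wt_D k) (nmono k n n 1).
by rewrite (_ : EFin \o _ = EFin \o (fun p => sq p ^+ n * wt p))//;
  apply/funext => p /=; rewrite mul1r zz.
Qed.

Let sub_D k : D k `<=` D k.+1.
Proof.
move=> p; rewrite /D /dsk /= aS => pk; rewrite (lt_le_trans pk)// lerD2l lerN2.
by have := a_gt0 k; lra.
Qed.

Let A k := D k.+1 `\` D k.

Let mA k : measurable (A k). Proof. exact: measurableD. Qed.

Let areaA k : mu2 (A k) = (a k.+1 * area)%:E.
Proof.
rewrite measureD//; last exact: Dfin.
rewrite setIidr; last exact: sub_D.
rewrite [X in (X - _)%E]dskE ?subr_gt0// [X in (_ - X)%E]dskE ?subr_gt0//.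
rewrite -EFinB -mulrBl; congr (_ * _)%:E.
by rewrite aS; lra.
Qed.

Let J k n := \int[mu2]_(p in A k) (sq p ^+ n * wt p).

Let itgA k n : mu2.-integrable (A k) (EFin \o (fun p => sq p ^+ n * wt p)).
Proof. by apply: integrableS (itg k.+1 n) => // p []. Qed.

Let WS k n : W k.+1 n = W k n + J k n.
Proof.
rewrite !WE -{1}(setDUK (@sub_D k)) Rintegral_setU//.
- exact: mA.
- rewrite setDUK; [exact: itg|exact: sub_D].
- by apply/disj_setPS => p [] ? [].
Qed.

Let A_cst k (c : R) : mu2.-integrable (A k) (EFin \o fun=> c).
Proof.
apply: measurable_bounded_integrable; [exact: mA| |exact: measurable_cst|].
  by rewrite [X in (X < _)%E]areaA ltry.
exists `|c|; split; first exact: num_real.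
by move=> x cx y _ /=; exact: ltW.
Qed.

Let J_le k : J k 0 <= c0 * a k.+1 `^ Num.min alpha 0 * (a k.+1 * area).
Proof.
rewrite (_ : a k.+1 * area = fine (mu2 (A k))); last by rewrite areaA.
rewrite -Rintegral_cst; last exact: mA.
apply: le_Rintegral; [exact: mA|exact: itgA|exact: A_cst|].
by move=> p [pk _]; rewrite expr0 mul1r wt_D.
Qed.

Let J_ge k n : (1 - a k) ^+ n * (c0 * a k.+1 `^ Num.max alpha 0 * (a k.+1 * area)) <= J k n.
Proof.
rewrite (_ : a k.+1 * area = fine (mu2 (A k))); last by rewrite areaA.
rewrite mulrA -Rintegral_cst; last exact: mA.
apply: le_Rintegral; [exact: mA|exact: A_cst|exact: itgA|].
move=> p [/ltW pk /negP]; rewrite -leNgt => kp.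
have ak0 : 0 <= 1 - a k by rewrite subr_ge0 ltW.
rewrite ler_pM ?exprn_ge0 ?(mulr_ge0 (ltW c0_gt0)) ?powR_ge0//.
  by rewrite lerXn2r ?nnegrE.
exact: wt_ge.
Qed.

Let J_ge0 k n : 0 <= J k n.
Proof. by apply: Rintegral_ge0 => p _; rewrite mulr_ge0// exprn_ge0. Qed.

Let W_ge0 k n : 0 <= W k n.
Proof. by rewrite WE; apply: Rintegral_ge0 => p _; rewrite mulr_ge0// exprn_ge0. Qed.

Let W_le0 k n : W k n <= W k 0.
Proof.
rewrite !WE; apply: le_Rintegral; [exact: mD|exact: itg|exact: itg|].
move=> p /ltW pk; rewrite ler_wpM2r// expr0 exprn_ile1//.
by rewrite (le_trans pk)// gerBl ltW.
Qed.

(** The mass of the k-th annulus is at most a constant times q^(k + 2): a power of 1/2 from its area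
    times the extreme value of the weight. The condition alpha > -1 is what makes q < 1, hence the
    total mass finite. *)
Let q : R := 2^-1 `^ (1 + Num.min alpha 0).

Let b_gt0 : 0 < 1 + Num.min alpha 0.
Proof. by rewrite -ltrBlDl sub0r lt_min alpha1 oppr_lt0 ltr01. Qed.

Let q_ge0 : 0 <= q. Proof. exact: powR_ge0. Qed.

Let q_lt1 : q < 1.
Proof.
have <- : 1 `^ (1 + Num.min alpha 0) = 1 :> R by rewrite powR1.
rewrite /q.
by apply: gt0_ltr_powR => //; rewrite ?nnegrE ?invr_ge0// invf_lt1// ltr1n.
Qed.

Let aq k : a k.+1 `^ Num.min alpha 0 * a k.+1 = q ^+ k.+2.
Proof.
have a0 := a_gt0 k.+1.
rewrite mulrC -{1}[a k.+1]powRr1 ?(ltW a0)// -powRD; last first.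
  by rewrite (gt_eqF a0) implybT.
by rewrite /a -powR_mulrn ?invr_ge0// powRAC powR_mulrn ?powR_ge0.
Qed.

Let W_bound k n : W k n <= W 0 0 + c0 * area / (1 - q).
Proof.
apply: le_trans (W_le0 k n) _.
have {n} : W k 0 <= W 0 0 + c0 * area * \sum_(j < k) q ^+ j.
  elim: k => [|k IH]; first by rewrite big_ord0 mulr0 addr0.
  rewrite WS big_ord_recr /= mulrDr addrA lerD//.
  apply: le_trans (J_le k) _.
  rewrite (_ : _ * _ = c0 * area * (a k.+1 `^ Num.min alpha 0 * a k.+1)); last by ring.
  rewrite aq ler_wpM2l ?(mulr_ge0 (ltW c0_gt0)) ?(ltW area_gt0)//.
  by rewrite ler_wiXn2l ?(ltW q_lt1)// ltnW.
move/le_trans; apply; rewrite lerD2l ler_wpM2l ?sum_geo_le//.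
by rewrite (mulr_ge0 (ltW c0_gt0)) ?(ltW area_gt0).
Qed.

Let W_nd n : nondecreasing_seq (W ^~ n).
Proof. by apply/nondecreasing_seqP => k; rewrite WS lerDl. Qed.

Let W_cvg n : cvgn (W ^~ n).
Proof.
apply: nondecreasing_is_cvgn => //.
by exists (W 0 0 + c0 * area / (1 - q)) => _ [k _ <-]; exact: W_bound.
Qed.

(** The integral of |z|^(2n) against the weight over the whole disk, obtained as the limit over the
    exhausting disks. *)
Let w n : R := limn (W ^~ n).

Let W_le k n : W k n <= w n.
Proof. exact: (nondecreasing_cvgn_le (@W_nd n) (@W_cvg n) k). Qed.

Let a_cvg : a @ \oo --> (0 : R).
Proof.
rewrite /a (cvg_shiftS (fun k => 2^-1 ^+ k : R)); apply: cvg_expr.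
by rewrite ger0_norm; lra.
Qed.

(** A single annulus suffices: choose [k] with a k < 1 - r, so that |z|^2 >= 1 - a k > r throughout
    [A k]; its mass is the constant. *)
Let w_low (r : R) : 0 < r -> r < 1 ->
  exists2 c : R, 0 < c & forall n, c * r ^+ n <= w n.
Proof.
move=> r0 r1.
have r1' : 0 < 1 - r by rewrite subr_gt0.
move/cvgrPdist_le: a_cvg => /(_ _ r1')[k _ /(_ k (leqnn k))] /=.
rewrite sub0r normrN gtr0_norm// => ak.
exists (c0 * a k.+1 `^ Num.max alpha 0 * (a k.+1 * area)).
  exact: mulr_gt0 (mulr_gt0 c0_gt0 (powR_gt0 _ (a_gt0 _)))
    (mulr_gt0 (a_gt0 _) area_gt0).
move=> n; apply: le_trans (W_le k.+1 n); rewrite WS.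
apply: le_trans (lerD (W_ge0 k n) (J_ge k n)); rewrite add0r mulrC.
rewrite ler_wpM2r ?(mulr_ge0 (mulr_ge0 (ltW c0_gt0) (powR_ge0 _ _)))//.
  by rewrite mulr_ge0// ltW.
by rewrite lerXn2r ?nnegrE ?subr_ge0 ?(ltW r0) ?(ltW (a_lt1 k))// lerBrDl addrC -lerBrDl.
Qed.

Let dskD : dsk 1 = \bigcup_k D k.
Proof.
apply/seteqP; split => p /=.
  move=> p1; have p1' : 0 < 1 - sq p by rewrite subr_gt0.

  move/cvgrPdist_lt: a_cvg => /(_ _ p1')[k _ /(_ k (leqnn k))] /=.
  rewrite sub0r normrN gtr0_norm// => ak.
  by exists k => //; rewrite /D /dsk /= ltrBrDl addrC -ltrBrDl.
by move=> [k _]; rewrite /D /dsk /= => /lt_le_trans; apply; rewrite gerBl ltW.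
Qed.

Let modulus_lt1 p : dsk 1 p -> modulus (zeta p) < 1.
Proof.
by move=> p1; rewrite -[1]sqrtr1 -[modulus _]ger0_norm// -sqrtr_sqr modulus_zeta ltr_sqrt.
Qed.

Let mdens f : holomorphic f ->
  measurable_fun (dsk 1) (fun p => (modulus (f (zeta p)) ^+ 2 * wt p)%:E).
Proof.
move=> /holomorphic_has_ps[c Hf]; apply/measurable_EFinP.
apply: measurable_funM; last exact: measurable_funTS.
under eq_fun do rewrite sqr_modulus.
have mz n : measurable_fun (dsk 1) (fun p => complex.Re (psum c (zeta p) n)) /\
  measurable_fun (dsk 1) (fun p => complex.Im (psum c (zeta p) n)).
  have nz : nice (dsk 1) zeta.
    split; [exact: mRe|exact: mIm|exists 1 => p p1; exact: ltW (modulus_lt1 p1)].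
  by have [] := nice_psum c n nz.
apply: measurable_funD; apply: measurable_funX.
  apply: (@measurable_fun_cvg _ _ _ _ (fun n p => complex.Re (psum c (zeta p) n))).
    by move=> n; have [] := mz n.
  by move=> p p1; apply: ccvg_Re; exact: Hf (modulus_lt1 p1).
apply: (@measurable_fun_cvg _ _ _ _ (fun n p => complex.Im (psum c (zeta p) n))).
  by move=> n; have [] := mz n.
by move=> p p1; apply: ccvg_Im; exact: Hf (modulus_lt1 p1).
Qed.

Let dens_ge0 f p : (0 <= (modulus (f (zeta p)) ^+ 2 * wt p)%:E)%E.
Proof. by rewrite lee_fin mulr_ge0// sqr_ge0. Qed.

Let bergmanE f : holomorphic f -> bergman_norm2 alpha f =
  (\int[mu2]_(p in dsk 1) (modulus (f (zeta p)) ^+ 2 * wt p)%:E)%E.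
Proof.
move=> fh; rewrite /bergman_norm2.
have -> : [set p : R * R | disk (p.1 +i* p.2)] = dsk 1.
  apply/seteqP; split => p.
    rewrite /disk /dsk /= => p1; rewrite -modulus_zeta exprn_ilt1//.
  exact: modulus_lt1.
have E p : (pi^-1 * (modulus (f (zeta p)) ^+ 2 *
    ((alpha + 1) * (1 - modulus (zeta p) ^+ 2) `^ alpha)))%:E =
    (modulus (f (zeta p)) ^+ 2 * wt p)%:E.
  by rewrite /wt /c0 modulus_zeta; congr (_%:E); ring.
have pi0 : 0 < pi :> R := pi_gt0 R.
rewrite -ge0_integralZl.
- by apply: eq_integral => p _; rewrite -EFinM E.
- exact: mdsk.
- have := measurable_funeM pi%:E (mdens fh).
  apply: eq_measurable_fun => p _; rewrite -E -EFinM; congr (_%:E).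
  by rewrite mulVKf// gt_eqF.
- move=> p _; rewrite lee_fin mulr_ge0 ?sqr_ge0// mulr_ge0 ?powR_ge0//.
  by move: alpha1; lra.
- by rewrite lee_fin invr_ge0 ltW.
Qed.

Let meank k f := meanD_ k (fun p => f (zeta p) * conjc (f (zeta p))).

Let meankE k f : holomorphic f ->
  (\int[mu2]_(p in D k) (modulus (f (zeta p)) ^+ 2 * wt p)%:E = (meank k f)%:E)%E.
Proof.
move=> /holomorphic_has_ps[c Hf].
exact: (mean_squareE (mD k) (Dfin k) (measurable_funTS mwt)
    (fun p _ => wt_ge0 p) (@wt_D k) (@mRe _) (@mIm _) (rho_ge0 k) (rho_lt1 k)
    (@zeta_le k) Hf).
Qed.

Theorem bergman_diag_norm : exists v, diag_norm (bergman_norm2 alpha) v.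
Proof.
exists w.
split.
- move=> n; have h0 : 0 < 2^-1 :> R by rewrite invr_gt0.
  have [|c cp /(_ n)] := w_low h0; first by rewrite invf_lt1// ltr1n.
  by apply: lt_le_trans; rewrite mulr_gt0// exprn_gt0.
- exact: w_low.
- move=> c f Hf; have fh := has_ps_holomorphic Hf.
  have Hk k : (fun n => \sum_(j < n) modulus (c j) ^+ 2 * W k j) @ \oo --> meank k f.
    exact: (mean_square (mD k) (Dfin k) (measurable_funTS mwt)
      (fun p _ => wt_ge0 p) (@wt_D k) (@mRe _) (@mIm _) (rho_ge0 k) (rho_lt1 k)
      (@zeta_le k) (@orth k) Hf).
  rewrite bergmanE//; apply/eqP; rewrite eq_le; apply/andP; split.
    (* Monotone convergence along the disks [D k], on each of which the Parseval identity
       [mean_square] is available. *)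
    have := @ge0_nondecreasing_set_cvg_integral _ _ R D
      (fun p => (modulus (f (zeta p)) ^+ 2 * wt p)%:E) mu2.
    rewrite -dskD => /(_ _ mD).
    have ndD : nondecreasing_seq D.
      by apply/nondecreasing_seqP => k; rewrite subsetEset; exact: sub_D.
    have mDf k : measurable_fun (D k) (fun p => (modulus (f (zeta p)) ^+ 2 * wt p)%:E).
      apply: measurable_funS (mdens fh) => // p pk; rewrite dskD; by exists k.
    move=> /(_ ndD mDf (fun k p _ => dens_ge0 f p)) H.
    rewrite -(cvg_lim _ H)//; apply: lime_le; first by apply/cvg_ex; eexists; exact: H.
    apply: nearW => k; rewrite meankE//.
    apply: (@series_weight_le _ _ (W k)) => //.
    + by move=> n; exact: sqr_ge0.
    + by move=> n; rewrite W_ge0 W_le.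
  apply: (series_weight_ge (W := W) (I := fun k => meank k f)) => //.
  + by move=> n; exact: sqr_ge0.
  + by move=> n; exact: le_trans (W_ge0 0 n) (W_le 0 n).
  + move=> k; rewrite -meankE//; apply: ge0_subset_integral => //.
      exact: mdens.
    by move=> p pk; rewrite dskD; exists k.
- move=> f1 f2 f3 h1 h2 h3 H; rewrite !bergmanE//.
  rewrite -ge0_integralD//; [|exact: mdens|exact: mdens].
  apply: ge0_le_integral => //.
  + exact: mdens.
  + by apply: emeasurable_funD; exact: mdens.
  + move=> p /modulus_lt1 p1; rewrite -EFinD lee_fin -mulrDl ler_wpM2r//.
    exact: H.
Qed.

End Bergman.

(** * Inner products and projections *)

Section InnerProduct.
Variables (R : realType) (V : lmodType R[i]).
Local Notation C := R[i].
Implicit Types (M : hmod V) (S : set V) (f g h : V) (a : C).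

Definition lin_closed S := S 0 /\ forall a f g, S f -> S g -> S (a *: f + g).

(** All axioms are relative to the carrier, where alone [hip] is meaningful. Positivity is put on
    the real part; Hermitian symmetry makes the product of f with itself real. *)
Definition prehilbert M := [/\ lin_closed (hcar M),
  forall a f g h, hcar M f -> hcar M g -> hcar M h ->
    hip M (a *: f + g) h = a * hip M f h + hip M g h,
  forall f g, hcar M f -> hcar M g -> hip M g f = conjc (hip M f g) &
  forall f, hcar M f -> 0 <= complex.Re (hip M f f) /\
    (complex.Re (hip M f f) = 0 -> f = 0)].

Definition nrm2 M f : R := complex.Re (hip M f f).

Lemma lin_closedZ S a f : lin_closed S -> S f -> S (a *: f).
Proof. by move=> [S0 H] Sf; rewrite -[a *: f]addr0; exact: H. Qed.

Lemma lin_closedB S f g : lin_closed S -> S f -> S g -> S (f - g).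
Proof. by move=> [S0 H] Sf Sg; rewrite addrC -scaleN1r; exact: H. Qed.

Lemma lin_closedD S f g : lin_closed S -> S f -> S g -> S (f + g).
Proof. by move=> [S0 H] Sf Sg; rewrite -[f]scale1r; exact: H. Qed.

Lemma subrBB f g h : (f - h) - (f - g) = g - h.
Proof. by rewrite opprB addrC addrA subrK. Qed.

Variable M : hmod V.
Hypothesis HM : prehilbert M.
Local Notation H := (hcar M).
Local Notation ip := (hip M).
Local Notation n2 := (nrm2 M).

Lemma hcar_lin : lin_closed H. Proof. by case: HM. Qed.
Let HL := hcar_lin.

Lemma ipDl f g h : H f -> H g -> H h -> ip (f + g) h = ip f h + ip g h.
Proof.
by move=> Hf Hg Hh; case: HM => _ L _ _; rewrite -[f]scale1r L// mul1r scale1r.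
Qed.

Lemma ip0l h : H h -> ip 0 h = 0.
Proof.
move=> Hh; have H0 := HL.1.
by apply: (addrI (ip 0 h)); rewrite -ipDl// !addr0.
Qed.

Lemma ipZl a f h : H f -> H h -> ip (a *: f) h = a * ip f h.
Proof.
move=> Hf Hh; case: HM => _ L _ _.
by rewrite -[a *: f]addr0 L ?ip0l ?addr0//; exact: HL.1.
Qed.

Lemma ipBl f g h : H f -> H g -> H h -> ip (f - g) h = ip f h - ip g h.
Proof.
move=> Hf Hg Hh; rewrite -scaleN1r ipDl ?ipZl ?mulN1r//.
exact: lin_closedZ.
Qed.

Lemma ipC f g : H f -> H g -> ip g f = conjc (ip f g).
Proof. by case: HM => _ _ Cj _; exact: Cj. Qed.

Lemma ipDr f g h : H f -> H g -> H h -> ip h (f + g) = ip h f + ip h g.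
Proof.
move=> Hf Hg Hh; rewrite ipC ?ipDl// ?conjcD -?ipC//; exact: lin_closedD.
Qed.

Lemma ipZr a f h : H f -> H h -> ip h (a *: f) = conjc a * ip h f.
Proof.
move=> Hf Hh; rewrite ipC ?ipZl// ?conjcM -?ipC//; exact: lin_closedZ.
Qed.

Lemma ipNr f h : H f -> H h -> ip h (- f) = - ip h f.
Proof. by move=> Hf Hh; rewrite -scaleN1r ipZr// conjcN rmorph1 mulN1r. Qed.

Lemma nrm2_ge0 f : H f -> 0 <= n2 f.
Proof. by case: HM => _ _ _ P /P[]. Qed.

Lemma nrm2_eq0 f : H f -> n2 f = 0 -> f = 0.
Proof. by case: HM => _ _ _ P /P[]. Qed.

Lemma ip_self f : H f -> ip f f = (n2 f)%:C.
Proof.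
move=> Hf; have := ipC Hf Hf; rewrite /nrm2; case: (ip f f) => x y /=.
by move=> [e]; apply: complex_ext => //=; move: e; lra.
Qed.

Lemma nrm2Z a f : H f -> n2 (a *: f) = modulus a ^+ 2 * n2 f.
Proof.
move=> Hf; have Ha := lin_closedZ a HL Hf.
rewrite {1}/nrm2 ipZl// ipZr// mulrA mul_conj ip_self// -rmorphM.
by [].
Qed.

Lemma nrm2D f g : H f -> H g ->
  n2 (f + g) = n2 f + n2 g + 2 * complex.Re (ip f g).
Proof.
move=> Hf Hg; rewrite /nrm2 ipDl ?ipDr//; last exact: lin_closedD.
rewrite !cReD (ipC Hf Hg); case: (ip f g) => x y /=; lra.
Qed.

Lemma nrm2N f : H f -> n2 (- f) = n2 f.
Proof. by move=> Hf; rewrite -scaleN1r nrm2Z// modulusN modulus1 expr1n mul1r. Qed.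

Lemma hcarN f : H f -> H (- f).
Proof. by move=> Hf; rewrite -scaleN1r; exact: lin_closedZ. Qed.

(* With [e] the defect of minimality of [f] this controls near-minimizers; with [e = nrm2 f] it
   is the Cauchy-Schwarz inequality. *)
Lemma near_orthogonal f t (e : R) : H f -> H t ->
  (forall c : C, n2 f <= n2 (f - c *: t) + e) -> modulus (ip f t) ^+ 2 <= e * n2 t.
Proof.
move=> Hf Ht Hc; have t0 := nrm2_ge0 Ht.
have [tE|tE] := eqVneq (n2 t) 0.
  have E := nrm2_eq0 Ht tE.
  by rewrite tE mulr0 E (ipC HL.1 Hf) modulus_conj ip0l// modulus0 expr0n.
have tp : 0 < n2 t by rewrite lt_def tE.
(* The coefficient of the projection of [f] on the line of [t], which makes the hypothesis
   strongest. *)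
pose c := ip f t / (n2 t)%:C.
have Hct : H (- (c *: t)) by apply: hcarN; exact: lin_closedZ.
have := Hc c; rewrite nrm2D// nrm2N; last exact: lin_closedZ.
rewrite nrm2Z// -scaleNr ipZr// conjcN mulNr cReN.
have -> : conjc c * ip f t = (modulus (ip f t) ^+ 2 / n2 t)%:C.
  rewrite /c conjcM mulrAC [conjc (ip f t) * _]mulrC mul_conj.
  have -> : conjc ((n2 t)%:C^-1) = ((n2 t)^-1)%:C :> C.
    by rewrite -fmorphV; apply: complex_ext => //=; rewrite oppr0.
  by rewrite -rmorphM.
rewrite /= /c modulusM modulusV modulus_real (gtr0_norm tp) exprMn => h.
have : modulus (ip f t) ^+ 2 / n2 t <= e.
  move: h; have -> : (modulus (ip f t)) ^+ 2 * ((n2 t)^-1) ^+ 2 * n2 t =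
    modulus (ip f t) ^+ 2 / n2 t by field.
  lra.
by rewrite ler_pdivrMr.
Qed.

Lemma cauchy_schwarz f t : H f -> H t -> modulus (ip f t) ^+ 2 <= n2 f * n2 t.
Proof.
move=> Hf Ht; apply: near_orthogonal => // c.
by rewrite lerDr nrm2_ge0//; apply: lin_closedB => //; exact: lin_closedZ.
Qed.

Definition ip_complete S := forall s : nat -> V, (forall n, S (s n)) ->
  (forall e : R, 0 < e -> exists N, forall m n, (N <= m)%N -> (N <= n)%N ->
     n2 (s m - s n) <= e) ->
  exists2 l, S l & forall e : R, 0 < e -> exists N, forall n, (N <= n)%N ->
     n2 (s n - l) <= e.

(** The parallelogram law for f - g and f - h. If g and h nearly minimize the distance to f, so does
    their midpoint, hence g and h are close. *)
Lemma parallelogram f g h : H f -> H g -> H h ->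
  n2 (g - h) = 2 * n2 (f - g) + 2 * n2 (f - h) -
    4 * n2 (f - (2^-1 : C) *: (g + h)).
Proof.
move=> Hf Hg Hh.
have Ha : H (f - g) by exact: lin_closedB.
have Hb : H (f - h) by exact: lin_closedB.
have -> : f - (2^-1 : C) *: (g + h) = (2^-1 : C) *: ((f - g) + (f - h)).
  rewrite addrACA -opprD scalerBr; congr (_ - _).
  rewrite -[f in RHS]scale1r -scalerDl scalerA (_ : 2^-1 * (1 + 1) = 1) ?scale1r//.
  by field.
rewrite -(subrBB f).
rewrite nrm2Z; last exact: lin_closedD.
have -> : modulus (2^-1 : C) = 2^-1.
  by rewrite modulusV (_ : 2 = (2 : R)%:C) ?modulus_real ?ger0_norm// rmorph_nat.
rewrite (nrm2D Hb (hcarN Ha)) nrm2N// ipNr// cReN (nrm2D Ha Hb).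
have -> : complex.Re (ip (f - h) (f - g)) = complex.Re (ip (f - g) (f - h)).
  by rewrite (ipC Ha Hb); case: (ip _ _).
lra.
Qed.

(** A sequence minimizing the squared distance up to 1 / (n + 1) is Cauchy by the parallelogram law,
    and completeness of S supplies the limit. *)
Lemma projection_exists S f : S `<=` H -> lin_closed S -> ip_complete S -> H f ->
  exists2 s, S s & forall t, S t -> ip (f - s) t = 0.
Proof.
move=> SH SL Sc Hf.
pose E := [set x | exists2 s, S s & x = n2 (f - s)].
have Hfs s : S s -> H (f - s) by move=> /SH Hs; exact: lin_closedB.
have E0 : E !=set0 by exists (n2 (f - 0)), 0 => //; exact: SL.1.
have lE : lbound E 0 by move=> _ [s Ss ->]; exact: nrm2_ge0 (Hfs s Ss).
have hE : has_inf E by split=> //; exists 0.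
pose d := inf E.
have dE s : S s -> d <= n2 (f - s).
  by move=> Ss; apply: ge_inf => //; [exists 0|exists s].
have /choice[s Hs] : forall n : nat, exists s, S s /\ n2 (f - s) <= d + n.+1%:R^-1.
  move=> n; have n0 : 0 < n.+1%:R^-1 :> R by rewrite invr_gt0 ltr0n.
  by have [_ [s Ss ->] h] := inf_adherent n0 hE; exists s; split=> //; exact: ltW.
have small (e : R) : 0 < e -> exists N, forall n, (N <= n)%N -> n.+1%:R^-1 <= e.
  move=> e0; have := @cvg_harmonic R; move/cvgrPdist_le => /(_ _ e0)[N _ HN].
  exists N => n /HN /=; rewrite sub0r normrN ger0_norm//.
have Cs : forall e : R, 0 < e -> exists N, forall m n, (N <= m)%N -> (N <= n)%N ->
    n2 (s m - s n) <= e.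
  move=> e e0; have e4 : 0 < e / 4 by rewrite divr_gt0.
  have [N HN] := small _ e4; exists N => m n mN nN.
  rewrite (parallelogram Hf (SH _ (Hs m).1) (SH _ (Hs n).1)).
  have h k : (N <= k)%N -> n2 (f - s k) <= d + e / 4.
    by move=> kN; apply: (le_trans (Hs k).2); rewrite lerD2l HN.
  have h1 := h _ mN; have h2 := h _ nN.
  have := dE _ (lin_closedZ 2^-1 SL (lin_closedD SL (Hs m).1 (Hs n).1)).
  by move: h1 h2; clearbody d; lra.
have [l Sl Hl] := Sc s (fun n => (Hs n).1) Cs.
(* Orthogonality is passed to the limit directly: near-minimizers are nearly orthogonal to [t], and
   Cauchy-Schwarz controls the difference to [l]. *)
exists l => // t St; apply/eqP; rewrite -modulus_eq0 -sqrf_eq0 eq_le sqr_ge0 andbT.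
have t0 := nrm2_ge0 (SH _ St).
apply/ler_addgt0Pr => e e0; rewrite add0r.
(* The 4 comes from (x + y)^2 <= 2 x^2 + 2 y^2 with both squares at most e' n2 t; the + 1 covers n2
   t = 0. *)
pose e' := e / (4 * (n2 t + 1)).
have e'0 : 0 < e' by rewrite divr_gt0// mulr_gt0//; lra.
have [N1 HN1] := small _ e'0; have [N2 HN2] := Hl _ e'0.
pose n := maxn N1 N2; have [Ss dn] := Hs n.
have -> : f - l = (f - s n) + (s n - l) by rewrite addrA subrK.
have HSl : H (s n - l) by apply: lin_closedB => //; exact: SH.
rewrite ipDl//; [|exact: Hfs|exact: SH].
have h1 : modulus (ip (f - s n) t) ^+ 2 <= e' * n2 t.
  apply: near_orthogonal; [exact: Hfs|exact: SH|move=> c].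
  rewrite -addrA -opprD.
  have := dE _ (lin_closedD SL Ss (lin_closedZ c SL St)).
  by move=> h; apply: (le_trans dn); apply: lerD h _; exact: HN1 (leq_maxl _ _).
have h2 : modulus (ip (s n - l) t) ^+ 2 <= e' * n2 t.
  apply: (le_trans (cauchy_schwarz HSl (SH _ St))).
  by rewrite ler_wpM2r//; exact: HN2 (leq_maxr _ _).
have h3 := le_modulusD (ip (f - s n) t) (ip (s n - l) t).
apply: (@le_trans _ _ (4 * (e' * n2 t))).
  apply: (@le_trans _ _ ((modulus (ip (f - s n) t) + modulus (ip (s n - l) t)) ^+ 2)).
    by rewrite lerXn2r// nnegrE ?addr_ge0// modulus_ge0.
  have := sqr_ge0 (modulus (ip (f - s n) t) - modulus (ip (s n - l) t)).
  rewrite sqrrB sqrrD; move: h1 h2; lra.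
rewrite /e' (_ : 4 * _ = e * (n2 t / (n2 t + 1))); last by field; rewrite gt_eqF//; lra.
rewrite ler_piMr ?(ltW e0)// ler_pdivrMr ?mul1r; lra.
Qed.

Section Projection.
Variable S : set V.
Hypotheses (SH : S `<=` H) (SL : lin_closed S) (Sc : ip_complete S).
Local Notation K := (orthocomplement M S).
Local Notation P := (orthproj M K).

Lemma orthocomplement_lin : lin_closed K.
Proof.
split; first by split; [exact: HL.1|move=> s /SH Hs; rewrite ip0l].
move=> a f g [Hf Of] [Hg Og]; split; first exact: HL.2.
move=> s Ss; rewrite ipDl// ?ipZl ?Of ?Og ?mulr0 ?addr0//; try exact: SH.
exact: lin_closedZ.
Qed.

(** Replaces the choice operator in [orthproj] by a checkable description: the projection onto the
    complement of S is recognized by a difference in S. All later identities about projections go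
    through it. *)
Lemma orthproj_unique f g : H f -> K g -> S (f - g) -> P f = g.
Proof.
move=> Hf Kg Sfg.
have ok : [set g | K g /\ forall s, K s -> ip (f - g) s = 0] g.
  split=> // s [Hs Os]; rewrite ipC ?Os ?conjc0//; last exact: SH.
rewrite /orthproj; case: xgetP => [g' _ [Kg' Og']|/(_ g)] //.
have KD := lin_closedB orthocomplement_lin Kg Kg'.
have HD := KD.1.
apply/eqP; rewrite -subr_eq0 -opprB oppr_eq0; apply/eqP; apply: (nrm2_eq0 HD).
rewrite /nrm2; have -> : ip (g - g') (g - g') = ip (f - g') (g - g') - ip (f - g) (g - g').
  by rewrite -ipBl ?subrBB//; [apply: lin_closedB => //; exact: Kg'.1|exact: SH].
by rewrite Og'// ok.2// subr0.
Qed.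

Lemma orthproj_in f : H f -> K (P f).
Proof.
move=> Hf; have [s Ss Os] := projection_exists SH SL Sc Hf.
have Kfs : K (f - s) by split=> //; apply: lin_closedB => //; exact: SH.
by rewrite (@orthproj_unique f (f - s))// opprB addrC subrK.
Qed.

Lemma orthproj_diff f : H f -> S (f - P f).
Proof.
move=> Hf; have [s Ss Os] := projection_exists SH SL Sc Hf.
have Kfs : K (f - s) by split=> //; apply: lin_closedB => //; exact: SH.
by rewrite (@orthproj_unique f (f - s))// opprB addrC subrK.
Qed.

Lemma orthproj_lin a f g : H f -> H g -> P (a *: f + g) = a *: P f + P g.
Proof.
move=> Hf Hg; apply: orthproj_unique; first exact: HL.2.
  by apply: orthocomplement_lin.2; exact: orthproj_in.
rewrite opprD addrACA -scalerBr; apply: SL.2; exact: orthproj_diff.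
Qed.

Lemma orthproj_eq0 f : S f -> P f = 0.
Proof.
move=> Sf; apply: orthproj_unique; rewrite ?subr0//; first exact: SH.
exact: orthocomplement_lin.1.
Qed.

Lemma nrm2_orthproj f : H f -> n2 (P f) <= n2 f.
Proof.
move=> Hf; have [HP OP] := orthproj_in Hf; have Sf := orthproj_diff Hf.
have -> : n2 f = n2 (P f + (f - P f)) by rewrite addrC subrK.
rewrite nrm2D//; last exact: SH.
by rewrite OP// mulr0 addr0 lerDl nrm2_ge0//; exact: SH.
Qed.

End Projection.

End InnerProduct.

(** * Modules with a diagonal norm as Hilbert spaces of functions *)

Section DiagonalModule.
Variable R : realType.
Local Notation C := R[i].
Implicit Types (a b : nat -> C) (f g h : C -> C).

Lemma ccvg_conj (u : nat -> C) l : ccvg u l -> ccvg (fun n => conjc (u n)) (conjc l).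
Proof.
by move=> H; rewrite /ccvg; under eq_fun do rewrite -conjcB modulus_conj.
Qed.

Lemma psum_lin (c : C) a b z n :
  psum (fun k => c * a k + b k) z n = c * psum a z n + psum b z n.
Proof.
rewrite /psum mulr_sumr -big_split; apply: eq_bigr => k _ /=.
by rewrite mulrDl mulrA.
Qed.

Lemma has_ps_lin r (c : C) a b f g : has_ps r a f -> has_ps r b g ->
  has_ps r (fun k => c * a k + b k) (fun z => c * f z + g z).
Proof.
move=> Ha Hb z zr; apply: (@eq_ccvg _ (fun n => c * psum a z n + psum b z n)).
  by move=> n; rewrite psum_lin.
by apply: ccvgD (Hb z zr); apply: ccvgZ; exact: Ha.
Qed.

Definition taylor f : nat -> C := xget (fun=> 0) [set a | has_ps 1 a f].

Lemma taylorP f : holomorphic f -> has_ps 1 (taylor f) f.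
Proof.
move=> /holomorphic_has_ps[a Ha].
by rewrite /taylor; case: xgetP => [b _ //|/(_ a)].
Qed.

Lemma taylorE a f : has_ps 1 a f -> taylor f = a.
Proof.
move=> Hf; have fh := has_ps_holomorphic Hf.
exact: has_ps_unique ltr01 ltr01 (taylorP fh) Hf.
Qed.

Lemma has_ps_disk a f g : has_ps 1 a f -> (forall z, disk z -> f z = g z) ->
  has_ps 1 a g.
Proof. by move=> Hf E z z1; rewrite -E//; exact: Hf. Qed.

Variables (N : (C -> C) -> \bar R) (w : nat -> R).
Hypothesis HN : diag_norm N w.
Local Notation H := (function_module N).

Definition energy a n : R := \sum_(k < n) modulus (a k) ^+ 2 * w k.

Let w_gt0 n : 0 < w n. Proof. by case: HN. Qed.

Let term_ge0 a k : 0 <= modulus (a k) ^+ 2 * w k.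
Proof. by rewrite mulr_ge0 ?sqr_ge0// ltW. Qed.

Lemma energy_nd a : nondecreasing_seq (energy a).
Proof.
by apply/nondecreasing_seqP => n; rewrite /energy big_ord_recr /= lerDl.
Qed.

Lemma term_le_energy a k : modulus (a k) ^+ 2 * w k <= energy a k.+1.
Proof. by rewrite /energy big_ord_recr /= lerDr sumr_ge0. Qed.

Lemma energyE a f : has_ps 1 a f ->
  (fun n => (energy a n)%:E) @ \oo --> N f.
Proof.
case: HN => _ _ E _ Hf; rewrite (E a f Hf).
have := @is_cvg_nneseries R (fun n => (modulus (a n) ^+ 2 * w n)%:E) xpredT 0%N.
have h n : (0 <= n)%N -> true -> (0 <= (modulus (a n) ^+ 2 * w n)%:E)%E.
  by rewrite lee_fin.
move=> /(_ h); apply: cvg_trans; apply: near_eq_cvg; apply: nearW => n.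
by rewrite big_mkord sumEFin.
Qed.

Lemma N_ge0 a f : has_ps 1 a f -> (0 <= N f)%E.
Proof.
move=> Hf; apply: (cvge_ge _ (energyE Hf)); apply: nearW => n.
by rewrite lee_fin sumr_ge0.
Qed.

Lemma energy_fin a f (K : R) : has_ps 1 a f -> (forall n, energy a n <= K) ->
  (N f <= K%:E)%E.
Proof.
move=> Hf HK; apply: (cvge_le _ (energyE Hf)); apply: nearW => n.
by rewrite lee_fin.
Qed.

Lemma energy_cvg a f : has_ps 1 a f -> (N f < +oo)%E ->
  energy a @ \oo --> fine (N f).
Proof.
move=> Hf fin; have := energyE Hf.
by rewrite -[N f]fineK ?ge0_fin_numE ?(N_ge0 Hf)// => /fine_cvg.
Qed.

Lemma energy_le a f n : has_ps 1 a f -> (N f < +oo)%E -> energy a n <= fine (N f).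
Proof.
move=> Hf fin; apply: (cvgr_to_ge (energy_cvg Hf fin)).
by exists n => // m /= nm; exact: energy_nd.
Qed.

Lemma hcar_taylor f : hcar H f -> has_ps 1 (taylor f) f.
Proof. by case=> fh _ _; exact: taylorP. Qed.

Lemma hcar_intro a f (K : R) : has_ps 1 a f -> (forall z, ~ disk z -> f z = 0) ->
  (forall n, energy a n <= K) -> hcar H f.
Proof.
move=> Hf f0 HK; split => //; first exact: has_ps_holomorphic Hf.
by apply: (le_lt_trans (energy_fin Hf HK)); rewrite ltry.
Qed.

Lemma energy_taylor_le f n : hcar H f -> energy (taylor f) n <= fine (N f).
Proof. by move=> Hf; apply: energy_le (hcar_taylor Hf) _; case: Hf. Qed.

Lemma modulus2_lin (c x y : C) :
  modulus (c * x + y) ^+ 2 <= 2 * (modulus c ^+ 2 * modulus x ^+ 2 + modulus y ^+ 2).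
Proof.
apply: (@le_trans _ _ ((modulus c * modulus x + modulus y) ^+ 2)).
  rewrite lerXn2r ?nnegrE ?addr_ge0 ?mulr_ge0 ?modulus_ge0//.
  by rewrite (le_trans (le_modulusD _ _))// modulusM.
have := sqr_ge0 (modulus c * modulus x - modulus y).
by rewrite sqrrB sqrrD exprMn; lra.
Qed.

Lemma energy_lin (c : C) a b n : energy (fun k => c * a k + b k) n <=
  2 * (modulus c ^+ 2 * energy a n + energy b n).
Proof.
rewrite /energy mulr_sumr -big_split mulr_sumr /=; apply: ler_sum => k _.
rewrite (_ : 2 * _ = 2 * (modulus c ^+ 2 * modulus (a k) ^+ 2 + modulus (b k) ^+ 2) * w k).
  by rewrite ler_wpM2r ?modulus2_lin// ltW.
by ring.
Qed.

Lemma taylor_lin (c : C) f g : hcar H f -> hcar H g ->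
  taylor (c *: f + g) = fun k => c * taylor f k + taylor g k.
Proof.
by move=> Hf Hg; apply: taylorE; apply: has_ps_lin; exact: hcar_taylor.
Qed.

Lemma hcar_diag_lin : lin_closed (hcar H).
Proof.
split.
  apply: (@hcar_intro (fun=> 0) _ 0) => //.
    by move=> z _; apply: (eq_ccvg _ (@ccvg_cst _ 0)) => n;
      rewrite /psum big1// => k _; rewrite mul0r.
  by move=> n; rewrite /energy big1// => k _; rewrite modulus0 expr0n mul0r.
move=> c f g Hf Hg.
apply: (@hcar_intro (fun k => c * taylor f k + taylor g k) _
  (2 * (modulus c ^+ 2 * fine (N f) + fine (N g)))).
- by apply: has_ps_lin; exact: hcar_taylor.
- move=> z z1; case: Hf => _ f0 _; case: Hg => _ g0 _.
  by rewrite -[LHS]/(c * f z + g z) f0// g0// mulr0 addr0.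
- move=> n; apply: (le_trans (energy_lin _ _ _ _)); rewrite ler_pM2l//.
  by apply: lerD; [rewrite ler_wpM2l ?sqr_ge0//|]; exact: energy_taylor_le.
Qed.

Lemma polarize (x y : C) : 4^-1 * \sum_(j < 4)
  'i%C ^+ j * (modulus (x + 'i%C ^+ j * y) ^+ 2)%:C = x * conjc y.
Proof.
rewrite !big_ord_recr big_ord0 /= add0r expr0 expr1 !mul1r.
have -> : 'i%C ^+ 3 = - 'i%C :> C by rewrite exprS sqr_i mulrN1.
rewrite sqr_i.
have E : 4 \is a @GRing.unit C by rewrite unitfE.
apply: (mulrI E); rewrite mulrA mulfV ?pnatr_eq0// mul1r !sqr_modulus.
case: x y => x1 x2 [y1 y2]; rewrite -[4]/(4%:R) -(rmorph_nat (real_complex R)).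
by apply: complex_ext; rewrite /= ; ring.
Qed.

(** Polarization is applied coefficient by coefficient and passed to the limit. It exhibits [hip] as
    a weighted l^2 product, from which sesquilinearity follows. *)
Lemma ip_ccvg f g : hcar H f -> hcar H g ->
  ccvg (fun n => \sum_(k < n) taylor f k * conjc (taylor g k) * (w k)%:C) (hip H f g).
Proof.
move=> Hf Hg; rewrite /= /polarization.
apply: (@eq_ccvg _ (fun n => 4^-1 * \sum_(j < 4) 'i%C ^+ j *
  (energy (taylor ('i%C ^+ j *: g + f)) n)%:C)).
  move=> n; rewrite (eq_bigr (fun k : 'I_n => 4^-1 * \sum_(j < 4) 'i%C ^+ j *
     (modulus (taylor f k + 'i%C ^+ j * taylor g k) ^+ 2)%:C * (w k)%:C)); last first.
    by move=> k _; rewrite -mulr_suml mulrA polarize.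
  rewrite -mulr_sumr exchange_big /=; congr (_ * _); apply: eq_bigr => j _.
  rewrite /energy rmorph_sum mulr_sumr; apply: eq_bigr => k _ /=.
  by rewrite taylor_lin// addrC rmorphM mulrA.
apply: ccvgZ; rewrite !big_ord_recr big_ord0 /=.
apply: (@eq_ccvg _ (fun n => 0 + 'i%C ^+ 0 * (energy (taylor ('i%C ^+ 0 *: g + f)) n)%:C
 + 'i%C ^+ 1 * (energy (taylor ('i%C ^+ 1 *: g + f)) n)%:C
 + 'i%C ^+ 2 * (energy (taylor ('i%C ^+ 2 *: g + f)) n)%:C
 + 'i%C ^+ 3 * (energy (taylor ('i%C ^+ 3 *: g + f)) n)%:C)).
  by move=> n; rewrite !big_ord_recr big_ord0.
have T (c : C) : ccvg (fun n => (energy (taylor (c *: g + f)) n)%:C)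
    (fine (N (fun z => f z + c * g z)))%:C.
  have Hc : hcar H (c *: g + f) by exact: hcar_diag_lin.2.
  have -> : (fun z => f z + c * g z) = c *: g + f.
    by apply/funext => z; rewrite addrC.
  apply: ReIm_ccvg => /=; last exact: cvg_cst.
  by apply: energy_cvg (hcar_taylor Hc) _; case: Hc.
by do 3 (apply: ccvgD; last exact: ccvgZ); apply: ccvgD; [exact: ccvg_cst|exact: ccvgZ].
Qed.

Lemma nrm2_diag f : hcar H f -> nrm2 H f = fine (N f).
Proof.
move=> Hf; have := ccvg_Re (ip_ccvg Hf Hf); rewrite -/(nrm2 _ _).
under eq_fun => n.
  rewrite cRe_sum (eq_bigr (fun k : 'I_n => modulus (taylor f k) ^+ 2 * w k)).
    rewrite -/(energy (taylor f) n); over.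
  by move=> k _; rewrite mul_conj -rmorphM.
have fin : (N f < +oo)%E by case: Hf.
move=> h; have := energy_cvg (hcar_taylor Hf) fin.
by move: h; exact: cvg_unique.
Qed.

Lemma energy_le_nrm2 f n : hcar H f -> energy (taylor f) n <= nrm2 H f.
Proof. by move=> Hf; rewrite nrm2_diag//; exact: energy_taylor_le. Qed.

Lemma energy_cvg_nrm2 f : hcar H f -> energy (taylor f) @ \oo --> nrm2 H f.
Proof.
move=> Hf; rewrite nrm2_diag//; apply: energy_cvg (hcar_taylor Hf) _.
by case: Hf.
Qed.

Lemma nrm2_le_energy f (K : R) : hcar H f -> (forall n, energy (taylor f) n <= K) ->
  nrm2 H f <= K.
Proof.
by move=> Hf HK; apply: (cvgr_to_le (energy_cvg_nrm2 Hf)); exact: nearW.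
Qed.

Lemma diag_prehilbert : prehilbert H.
Proof.
split; first exact: hcar_diag_lin.
- move=> c f g h Hf Hg Hh.
  apply: ccvg_unique (ip_ccvg (hcar_diag_lin.2 c _ _ Hf Hg) Hh) _.
  apply: eq_ccvg (ccvgD (ccvgZ c (ip_ccvg Hf Hh)) (ip_ccvg Hg Hh)) => n.
  rewrite taylor_lin// mulr_sumr -big_split; apply: eq_bigr => k _ /=.
  by rewrite !mulrDl !mulrA.
- move=> f g Hf Hg; apply: ccvg_unique (ip_ccvg Hg Hf) _.
  apply: eq_ccvg (ccvg_conj (ip_ccvg Hf Hg)) => n.
  rewrite rmorph_sum; apply: eq_bigr => k _ /=.
  by rewrite !conjcM conjcK conjc_real [X in X * _]mulrC.
- move=> f Hf; rewrite -/(nrm2 H f); split.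
    by apply: (le_trans _ (energy_le_nrm2 0 Hf)); rewrite /energy big_ord0.
  move=> f0; have a0 k : taylor f k = 0.
    apply/eqP; rewrite -modulus_eq0 -sqrf_eq0 eq_le sqr_ge0 andbT.
    rewrite -(pmulr_lle0 _ (w_gt0 k)) -f0.
    exact: le_trans (term_le_energy _ _) (energy_le_nrm2 _ Hf).
  apply/funext => z; case: (Hf) => _ fz _.
  have [z1|z1] := pselect (disk z); last exact: fz.
  apply: (ccvg_unique (hcar_taylor Hf z1)).
  apply: eq_ccvg (ccvg_cst 0) => n.
  by rewrite /psum big1// => k _; rewrite a0 mul0r.
Qed.

Local Notation n2 := (nrm2 H).
Let HP := diag_prehilbert.

(** The only source of norm estimates that are not coefficientwise. Two dominating functions are
    allowed so that the corona condition fits. *)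
Lemma nrm2_dom f1 f2 f3 : holomorphic f1 -> (forall z, ~ disk z -> f1 z = 0) ->
  hcar H f2 -> hcar H f3 ->
  (forall z, disk z ->
    modulus (f1 z) ^+ 2 <= modulus (f2 z) ^+ 2 + modulus (f3 z) ^+ 2) ->
  hcar H f1 /\ n2 f1 <= n2 f2 + n2 f3.
Proof.
move=> h1 z1 Hf2 Hf3 le; have [h2 z2 fin2] := Hf2; have [h3 z3 fin3] := Hf3.
have L : (N f1 <= N f2 + N f3)%E by case: HN => _ _ _; exact.
have fin : (N f2 + N f3 < +oo)%E by rewrite lte_add_pinfty.
have fin1 := le_lt_trans L fin.
have Hf1 : hcar H f1 by [].
have F f : hcar H f -> N f \is a fin_num.
  by move=> Hf; rewrite ge0_fin_numE ?(N_ge0 (hcar_taylor Hf))//; case: Hf.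
split=> //; rewrite !nrm2_diag// -fineD ?F// fine_le ?F//.
by rewrite fin_numD !F.
Qed.

Lemma holomorphicM f g : holomorphic f -> holomorphic g ->
  holomorphic (fun z => f z * g z).
Proof.
move=> Hf Hg z z1; have [a wa] := derivable_wd (Hf z z1).
have [b wb] := derivable_wd (Hg z z1); apply: wd_derivable.
by have := wdM wa wb; apply: wd_eq; rewrite ?mul0r ?mulr0 ?addr0.
Qed.

Lemma hcar0 : hcar H 0. Proof. exact: hcar_diag_lin.1. Qed.

Lemma nrm20 : n2 0 = 0.
Proof. by rewrite /nrm2 (ip0l HP)//; exact: hcar0. Qed.

(** The product is dominated by the scalar multiple B f, with 0 as the second dominating
    function. *)
Lemma hcar_mul phi (B : R) f : holomorphic phi ->
  (forall z, disk z -> modulus (phi z) <= B) -> hcar H f ->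
  hcar H (fun z => phi z * f z) /\ n2 (fun z => phi z * f z) <= B ^+ 2 * n2 f.
Proof.
move=> ph pB Hf; have [fh f0 _] := Hf.
have B0 : 0 <= B.
  apply: (le_trans (modulus_ge0 (phi 0))); apply: pB.
  by change (modulus (0 : C) < 1); rewrite modulus0.
have Hg : hcar H (B%:C *: f) by exact: lin_closedZ hcar_diag_lin Hf.
have -> : B ^+ 2 * n2 f = n2 (B%:C *: f) + n2 0.
  by rewrite nrm20 addr0 (nrm2Z HP)// modulus_real ger0_norm.
apply: (nrm2_dom _ _ Hg hcar0); first exact: holomorphicM.
  by move=> z /f0 ->; rewrite mulr0.
move=> z z1; rewrite [X in _ + X](_ : _ = 0) ?addr0; last by rewrite modulus0 expr0n.
rewrite -[(B%:C *: f) z]/(B%:C * f z) !modulusM modulus_real (ger0_norm B0).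
by rewrite lerXn2r ?nnegrE ?mulr_ge0 ?modulus_ge0// ler_wpM2r ?modulus_ge0// pB.
Qed.

Lemma sqr_le_add1 (x y : R) : 0 <= y -> x ^+ 2 <= y -> x <= y + 1.
Proof.
move=> y0 xy; have := sqr_ge0 (x - 1); rewrite sqrrB mulr1 expr1n; lra.
Qed.

Lemma energy_coef_le a (K : R) : (forall n, energy a n <= K) ->
  forall rho : R, 0 < rho -> rho < 1 -> exists2 c : R, 0 < c &
    forall n, (modulus (a n) * rho ^+ n) ^+ 2 <= c * K.
Proof.
move=> HK rho r0 r1; have [_ L _ _] := HN.
have r2 : rho ^+ 2 < 1 by rewrite exprn_ilt1// ltW.
have [c c0 Hc] := L _ (exprn_gt0 2 r0) r2; exists c^-1; rewrite ?invr_gt0// => n.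
rewrite ler_pdivlMl// exprMn -exprM mulnC exprM mulrCA.
apply: (le_trans _ (HK n.+1)); apply: (le_trans _ (term_le_energy _ _)).
by rewrite ler_wpM2l ?sqr_ge0.
Qed.

(** The lower bound on the weights turns bounded energy into [geo 1 a], so the series converges on
    the disk; [g] cuts the sum off outside. *)
Lemma hcar_of_energy a (K : R) : (forall n, energy a n <= K) ->
  exists2 f, hcar H f & taylor f = a.
Proof.
move=> HK; have K0 : 0 <= K by apply: (le_trans _ (HK 0%N)); rewrite /energy big_ord0.
have [f Hf] : exists f, has_ps 1 a f.
  apply: geo_has_ps => rho r0 r1; have [c c0 Hc] := energy_coef_le HK r0 r1.
  by exists (c * K + 1) => n; apply: sqr_le_add1 (Hc n); rewrite mulr_ge0// ltW.
pose g z := if modulus z < 1 then f z else 0.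
have Hg : has_ps 1 a g.
  by apply: has_ps_disk Hf _ => z; rewrite /disk /g /= => ->.
exists g; last exact: taylorE.
by apply: hcar_intro Hg _ HK => z; rewrite /disk /g /= => /negP/negbTE ->.
Qed.

Lemma ccvg_cauchy (u : nat -> C) : (forall e : R, 0 < e -> exists k, forall m n,
    (k <= m)%N -> (k <= n)%N -> modulus (u m - u n) <= e) ->
  exists l, ccvg u l.
Proof.
move=> Hu; have rc (v : nat -> R) : (forall m n, `|v m - v n| <= modulus (u m - u n)) ->
    exists x : R, v @ \oo --> x.
  move=> Hv; apply/cvg_ex; apply/cauchy_cvgP; apply/cauchy_exP => e e0.
  have e2 : 0 < e / 2 by rewrite divr_gt0.
  have [k Hk] := Hu _ e2; exists (v k); exists k => // n /= kn.
  rewrite /ball /=; apply: (le_lt_trans (Hv _ _)).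
  by apply: (le_lt_trans (Hk _ _ (leqnn k) kn)); lra.
have [x Hx] : exists x : R, (fun n => complex.Re (u n)) @ \oo --> x.
  by apply: rc => m n; rewrite -cReN -cReD Re_le_modulus.
have [y Hy] : exists y : R, (fun n => complex.Im (u n)) @ \oo --> y.
  by apply: rc => m n; rewrite -cImN -cImD Im_le_modulus.
by exists (x +i* y); exact: ReIm_ccvg.
Qed.

Lemma energy_cvg0 (T : nat -> nat -> C) a K : (forall k, ccvg (T ^~ k) (a k)) ->
  (fun m => energy (fun k => T m k - a k) K) @ \oo --> (0 : R).
Proof.
move=> HT; rewrite /energy; elim: K => [|K IH].
  by under eq_fun do rewrite big_ord0; exact: cvg_cst.
under eq_fun do rewrite big_ord_recr /=.
have h : (fun m => modulus (T m K - a K) ^+ 2 * w K) @ \oo --> 0 ^+ 2 * w K.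
  by apply: cvgMl; apply: cvg_exprn; exact: HT.
by have := cvgD IH h; rewrite expr0n mul0r addr0; apply.
Qed.

Lemma taylorB f g : hcar H f -> hcar H g ->
  taylor (f - g) = fun k => taylor f k - taylor g k.
Proof.
move=> Hf Hg; rewrite addrC -scaleN1r taylor_lin//.
by apply/funext => k; rewrite mulN1r addrC.
Qed.

(** A Cauchy sequence converges in each coefficient. The limit coefficients have bounded energy, so
    they come from an element of the module. *)
Lemma diag_complete : ip_complete H (hcar H).
Proof.
move=> s Hs Cs; pose T n := taylor (s n).
have CT m n K e : n2 (s m - s n) <= e -> energy (fun k => T m k - T n k) K <= e.
  move=> h; rewrite -taylorB//; apply: (le_trans _ h); apply: energy_le_nrm2.
  exact: lin_closedB hcar_diag_lin (Hs m) (Hs n).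
have /choice[a Ha] : forall k, exists l, ccvg (T ^~ k) l.
  move=> k; apply: ccvg_cauchy => e e0.
  have we : 0 < e ^+ 2 * w k by rewrite mulr_gt0 ?exprn_gt0.
  have [j Hj] := Cs _ we; exists j => m n jm jn.
  rewrite -(@ler_pXn2r _ 2)// ?nnegrE ?modulus_ge0 ?(ltW e0)//.
  rewrite -(ler_pM2r (w_gt0 k)); apply: le_trans (CT m n k.+1 _ (Hj m n jm jn)).
  exact: term_le_energy (fun k => T m k - T n k) k.
(* Fatou in elementary form: [K] is fixed while m tends to infinity. The factor 2 comes from |x +
   y|^2 <= 2 (|x|^2 + |y|^2). *)
have close e n j : (forall m, (j <= m)%N -> n2 (s n - s m) <= e) ->
    forall K, energy (fun k => T n k - a k) K <= 2 * e.
  move=> Hj K; rewrite -[2 * e]addr0 -[X in _ + X](mulr0 2) -mulrDr.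
  have lim : (fun m => 2 * (e + energy (fun k => T m k - a k) K)) @ \oo -->
      2 * (e + 0) by apply: cvgMr; apply: cvgD; [exact: cvg_cst|exact: energy_cvg0].
  apply: (cvgr_to_ge lim); exists j => // m /= jm.
  rewrite [leLHS](_ : _ = energy (fun k => 1 * (T n k - T m k) + (T m k - a k)) K).
    apply: (le_trans (energy_lin _ _ _ _)).
    by rewrite modulus1 expr1n mul1r ler_pM2l// lerD2r CT// Hj.
  by apply: eq_bigr => k _; rewrite mul1r addrA subrK.
have [j0 Hj0] := Cs 1 ltr01.
have B K : energy a K <= 2 * (2 * 1 + n2 (s j0)).
  rewrite (_ : energy a K = energy (fun k => (-1) * (T j0 k - a k) + T j0 k) K).
    apply: (le_trans (energy_lin _ _ _ _)).
    rewrite modulusN modulus1 expr1n mul1r ler_pM2l// lerD//.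
      by apply: (close _ _ j0) => m; exact: Hj0.
    exact: energy_le_nrm2.
  by apply: eq_bigr => k _; rewrite mulN1r opprB subrK.
have [f Hf fa] := hcar_of_energy B.
exists f => // e e0; have e2 : 0 < e / 2 by rewrite divr_gt0.
have [j Hj] := Cs _ e2; exists j => n jn.
apply: nrm2_le_energy; first exact: lin_closedB hcar_diag_lin (Hs n) Hf.
move=> K; rewrite taylorB// fa; have -> : e = 2 * (e / 2) by field.
by apply: (close _ _ j) => m; exact: Hj.
Qed.

(** The norm bounds every coefficient by a constant over s^n with |z| <= s q and q < 1; summing the
    geometric series bounds f(z). *)
Lemma point_bound z : disk z ->
  exists2 K : R, 0 < K & forall f, hcar H f -> modulus (f z) ^+ 2 <= K * n2 f.
Proof.
move=> z1; have [s [q [s0 s1 q0 q1 zs]]] := geo_radius z1.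
have [c c0 Hc] : exists2 c : R, 0 < c & forall f, hcar H f ->
    forall n, (modulus (taylor f n) * s ^+ n) ^+ 2 <= c * n2 f.
  have [_ L _ _] := HN; have s2 : s ^+ 2 < 1 by rewrite exprn_ilt1// ltW.
  have [c c0 Hc] := L _ (exprn_gt0 2 s0) s2; exists c^-1; rewrite ?invr_gt0// => f Hf n.
  rewrite ler_pdivlMl// exprMn -exprM mulnC exprM mulrCA.
  apply: (le_trans _ (energy_le_nrm2 n.+1 Hf)); apply: (le_trans _ (term_le_energy _ _)).
  by rewrite ler_wpM2l ?sqr_ge0.
have q2 : 0 < (1 - q)^-1 by rewrite invr_gt0 subr_gt0.
exists (c * (1 - q)^-1 ^+ 2) => [|f Hf]; first by rewrite mulr_gt0// exprn_gt0.
have f0 : 0 <= c * n2 f by rewrite mulr_ge0 ?(ltW c0)// (nrm2_ge0 HP).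
have HM n : modulus (taylor f n) * s ^+ n <= Num.sqrt (c * n2 f).
  by rewrite -(@ger0_norm _ (_ * s ^+ n)) ?mulr_ge0 ?modulus_ge0 ?exprn_ge0 ?(ltW s0)//
    -sqrtr_sqr ler_wsqrtr ?Hc.
have := psum_tail 0 (hcar_taylor Hf) z1 q0 q1 HM zs.
rewrite /psum big_ord0 subr0 expr0 mulr1 => h.
rewrite mulrAC -[X in _ <= X * _](sqr_sqrtr f0) -exprMn.
by rewrite lerXn2r// nnegrE ?modulus_ge0// mulr_ge0 ?sqrtr_ge0// ltW.
Qed.

Definition trunc a n k : C := if (k < n)%N then a k else 0.

Lemma psum_trunc a n m z : psum (trunc a n) z (n + m) = psum a z n.
Proof.
rewrite /psum big_split_ord /= [X in _ + X]big1 => [|k _]; last first.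
  by rewrite /trunc ltnNge leq_addr mul0r.
by rewrite addr0; apply: eq_bigr => k _; rewrite /trunc ltn_ord.
Qed.

Lemma has_ps_trunc a n r : has_ps r (trunc a n) (fun z => psum a z n).
Proof.
move=> z _; apply/cvgrPdist_le => e e0; exists n => // m /= nm.
by rewrite -(subnKC nm) psum_trunc subrr modulus0 subrr normr0 ltW.
Qed.

Lemma energy_trunc a n m : energy (trunc a n) m <= energy a n.
Proof.
apply: (@le_trans _ _ (energy (trunc a n) (n + m))).
  by apply: energy_nd; exact: leq_addl.
rewrite /energy big_split_ord /= [X in _ + X]big1 => [|k _]; last first.
  by rewrite /trunc ltnNge leq_addr modulus0 expr0n mul0r.
by rewrite addr0 ler_sum// => k _; rewrite /trunc ltn_ord.
Qed.

Lemma energy_tail a n m : energy (fun k => a k - trunc a n k) m + energy a n <=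
  energy a (n + m).
Proof.
apply: (@le_trans _ _ (energy (fun k => a k - trunc a n k) (n + m) + energy a n)).
  by rewrite lerD2r; apply: energy_nd; exact: leq_addl.
rewrite /energy big_split_ord /= big1 => [|k _]; last first.
  by rewrite /trunc ltn_ord subrr modulus0 expr0n mul0r.
rewrite add0r addrC [leRHS]big_split_ord lerD2l ler_sum// => k _ /=.
by rewrite /trunc ltnNge leq_addr subr0.
Qed.

(** The constant function 1, extended by 0 as the carrier requires. The polynomials are its images
    under [hact]. *)
Definition disk1 : C -> C := fun z => if modulus z < 1 then 1 else 0.

Lemma hcar_disk1 : hcar H disk1.
Proof.
apply: (@hcar_intro (trunc (fun=> 1) 1) _ (energy (fun=> 1) 1)).
- apply: has_ps_disk (@has_ps_trunc _ _ _) _ => z.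
  by rewrite /disk /disk1 /psum big_ord1 expr0 mulr1 /= => ->.
- by move=> z; rewrite /disk /disk1 /= => /negP/negbTE ->.
- by move=> n; exact: energy_trunc.
Qed.

Lemma horner_holomorphic (p : {poly C}) : holomorphic (fun z => p.[z]).
Proof.
apply: (@has_ps_holomorphic _ (trunc (fun k => p`_k) (size p))).
by apply: has_ps_disk (@has_ps_trunc _ _ _) _ => z _; rewrite horner_coef.
Qed.

Lemma hcar_hact (p : {poly C}) f : hcar H f -> hcar H (hact H p f).
Proof.
move=> Hf; have := @hcar_mul (fun z => p.[z]) (\sum_(k < size p) modulus (p`_k)) f.
case=> //; first exact: horner_holomorphic.
move=> z z1; rewrite horner_coef; apply: (le_trans (le_modulus_sum _ _ _)).
apply: ler_sum => k _; rewrite modulusM modulusX ler_piMr ?modulus_ge0//.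
by rewrite exprn_ile1 ?modulus_ge0// ltW.
Qed.

(** Subtracting the Taylor polynomial of degree below n leaves energy at most n2 f - energy n, which
    tends to 0. *)
Lemma poly_dense f (e : R) : hcar H f -> 0 < e -> exists n0, forall n, (n0 <= n)%N ->
  n2 (f - hact H (\poly_(k < n) taylor f k) disk1) <= e.
Proof.
move=> Hf e0; have /cvgrPdist_le/(_ _ e0)[n0 _ Hn] := energy_cvg_nrm2 Hf.
exists n0 => n /Hn /=; rewrite ger0_norm ?subr_ge0 ?energy_le_nrm2// => h.
have Hp := hcar_hact (\poly_(k < n) taylor f k) hcar_disk1.
apply: le_trans h; apply: nrm2_le_energy => [|m].
  exact: lin_closedB hcar_diag_lin Hf Hp.
have E : taylor (hact H (\poly_(k < n) taylor f k) disk1) = trunc (taylor f) n.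
  apply: taylorE; apply: has_ps_disk (@has_ps_trunc _ _ _) _ => z z1 /=.
  by rewrite horner_poly /disk1 z1 mulr1.
rewrite (taylorB Hf Hp) E lerBrDr.
by apply: (le_trans (energy_tail _ _ _)); exact: energy_le_nrm2.
Qed.

End DiagonalModule.

(** * Moduli of holomorphic pairs *)

Section HolomorphicFunctions.
Variable R : realType.
Local Notation C := R[i].
Implicit Types (f g h : C -> C) (z : C) (a b : nat -> C).

Lemma wd_unique2 f z (a1 b1 a2 b2 : C) : wd f z a1 b1 -> wd f z a2 b2 -> b1 = b2.
Proof. by move=> h1 h2; rewrite -(wd_ddbar h1) -(wd_ddbar h2). Qed.

Lemma wd_holomorphic f : (forall z, disk z -> exists c : C, wd f z c 0) -> holomorphic f.
Proof. by move=> H z /H[a Ha]; exact: wd_derivable Ha. Qed.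

Lemma has_ps_shiftd a f : has_ps 1 a f -> exists2 g, has_ps 1 (shiftd a) g &
  forall z, disk z -> wd f z (g z) 0.
Proof.
move=> Hf; have [g Hg] := geo_has_ps (geo_shiftd (has_ps_geo Hf)).
by exists g => // z z1; exact: has_ps_wd Hf Hg z1.
Qed.

Lemma holomorphic_deriv f : holomorphic f ->
  exists2 g, holomorphic g & forall z, disk z -> wd f z (g z) 0.
Proof.
move=> /holomorphic_has_ps[a /has_ps_shiftd[g Hg fg]].
by exists g => //; exact: has_ps_holomorphic Hg.
Qed.

Lemma holomorphic_div f g : holomorphic f -> holomorphic g ->
  (forall z, disk z -> g z != 0) -> holomorphic (fun z => f z / g z).
Proof.
move=> Hf Hg g0; apply: wd_holomorphic => z z1.
have [a wa] := derivable_wd (Hf z z1); have [b wb] := derivable_wd (Hg z z1).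
have := wdM wa (wd_inv (g0 z z1) wb).
rewrite mul0r add0r oppr0 mul0r mulr0 => H; by eexists; exact: H.
Qed.

Lemma holomorphicV f : holomorphic f -> (forall z, disk z -> f z != 0) ->
  holomorphic (fun z => (f z)^-1).
Proof.
move=> Hf f0; apply: wd_holomorphic => z z1; have [a wa] := derivable_wd (Hf z z1).
by have := wd_inv (f0 z z1) wa; rewrite oppr0 mul0r => H; eexists; exact: H.
Qed.

Lemma holomorphic_primitive g : holomorphic g -> exists2 h, holomorphic h &
  forall z, disk z -> wd h z (g z) 0.
Proof.
move=> /holomorphic_has_ps[a Ha].
pose b k : C := if k is n.+1 then a n / n.+1%:R else 0.
have E : shiftd b = a.
  by apply/funext => n; rewrite /shiftd /b mulrC divfK// pnatr_eq0.
have gb : geo 1 b.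
  move=> r r0 r1; have [M HM] := has_ps_geo Ha r0 r1.
  exists M => -[|n]; rewrite /b.
    by rewrite modulus0 mul0r (le_trans _ (HM 0%N))// mulr_ge0 ?modulus_ge0.
  apply: (le_trans _ (HM n)); rewrite modulusM modulusV.
  have -> : modulus (n.+1%:R : C) = n.+1%:R.
    by rewrite -(rmorph_nat (real_complex R)) modulus_real ger0_norm.
  apply: ler_pM; rewrite ?divr_ge0 ?modulus_ge0 ?exprn_ge0 ?(ltW r0)//.
    by rewrite ler_piMr ?modulus_ge0// invf_le1 ?ler1n ?ltr0n.
  by rewrite exprS ler_piMl ?exprn_ge0 ?(ltW r0) ?(ltW r1).
have [h Hh] := geo_has_ps gb; exists h; first exact: has_ps_holomorphic Hh.
by move=> z z1; apply: has_ps_wd Hh _ z1; rewrite E.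
Qed.

Lemma has_ps_eq0 f z : has_ps 1 (fun=> 0) f -> disk z -> f z = 0.
Proof.
move=> Hf z1; apply: (ccvg_unique (Hf z z1)).
by apply: eq_ccvg (ccvg_cst 0) => n; rewrite /psum big1// => k _; rewrite mul0r.
Qed.

Lemma wd0_cst f : (forall z, disk z -> wd f z 0 0) ->
  forall z, disk z -> f z = f 0.
Proof.
move=> H z z1; have [|a Ha] := holomorphic_has_ps (f := f).
  by apply: wd_holomorphic => w /H h; exists 0.
have [g Hg fg] := has_ps_shiftd Ha.
have g0 : has_ps 1 (fun=> 0) g.
  move=> w w1; rewrite (wd_unique (fg w w1) (H w w1)).
  by apply: eq_ccvg (ccvg_cst 0) => n; rewrite /psum big1// => k _; rewrite mul0r.
have sa := has_ps_unique ltr01 ltr01 Hg g0.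
have a0 n : a n.+1 = 0.
  have := congr1 (fun u => u n) sa; rewrite /shiftd => /eqP.
  by rewrite mulf_eq0 pnatr_eq0 /= => /eqP.
rewrite -(has_ps0 ltr01 Ha); apply: (ccvg_unique (ccvgS (Ha z z1))).
apply: eq_ccvg (ccvg_cst (a 0%N)) => n; rewrite psumSl /psum big1 ?mulr0 ?addr0//.
by move=> k _; rewrite a0 mul0r.
Qed.

Lemma wd_ln_modulus f z (a : C) : f z != 0 -> wd f z a 0 ->
  wd (fun w => (ln (modulus (f w) ^+ 2))%:C) z (a / f z) (conjc (a / f z)).
Proof.
move=> f0 Hf; have m0 : 0 < modulus (f z) ^+ 2 by rewrite exprn_gt0// modulus_gt0.
have := wd_real_comp (wd_modulus2 Hf) (is_derive1_ln m0).
have f0' : conjc (f z) != 0 by rewrite -modulus_eq0 modulus_conj modulus_eq0.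
have E : (modulus (f z) ^+ 2)^-1%:C = (f z)^-1 * (conjc (f z))^-1 :> C.
  by rewrite fmorphV /= -mul_conj invfM.
apply: wd_eq; rewrite E.
  by rewrite conjc0 mulr0 addr0; field; apply/andP.
by rewrite mul0r add0r conjcM conjc_inv; field; apply/andP.
Qed.

(** The d-bar derivative of log |f|^2 is the conjugate of f'/f, hence antiholomorphic and killed by
    d. *)
Lemma laplacian_ln_modulus f (q : C -> R) : holomorphic f ->
  (forall z, disk z -> f z != 0) ->
  (forall z, disk z -> q z = ln (modulus (f z) ^+ 2)) ->
  forall z, disk z -> laplacian q z = 0.
Proof.
move=> fh f0 qE z z1; have [g gh fg] := holomorphic_deriv fh.
have E w : disk w -> ddbar (fun v => (q v)%:C) w = conjc (g w / f w).
  move=> w1; apply: (wd_ddbar (a := g w / f w)).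
  by apply: (wd_disk w1 _ (wd_ln_modulus (f0 w w1) (fg w w1))) => v v1; rewrite qE.
have [a Ha] := derivable_wd (holomorphic_div gh fh f0 z1).
have H : wd (ddbar (fun v => (q v)%:C)) z 0 (conjc a).
  by apply: (wd_disk z1 _ (wd_eq (conjc0 _) erefl (wd_conj Ha))) => v v1; rewrite E.
by rewrite /laplacian (wd_dd H) mulr0.
Qed.

Definition mod2 (t1 t2 : C -> C) z : R := modulus (t1 z) ^+ 2 + modulus (t2 z) ^+ 2.

Lemma mod2E t1 t2 z : (mod2 t1 t2 z)%:C = t1 z * conjc (t1 z) + t2 z * conjc (t2 z).
Proof. by rewrite /mod2 rmorphD /= !mul_conj. Qed.

Lemma mod2_gt0 t1 t2 z : corona t1 t2 -> disk z -> 0 < mod2 t1 t2 z.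
Proof. by move=> [e e0 He] z1; rewrite (lt_le_trans e0)// He. Qed.

Lemma wd_mod2 t1 t2 z (u v : C) : wd t1 z u 0 -> wd t2 z v 0 ->
  wd (fun w => (mod2 t1 t2 w)%:C) z (u * conjc (t1 z) + v * conjc (t2 z))
    (conjc (u * conjc (t1 z) + v * conjc (t2 z))).
Proof.
move=> /wd_modulus2 h1 /wd_modulus2 h2.
apply: wd_ext_fun (fun w => esym (rmorphD _ _ _)) _.
apply: wd_eq (wdD h1 h2); first by rewrite conjc0 !mulr0 !addr0.
by rewrite !mul0r !add0r conjcD !conjcM !conjcK mulrC [X in _ + X]mulrC.
Qed.

(** The d-derivative of log(|t1|^2 + |t2|^2) at z when u and v are the derivatives of t1 and t2
    there. *)
Definition dlog (t1 t2 : C -> C) z (u v : C) :=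
  (u * conjc (t1 z) + v * conjc (t2 z)) / (mod2 t1 t2 z)%:C.

Lemma wd_ln_mod2 t1 t2 z (u v : C) : 0 < mod2 t1 t2 z ->
  wd t1 z u 0 -> wd t2 z v 0 ->
  wd (fun w => (ln (mod2 t1 t2 w))%:C) z (dlog t1 t2 z u v) (conjc (dlog t1 t2 z u v)).
Proof.
move=> m0 h1 h2; apply: wd_eq (wd_real_comp (wd_mod2 h1 h2) (is_derive1_ln m0)).
  by rewrite /dlog fmorphV mulrC.
by rewrite /dlog conjcM conjc_inv conjc_real fmorphV mulrC.
Qed.

Lemma wd_ln_ratio t1 t2 p1 p2 z (u v r s : C) : corona t1 t2 -> corona p1 p2 -> disk z ->
  wd t1 z u 0 -> wd t2 z v 0 -> wd p1 z r 0 -> wd p2 z s 0 ->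
  wd (fun w => (ln (mod2 t1 t2 w / mod2 p1 p2 w))%:C) z
    (dlog t1 t2 z u v - dlog p1 p2 z r s) (conjc (dlog t1 t2 z u v - dlog p1 p2 z r s)).
Proof.
move=> ct cp z1 h1 h2 h3 h4.
have mt w := @mod2_gt0 _ _ w ct; have mp w := @mod2_gt0 _ _ w cp.
have := wdB (wd_ln_mod2 (mt z z1) h1 h2) (wd_ln_mod2 (mp z z1) h3 h4).
rewrite -conjcB; apply: wd_disk z1 _ => w w1.
by rewrite -rmorphB ln_div ?posrE ?mt ?mp.
Qed.

Definition cexp z : C := (expR (complex.Re z))%:C * expi (complex.Im z).

Lemma modulus_cexp z : modulus (cexp z) = expR (complex.Re z).
Proof. by rewrite /cexp modulusM modulus_expi mulr1 modulus_real ger0_norm// expR_ge0. Qed.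

Lemma cexp_neq0 z : cexp z != 0.
Proof. by rewrite -modulus_eq0 modulus_cexp gt_eqF// expR_gt0. Qed.

(** Each of exp, cos and sin is handled by the real chain rule; the d-bar derivative then carries
    the factor 1 + i^2 = 0. *)
Lemma wd_cexp f z (a : C) : wd f z a 0 -> wd (fun w => cexp (f w)) z (a * cexp (f z)) 0.
Proof.
move=> Hf.
have HRe : wd (fun w => (complex.Re (f w))%:C) z (a / 2) (conjc a / 2).
  have := wdZ (2^-1) (wdD Hf (wd_conj Hf)).
  rewrite conjc0 addr0 add0r [2^-1 * a]mulrC [2^-1 * _]mulrC.
  by apply: wd_ext_fun => w; rewrite ReJ_add mulrC.
have HIm : wd (fun w => (complex.Im (f w))%:C) z (- 'i%C * a / 2) ('i%C * conjc a / 2).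
  have := wdZ ('i%C / 2) (wdB (wd_conj Hf) Hf).
  rewrite conjc0 sub0r subr0 mulrN => H; apply: wd_eq (wd_ext_fun _ H).
  - by ring.
  - by ring.
  - by move=> w; rewrite ImJ_sub; ring.
have He := wd_real_comp HRe (is_derive_expR _).
have Hc := wd_real_comp HIm (is_derive_cos _).
have Hs := wd_real_comp HIm (is_derive_sin _).
have H := wdM He (wdD Hc (wdZ 'i%C Hs)).
have i2 : 'i%C * 'i%C = -1 :> C by rewrite -expr2 sqr_i.
have cs (x y : R) : x +i* y = x%:C + 'i%C * y%:C by rewrite [LHS]complexReIm.
rewrite /cexp /expi; apply: wd_eq (wd_ext_fun _ H); last first.
- by move=> w; rewrite cs.
- rewrite rmorphN /=.
  move: (expR _)%:C (cos _)%:C (sin _)%:C => e c s.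
  rewrite (_ : _ + _ = e * conjc a / 2 * (1 + 'i%C * 'i%C) * c); last by field.
  by rewrite i2 subrr mulr0 mul0r.
- rewrite cs rmorphN /=.
  move: (expR _)%:C (cos _)%:C (sin _)%:C => e c s.
  transitivity (e * a / 2 * ((1 - 'i%C * 'i%C) * c + 2 * 'i%C * s)); first by field.
  by rewrite i2; field.
Qed.

Lemma shiftd_iterE a m k :
  iter m (@shiftd R) a k * k`!%:R = (k + m)`!%:R * a (k + m)%N.
Proof.
elim: m a k => [|m IH] a k; first by rewrite addn0 mulrC.
rewrite iterSr IH /shiftd mulrA -natrM addnS factS.
by rewrite mulnC.
Qed.

Lemma shiftd_iter_eq0 a : (forall m, iter m (@shiftd R) a 0%N = 0) -> a = fun=> 0.
Proof.
move=> H; apply/funext => m; have := shiftd_iterE a m 0; rewrite H mul0r add0n.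
by rewrite ?mul0r => /esym/eqP; rewrite mulf_eq0 pnatr_eq0 eqn0Ngt fact_gt0 => /eqP.
Qed.

(** * Separation of z and w in identities known on the diagonal *)

Section Polarization.
Variables (n : nat) (e : 'I_n -> C).

Lemma wd_sum (I : Type) (r : seq I) (F : I -> C -> C) z (u v : I -> C) :
  (forall i, wd (F i) z (u i) (v i)) ->
  wd (fun w => \sum_(i <- r) F i w) z (\sum_(i <- r) u i) (\sum_(i <- r) v i).
Proof.
move=> H; elim: r => [|i r IH].
  rewrite !big_nil; apply: wd_ext_fun (wd_cst 0 z) => w; by rewrite big_nil.
rewrite !big_cons; apply: wd_ext_fun (wdD (H i) IH) => w; by rewrite big_cons.
Qed.

Lemma has_ps_sum (c : 'I_n -> C) (A : 'I_n -> nat -> C) (f : 'I_n -> C -> C) :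
  (forall i, has_ps 1 (A i) (f i)) ->
  has_ps 1 (fun k => \sum_(i < n) c i * A i k) (fun z => \sum_(i < n) c i * f i z).
Proof.
move=> H z z1; apply: (@eq_ccvg _ (fun m => \sum_(i < n) c i * psum (A i) z m)).
  move=> m; under eq_bigr do rewrite /psum mulr_sumr.
  rewrite exchange_big; apply: eq_bigr => k _ /=; rewrite mulr_suml.
  by apply: eq_bigr => i _; rewrite mulrA.
elim: (index_enum _) => [|i r IH].
  rewrite big_nil; apply: eq_ccvg (ccvg_cst 0) => m; by rewrite big_nil.
rewrite big_cons; apply: eq_ccvg (ccvgD (ccvgZ (c i) (H i z z1)) IH) => m.
by rewrite big_cons.
Qed.

Let pairing (f g : 'I_n -> C -> C) z := \sum_(i < n) e i * f i z * conjc (g i z).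

(** d sees only the holomorphic factors and d-bar only the conjugated ones, so each derivative of
    the zero function gives a separate identity. *)
Lemma pairing_deriv (f f' g g' : 'I_n -> C -> C) :
  (forall i z, disk z -> wd (f i) z (f' i z) 0) ->
  (forall i z, disk z -> wd (g i) z (g' i z) 0) ->
  (forall z, disk z -> pairing f g z = 0) ->
  forall z, disk z -> pairing f' g z = 0 /\ pairing f g' z = 0.
Proof.
move=> Hf Hg H z z1.
have W := wd_sum (index_enum _)
  (fun i => wdM (wdZ (e i) (Hf i z z1)) (wd_conj (Hg i z z1))).
have Z : wd (fun w => \sum_(i <- index_enum _) e i * f i w * conjc (g i w)) z 0 0.
  by apply: wd_disk z1 _ (wd_cst 0 z) => w w1; rewrite -[LHS](H w w1).
split.
  rewrite -(wd_unique W Z); apply: eq_bigr => i _.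
  by rewrite conjc0 mulr0 addr0.
rewrite -(wd_unique2 W Z); apply: eq_bigr => i _.
by rewrite mulr0 mul0r add0r.
Qed.

Lemma pairing_iter (A B : 'I_n -> nat -> C) (f g : 'I_n -> C -> C) k l :
  (forall i, has_ps 1 (A i) (f i)) -> (forall i, has_ps 1 (B i) (g i)) ->
  (forall z, disk z -> pairing f g z = 0) ->
  \sum_(i < n) e i * iter k (@shiftd R) (A i) 0%N *
    conjc (iter l (@shiftd R) (B i) 0%N) = 0.
Proof.
have deriv (D : 'I_n -> nat -> C) (h : 'I_n -> C -> C) :
    (forall i, has_ps 1 (D i) (h i)) -> exists h' : 'I_n -> C -> C,
      (forall i, has_ps 1 (shiftd (D i)) (h' i)) /\
      (forall i z, disk z -> wd (h i) z (h' i z) 0).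
  move=> Hh; have /choice[h' Hh'] : forall i, exists h',
      has_ps 1 (shiftd (D i)) h' /\ forall z, disk z -> wd (h i) z (h' z) 0.
    by move=> i; have [h' a b] := has_ps_shiftd (Hh i); exists h'.
  by exists h'; split => i; case: (Hh' i).
elim: k A f => [|k IHk] A f.
  elim: l B g => [|l IHl] B g Hf Hg H.
    have D0 : disk (0 : C) by change (modulus (0 : C) < 1); rewrite modulus0.
    rewrite /= -[RHS](H 0 D0); apply: eq_bigr => i _.
    by rewrite (has_ps0 ltr01 (Hf i)) (has_ps0 ltr01 (Hg i)).
  have [g' [Hg' gg']] := deriv _ _ Hg; have [f' [_ ff']] := deriv _ _ Hf.
  under eq_bigr do rewrite [iter l.+1 _ _]iterSr.
  by apply: (IHl _ g') => // z z1; exact: (pairing_deriv ff' gg' H z1).2.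
move=> Hf Hg H.
have [g' [_ gg']] := deriv _ _ Hg; have [f' [Hf' ff']] := deriv _ _ Hf.
under eq_bigr do rewrite [iter k.+1 _ _]iterSr.
by apply: (IHk _ f') => // z z1; exact: (pairing_deriv ff' gg' H z1).1.
Qed.

Lemma iter_shiftd_sum (c : 'I_n -> C) (A : 'I_n -> nat -> C) m k :
  iter m (@shiftd R) (fun j => \sum_(i < n) c i * A i j) k =
  \sum_(i < n) c i * iter m (@shiftd R) (A i) k.
Proof.
elim: m k => // m IH k /=; rewrite /shiftd IH mulr_sumr.
by apply: eq_bigr => i _; rewrite mulrCA.
Qed.

(** By [pairing_iter] all mixed derivatives at 0 vanish; Taylor expansion in z and then in w
    finishes. The coefficients [e] admit differences of sums of squares. *)
Lemma polarization_id (f : 'I_n -> C -> C) : (forall i, holomorphic (f i)) ->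
  (forall z, disk z -> \sum_(i < n) e i * f i z * conjc (f i z) = 0) ->
  forall z w, disk z -> disk w -> \sum_(i < n) e i * f i z * conjc (f i w) = 0.
Proof.
move=> fh H; have /choice[A HA] : forall i, exists a, has_ps 1 a (f i).
  by move=> i; exact: holomorphic_has_ps.
have H1 l z : disk z -> \sum_(i < n) e i * f i z * conjc (iter l (@shiftd R) (A i) 0%N) = 0.
  move=> z1; under eq_bigr do rewrite mulrAC.
  apply: (@has_ps_eq0 (fun v => \sum_(i < n)
    e i * conjc (iter l (@shiftd R) (A i) 0%N) * f i v)) z1; have := has_ps_sum
    (fun i => e i * conjc (iter l (@shiftd R) (A i) 0%N)) HA.
  rewrite (_ : (fun k => \sum_(i < n) _ * A i k) = fun=> 0)//.
  apply: shiftd_iter_eq0 => k; rewrite iter_shiftd_sum.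
  rewrite -[RHS](pairing_iter k l HA HA H); apply: eq_bigr => i _.
  by rewrite mulrAC.
(* Conjugating makes the sum holomorphic in w, so the power series argument applies again. *)
move=> z w z1 w1; apply: (can_inj (@conjcK R)); rewrite rmorph_sum conjc0.
transitivity (\sum_(i < n) conjc (e i * f i z) * f i w).
  by apply: eq_bigr => i _; rewrite [LHS]conjcM conjcK.
apply: (@has_ps_eq0 (fun v => \sum_(i < n) conjc (e i * f i z) * f i v)) w1.
have := has_ps_sum (fun i => conjc (e i * f i z)) HA.
rewrite (_ : (fun k => \sum_(i < n) _ * A i k) = fun=> 0)//.
apply: shiftd_iter_eq0 => k; rewrite iter_shiftd_sum.
apply: (can_inj (@conjcK R)); rewrite rmorph_sum conjc0 -[RHS](H1 k z z1).
by apply: eq_bigr => i _; rewrite [LHS]conjcM conjcK.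
Qed.

End Polarization.

(* The pointwise formula for the proportionality factor of two proportional holomorphic pairs
   is not visibly holomorphic. *)
Lemma holomorphic_factor t1 t2 f1 f2 : holomorphic t1 -> holomorphic t2 ->
  holomorphic f1 -> holomorphic f2 -> corona t1 t2 ->
  (forall z, disk z -> f1 z * t1 z + f2 z * t2 z = 0) ->
  holomorphic (fun z => (f1 z * conjc (t2 z) - f2 z * conjc (t1 z)) / (mod2 t1 t2 z)%:C).
Proof.
move=> th1 th2 fh1 fh2 ct H; apply: wd_holomorphic => z z1.
have [u Hu] := derivable_wd (th1 z z1); have [v Hv] := derivable_wd (th2 z z1).
have [a Ha] := derivable_wd (fh1 z z1); have [b Hb] := derivable_wd (fh2 z z1).
have m0 : (mod2 t1 t2 z)%:C != 0 :> C by rewrite fmorph_eq0 gt_eqF// mod2_gt0.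
have W := wdM (wdB (wdM Ha (wd_conj Hv)) (wdM Hb (wd_conj Hu)))
  (wd_inv m0 (wd_mod2 Hu Hv)).
eexists; apply: wd_eq erefl _ W; have := H z z1; move: m0.
rewrite conjcD !conjcM !conjcK mod2E.
move: (f1 z) (f2 z) (t1 z) (t2 z) (conjc (t1 z)) (conjc (t2 z)) (conjc u) (conjc v).
move=> x y p q p' q' u' v' m0 E; rewrite !mul0r !add0r.
transitivity ((u' * - q' + v' * p') * (x * p + y * q) / (p * p' + q * q') ^+ 2).
  by field.
by rewrite E mulr0 mul0r.
Qed.

Lemma laplacian_eq0_factor t1 t2 p1 p2 : holomorphic t1 -> holomorphic t2 ->
  holomorphic p1 -> holomorphic p2 -> corona t1 t2 -> corona p1 p2 ->
  (forall z, disk z -> laplacian (fun w => ln (mod2 t1 t2 w / mod2 p1 p2 w)) z = 0) ->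
  exists G : C -> C, [/\ holomorphic G, forall z, G z != 0 &
    forall z, disk z -> mod2 t1 t2 z = modulus (G z) ^+ 2 * mod2 p1 p2 z].
Proof.
move=> th1 th2 ph1 ph2 ct cp H.
have mt w := @mod2_gt0 t1 t2 w ct; have mp w := @mod2_gt0 p1 p2 w cp.
have [u uh Hu] := holomorphic_deriv th1; have [v vh Hv] := holomorphic_deriv th2.
have [r rh Hr] := holomorphic_deriv ph1; have [s sh Hs] := holomorphic_deriv ph2.
pose g z := dlog t1 t2 z (u z) (v z) - dlog p1 p2 z (r z) (s z).
pose q z := ln (mod2 t1 t2 z / mod2 p1 p2 z).
have Wq z (z1 : disk z) : wd (fun w => (q w)%:C) z (g z) (conjc (g z)).
  exact (wd_ln_ratio ct cp z1 (Hu z z1) (Hv z z1) (Hr z z1) (Hs z z1)).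
have gh : holomorphic g.
  apply: wd_holomorphic => z z1.
  have dlog_wd (a1 a2 b1 b2 : C -> C) : holomorphic a1 -> holomorphic a2 -> holomorphic b1 ->
      holomorphic b2 -> corona a1 a2 ->
      exists c d : C, wd (fun w => dlog a1 a2 w (b1 w) (b2 w)) z c d.
    move=> ah1 ah2 bh1 bh2 ca.
    have [k1 K1] := derivable_wd (ah1 z z1); have [k2 K2] := derivable_wd (ah2 z z1).
    have [l1 L1] := derivable_wd (bh1 z z1); have [l2 L2] := derivable_wd (bh2 z z1).
    have m0 : (mod2 a1 a2 z)%:C != 0 :> C by rewrite fmorph_eq0 gt_eqF// mod2_gt0.
    do 2 eexists.
    exact: (wdM (wdD (wdM L1 (wd_conj K1)) (wdM L2 (wd_conj K2))) (wd_inv m0 (wd_mod2 K1 K2))).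
  have [c1 [d1 W1]] := dlog_wd _ _ _ _ th1 th2 uh vh ct.
  have [c2 [d2 W2]] := dlog_wd _ _ _ _ ph1 ph2 rh sh cp.
  have W := wdB W1 W2.
  (* As [q] is real, its d-bar derivative is conj g, whose d-derivative is the conjugate of the
     d-bar derivative of g. A vanishing Laplacian thus says that g is holomorphic. *)
  have W' : wd (ddbar (fun w => (q w)%:C)) z (conjc (d1 - d2)) (conjc (c1 - c2)).
    by apply: wd_disk z1 _ (wd_conj W) => w w1; rewrite (wd_ddbar (Wq w w1)).
  exists (c1 - c2); apply: wd_eq erefl _ W; apply: (can_inj (@conjcK R)).
  rewrite conjc0; have := H z z1; rewrite /laplacian -/q (wd_dd W') => /eqP.
  by rewrite mulf_eq0 pnatr_eq0 => /eqP.
have [h hh Hh] := holomorphic_primitive gh.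
(* The function q - 2 Re h has zero Wirtinger derivatives, so it keeps its value at 0. *)
pose k : R := q 0 - 2 * complex.Re (h 0).
have qE z : disk z -> q z = 2 * complex.Re (h z) + k.
  move=> z1; have V0 w : disk w -> wd (fun w => (q w)%:C - (h w + conjc (h w))) w 0 0.
    move=> w1; apply: wd_eq (wdB (Wq w w1) (wdD (Hh w w1) (wd_conj (Hh w w1)))).
      by rewrite conjc0 addr0 subrr.
    by rewrite add0r subrr.
  have := congr1 (@complex.Re R) (wd0_cst V0 z1).
  rewrite !cReD !cReN !cReD /k; case: (h z) (h 0) => [x y] [x' y'] /=; lra.
(* The squared modulus is exp(2 Re h + k) = exp q. *)
exists (fun z => cexp (h z + (k / 2)%:C)); split.
- apply: wd_holomorphic => z z1; exists (g z * cexp (h z + (k / 2)%:C)).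
  by apply: wd_cexp; have := wdD (Hh z z1) (wd_cst (k / 2)%:C z); rewrite !addr0.
- by move=> z; exact: cexp_neq0.
- move=> z z1; rewrite modulus_cexp cReD /= -expRM_natl.
  have -> : 2 * (complex.Re (h z) + k / 2) = q z by rewrite qE//; field.
  by rewrite /q lnK ?posrE ?divr_gt0 ?mt ?mp// divfK// gt_eqF// mp.
Qed.

(** Lagrange's identity: it splits x into its components along s and orthogonal to s. *)
Lemma norm_decomp (x1 x2 s1 s2 : C) :
  (modulus x1 ^+ 2 + modulus x2 ^+ 2) * (modulus s1 ^+ 2 + modulus s2 ^+ 2) =
  modulus (x1 * conjc s1 + x2 * conjc s2) ^+ 2 + modulus (x2 * s1 - x1 * s2) ^+ 2.
Proof.
rewrite !sqr_modulus; case: x1 x2 s1 s2 => [a b] [c d] [e f] [i j] /=; ring.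
Qed.

(* Polarization upgrades the equality of norms to that of the Gram kernels, so that the components
   along the values at 0 agree; [l] is the ratio of the components orthogonal to these values. *)
Lemma unitary_of_mod2 t1 t2 p1 p2 : holomorphic t1 -> holomorphic t2 ->
  holomorphic p1 -> holomorphic p2 -> corona t1 t2 ->
  (forall z, disk z -> mod2 t1 t2 z = mod2 p1 p2 z) ->
  exists a b c d : C, [/\ a * conjc a + b * conjc b = 1, c * conjc c + d * conjc d = 1,
    a * conjc c + b * conjc d = 0 &
    [/\ conjc a * a + conjc c * c = 1, conjc b * b + conjc d * d = 1,
    conjc a * b + conjc c * d = 0 &
    forall z, disk z -> t1 z = a * p1 z + b * p2 z /\ t2 z = c * p1 z + d * p2 z]].
Proof.
move=> th1 th2 ph1 ph2 ct E.
have D0 : disk (0 : C) by change (modulus (0 : C) < 1); rewrite modulus0.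
pose s1 := p1 0; pose s2 := p2 0; pose r1 := t1 0; pose r2 := t2 0.
pose n : C := (mod2 t1 t2 0)%:C.
have n0 : n != 0 by rewrite fmorph_eq0 gt_eqF// mod2_gt0.
have nr : r1 * conjc r1 + r2 * conjc r2 = n by rewrite -mod2E.
have ns : s1 * conjc s1 + s2 * conjc s2 = n by rewrite /n E// -mod2E.
have I z w : disk z -> disk w ->
    (* The equality of norms is a signed sum of four squared moduli equal to 0, to which
       [polarization_id] applies. *)
    t1 z * conjc (t1 w) + t2 z * conjc (t2 w) = p1 z * conjc (p1 w) + p2 z * conjc (p2 w).
  move=> z1 w1; pose f (i : 'I_4) := nth t1 [:: t1; t2; p1; p2] i.
  pose e (i : 'I_4) : C := nth 0 [:: 1; 1; -1; -1] i.
  have fh i : holomorphic (f i).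
    case: i => -[|[|[|[|m]]]] Hm; [exact th1|exact th2|exact ph1|exact ph2|].
    by exfalso; move: Hm.
  have H v : disk v -> \sum_(i < 4) e i * f i v * conjc (f i v) = 0.
    move=> v1; rewrite !big_ord_recr big_ord0 /e /f /= add0r !mul1r !mulN1r !mulNr.
    by rewrite -mod2E -addrA -opprD -mod2E E// subrr.
  have := polarization_id fh H z1 w1.
  rewrite !big_ord_recr big_ord0 /e /f /= add0r !mul1r !mulN1r !mulNr.
  by rewrite -addrA -opprD => /eqP; rewrite subr_eq0 => /eqP.
(* The products with the vectors orthogonal to the values at 0; they remain holomorphic in z because
   s and r are constant. *)
pose q z := p2 z * s1 - p1 z * s2; pose q' z := t2 z * r1 - t1 z * r2.
have holq (x y : C -> C) (c d : C) : holomorphic x -> holomorphic y ->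
    holomorphic (fun z => y z * c - x z * d).
  move=> xh yh; apply: wd_holomorphic => z z1.
  have [k K] := derivable_wd (xh z z1); have [l L] := derivable_wd (yh z z1).
  eexists; have := wdB (wdZ c L) (wdZ d K); rewrite !mulr0 subrr.
  by apply: wd_ext_fun => w; rewrite mulrC [d * _]mulrC.
have qq z : disk z -> modulus (q z) ^+ 2 = modulus (q' z) ^+ 2.
  move=> z1; have := norm_decomp (p1 z) (p2 z) s1 s2.
  have := norm_decomp (t1 z) (t2 z) r1 r2.
  rewrite -/(mod2 t1 t2 z) -/(mod2 t1 t2 0) -/(mod2 p1 p2 z) -/(mod2 p1 p2 0).
  by rewrite I// !E// => -> /addrI.
have [l l1 Hl] : exists2 l : C, l * conjc l = 1 & forall z, disk z -> q' z = l * q z.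
  have [[w [w1 qw]]|none] := pselect (exists w, disk w /\ q w != 0); last first.
    (* If q vanishes identically, so does q' by [qq], and any unimodular number serves as ratio. *)
    exists 1; first by rewrite conjc1 mulr1.
    move=> z z1; have q0 : q z = 0.
      by apply/eqP; apply: contrapT => /negP h; apply: none; exists z.
    have := qq z z1; rewrite q0 modulus0 expr0n mulr0 => /esym/eqP.
    by rewrite sqrf_eq0 modulus_eq0 => /eqP.
  have J z : disk z -> q z * conjc (q w) = q' z * conjc (q' w).
    move=> z1; pose f (i : 'I_2) := nth q [:: q; q'] i.
    pose e (i : 'I_2) : C := nth 0 [:: 1; -1] i.
    have fh i : holomorphic (f i).
      case: i => -[|[|m]] Hm; [exact (holq _ _ s1 s2 ph1 ph2)|
        exact (holq _ _ r1 r2 th1 th2)|by exfalso; move: Hm].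
    have H v : disk v -> \sum_(i < 2) e i * f i v * conjc (f i v) = 0.
      move=> v1; rewrite !big_ord_recr big_ord0 /e /f /= add0r !mul1r !mulN1r !mulNr.
      by rewrite !mul_conj qq// subrr.
    have := polarization_id fh H z1 w1.
    rewrite !big_ord_recr big_ord0 /e /f /= add0r !mul1r !mulN1r !mulNr.
    by move=> /eqP; rewrite subr_eq0 => /eqP.
  have qw' : q' w != 0.
    by rewrite -modulus_eq0 -sqrf_eq0 -qq// sqrf_eq0 modulus_eq0.
  have cw : conjc (q' w) != 0 by rewrite -modulus_eq0 modulus_conj modulus_eq0.
  exists (conjc (q w) / conjc (q' w)).
    rewrite conjcM conjc_inv !conjcK mulrACA [conjc _ * _]mulrC mul_conj.
    rewrite -invfM [conjc _ * _]mulrC mul_conj qq// divff//.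
    by rewrite fmorph_eq0 sqrf_eq0 modulus_eq0.
  by move=> z z1; apply: (mulIf cw); rewrite -J// [RHS]mulrAC divfK// mulrC.
(* The matrix that sends s to r and (-conj s2, conj s1) to l times (-conj r2, conj r1). Both pairs
   are orthogonal with squared norm n, so it is unitary. *)
exists ((conjc s1 * r1 + l * s2 * conjc r2) / n), ((conjc s2 * r1 - l * s1 * conjc r2) / n),
  ((conjc s1 * r2 - l * s2 * conjc r1) / n), ((conjc s2 * r2 + l * s1 * conjc r1) / n).
have nc : conjc n = n by rewrite conjc_real.
have sol z : disk z -> t1 z = (conjc s1 * r1 + l * s2 * conjc r2) / n * p1 z +
    (conjc s2 * r1 - l * s1 * conjc r2) / n * p2 z /\
    t2 z = (conjc s1 * r2 - l * s2 * conjc r1) / n * p1 z +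
    (conjc s2 * r2 + l * s1 * conjc r1) / n * p2 z.
  move=> z1; have h1 := I z 0 z1 D0; have h2 := Hl z z1.
  rewrite -/r1 -/r2 -/s1 -/s2 /q /q' in h1 h2.
  split; apply: (mulIf n0).
    transitivity ((t1 z * conjc r1 + t2 z * conjc r2) * r1 -
        (t2 z * r1 - t1 z * r2) * conjc r2); first by rewrite -nr; ring.
    by rewrite h1 h2; field.
  transitivity ((t1 z * conjc r1 + t2 z * conjc r2) * r2 +
      (t2 z * r1 - t1 z * r2) * conjc r1); first by rewrite -nr; ring.
  by rewrite h1 h2; field.
rewrite !conjcM !conjcD !conjcN !conjcM !conjcK conjc_inv nc.
move: l1 nr ns n0 {sol}(sol); move: (conjc l) (conjc s1) (conjc s2) (conjc r1) (conjc r2).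
move=> l' s1' s2' r1' r2' l1 nr ns n0 sol.
have one (x : C) : x = (s1 * s1' + s2 * s2') * (r1 * r1' + r2 * r2') ->
    x / (n * n) = 1 by move=> ->; rewrite nr ns divff// mulf_neq0.
split; last split => //.
- transitivity ((s1 * s1' + s2 * s2') * (r1 * r1' + l * l' * (r2 * r2')) / (n * n)).
    by field.
  by rewrite l1 mul1r one.
- transitivity ((s1 * s1' + s2 * s2') * (l * l' * (r1 * r1') + r2 * r2') / (n * n)).
    by field.
  by rewrite l1 mul1r one.
- transitivity ((1 - l * l') * ((s1 * s1' + s2 * s2') * r1 * r2') / (n * n)).
    by field.
  by rewrite l1 subrr !mul0r.
- transitivity ((s1 * s1' + l * l' * (s2 * s2')) * (r1 * r1' + r2 * r2') / (n * n)).
    by field.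
  by rewrite l1 mul1r one.
- transitivity ((l * l' * (s1 * s1') + s2 * s2') * (r1 * r1' + r2 * r2') / (n * n)).
    by field.
  by rewrite l1 mul1r one.
- transitivity ((1 - l * l') * ((r1 * r1' + r2 * r2') * s1 * s2') / (n * n)).
    by field.
  by rewrite l1 subrr !mul0r.
Qed.

End HolomorphicFunctions.

(** * Quotient modules *)

Lemma tensorC2_prehilbert (R : realType) (V : lmodType R[i]) (M : hmod V) :
  prehilbert M -> prehilbert (tensorC2 M).
Proof.
move=> HM; have [[H0 HL] ipL ipC ipP] := HM; split.
- by split=> //= a f g [f1 f2] [g1 g2]; split; exact: HL.
- move=> a f g h [f1 f2] [g1 g2] [h1 h2] /=.
  by rewrite !ipL// mulrDr addrACA.
- by move=> f g [f1 f2] [g1 g2] /=; rewrite ipC// (ipC f.2)// conjcD.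
- move=> f [f1 f2] /=; rewrite cReD.
  have [a0 a] := ipP _ f1; have [b0 b] := ipP _ f2; split; first exact: addr_ge0.
  move=> /eqP; rewrite paddr_eq0// => /andP[/eqP/a e1 /eqP/b e2].
  by rewrite [f]surjective_pairing e1 e2.
Qed.

Lemma ip_comb (R : realType) (V : lmodType R[i]) (M : hmod V) (x y : R[i]) f1 f2 g1 g2 :
  prehilbert M -> hcar M f1 -> hcar M f2 -> hcar M g1 -> hcar M g2 ->
  hip M (x *: f1 + y *: f2) (x *: g1 + y *: g2) =
    x * conjc x * hip M f1 g1 + x * conjc y * hip M f1 g2 +
    y * conjc x * hip M f2 g1 + y * conjc y * hip M f2 g2.
Proof.
move=> HM Hf1 Hf2 Hg1 Hg2; have HL := hcar_lin HM.
have HZ k h := @lin_closedZ _ _ _ k h HL; have HD h k := @lin_closedD _ _ _ h k HL.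
rewrite (ipDl HM) ?(ipDr HM); auto; rewrite !(ipZl HM, ipZr HM); auto.
by ring.
Qed.

Lemma nrm2_tensorC2 (R : realType) (V : lmodType R[i]) (M : hmod V) f :
  nrm2 (tensorC2 M) f = nrm2 M f.1 + nrm2 M f.2.
Proof. by rewrite /nrm2 /= cReD. Qed.

Lemma pair_lin1 (K : nzRingType) (V : lmodType K) a (f g : V) :
  (a *: f + g, 0) = a *: (f, 0) + (g, 0) :> (V * V)%type.
Proof. by apply: injective_projections => //=; rewrite scaler0 addr0. Qed.

Lemma pair_lin2 (K : nzRingType) (V : lmodType K) a (f g : V) :
  (0, a *: f + g) = a *: (0, f) + (0, g) :> (V * V)%type.
Proof. by apply: injective_projections => //=; rewrite scaler0 addr0. Qed.

Section QuotientModules.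
Variable R : realType.
Local Notation C := R[i].
Implicit Types (f g h : C -> C).
Variables (N : (C -> C) -> \bar R) (w : nat -> R).
Hypothesis HN : diag_norm N w.
Local Notation H := (function_module N).
Local Notation n2 := (nrm2 H).
Local Notation T := (tensorC2 H).
Let HP := diag_prehilbert HN.
Let TP := tensorC2_prehilbert HP.
Let HL := hcar_diag_lin HN.

Lemma hact_pair1 p f : hact T p (f, 0) = (hact H p f, 0).
Proof. by apply: injective_projections => //=; apply/funext => x; exact: mulr0. Qed.

Lemma hact_pair2 p f : hact T p (0, f) = (0, hact H p f).
Proof. by apply: injective_projections => //=; apply/funext => x; exact: mulr0. Qed.

(** On polynomials times 1 the last hypothesis gives p(z) l(1); boundedness and the density of
    polynomials extend this to all f. *)
Lemma disk_functional (l : (C -> C) -> C) z (K : R) : disk z -> 0 < K ->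
  (forall a f g, hcar H f -> hcar H g -> l (a *: f + g) = a * l f + l g) ->
  (forall f, hcar H f -> modulus (l f) ^+ 2 <= K * n2 f) ->
  (forall p f, hcar H f -> l (hact H p f) = p.[z] * l f) ->
  forall f, hcar H f -> l f = f z * l (@disk1 R).
Proof.
move=> z1 K0 ll lK lp f Hf; pose p n := \poly_(k < n) taylor f k.
have H1 := hcar_disk1 HN.
have A : ccvg (fun n => (p n).[z] * l (@disk1 R)) (f z * l (@disk1 R)).
  apply: (@eq_ccvg _ (fun n => l (@disk1 R) * psum (taylor f) z n)).
    by move=> n; rewrite /p horner_poly mulrC.
  by rewrite mulrC; apply: ccvgZ; exact: hcar_taylor Hf _ z1.
apply: (ccvg_unique _ A); apply/cvgrPdist_le => e e0.
have e'0 : 0 < e ^+ 2 / K by rewrite divr_gt0 ?exprn_gt0.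
have [n0 Hn] := poly_dense HN Hf e'0; exists n0 => // n /Hn h /=.
rewrite sub0r normrN ger0_norm ?modulus_ge0// modulusBC.
rewrite -(@ler_pXn2r _ 2)// ?nnegrE ?modulus_ge0 ?(ltW e0)//.
have Hp := hcar_hact HN (p n) H1.
have -> : l f - (p n).[z] * l (@disk1 R) = l (f - hact H (p n) (@disk1 R)).
  by rewrite addrC -lp// -mulN1r -ll//  scaleN1r addrC.
apply: (le_trans (lK _ (lin_closedB HL Hf Hp))).
by rewrite -ler_pdivlMl// mulrC.
Qed.

(** K is the squared norm of evaluation at z. The last clause is its sharpness in a form that
    cancels K from both sides of an inequality. *)
Lemma point_sup z : disk z -> exists K : R, [/\ 0 < K,
  forall f, hcar H f -> modulus (f z) ^+ 2 <= K * n2 f &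
  forall A B : R, 0 <= A -> 0 <= B ->
    (forall f, hcar H f -> A * modulus (f z) ^+ 2 <= B * K * n2 f) -> A <= B].
Proof.
move=> z1; have [K0 K00 HK0] := point_bound HN z1.
pose E := [set x | exists2 f, hcar H f /\ n2 f <= 1 & x = modulus (f z) ^+ 2].
have ubE : ubound E K0.
  move=> _ [f [Hf f1] ->]; apply: (le_trans (HK0 _ Hf)).
  by rewrite ler_piMr// ltW.
have E0 : E 0.
  by exists 0; [split; [exact: hcar0 HN|rewrite (nrm20 HN)]|rewrite modulus0 expr0n].
have hE : has_sup E by split; [exists 0|exists K0].
have H1 := hcar_disk1 HN.
have scale f : hcar H f -> modulus (f z) ^+ 2 <= sup E * n2 f.
  move=> Hf; have f0 := nrm2_ge0 HP Hf.
  have [fE|fE] := eqVneq (n2 f) 0.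
    by rewrite (nrm2_eq0 HP Hf fE) modulus0 expr0n (nrm20 HN) mulr0.
  have fp : 0 < n2 f by rewrite lt_def fE.
  pose r := (Num.sqrt (n2 f))^-1.
  have r2 : r ^+ 2 = (n2 f)^-1 by rewrite exprVn sqr_sqrtr.
  have r0 : 0 <= r by rewrite invr_ge0 sqrtr_ge0.
  have : E ((n2 f)^-1 * modulus (f z) ^+ 2).
    exists (r%:C *: f).
      split; first exact: lin_closedZ.
      by rewrite (nrm2Z HP)// modulus_real ger0_norm// r2 mulVf.
    rewrite -[(_ *: f) z]/(r%:C * f z) modulusM modulus_real ger0_norm// exprMn.
    by rewrite r2.
  by move=> /(sup_upper_bound hE); rewrite ler_pdivrMl// mulrC.
have K1 : 0 < sup E.
  have := scale _ H1; rewrite /disk1 z1 modulus1 expr1n => h.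
  have n1 := nrm2_ge0 HP H1; rewrite ltNge; apply/negP => s0.
  have := mulr_le0_ge0 s0 n1; move: h; rewrite -/(@disk1 R); lra.
exists (sup E); split => // A B A0 B0 AB.
have [->//|An] := eqVneq A 0.
have Ap : 0 < A by rewrite lt_def An.
have : sup E <= B * sup E / A.
  apply: ge_sup; first by exists 0.
  move=> _ [f [Hf f1] ->]; rewrite ler_pdivlMr// mulrC.
  apply: (le_trans (AB _ Hf)); rewrite ler_piMr//.
  by rewrite mulr_ge0// ltW.
by rewrite ler_pdivlMr// mulrC ler_pM2r.
Qed.

Section Range.
Variables t1 t2 : C -> C.
Hypotheses (b1 : bounded_holomorphic t1) (b2 : bounded_holomorphic t2).
Hypothesis ct : corona t1 t2.

Lemma hcar_bounded_mul t f : bounded_holomorphic t -> hcar H f ->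
  hcar H (fun z => t z * f z).
Proof. by move=> [th [B HB]] Hf; exact: (hcar_mul HN th HB Hf).1. Qed.

Lemma ranM_sub : ranM H t1 t2 `<=` hcar T.
Proof. by move=> _ [f Hf <-]; split; exact: hcar_bounded_mul. Qed.

Lemma ranM_lin : lin_closed (ranM H t1 t2).
Proof.
split.
  exists 0; first exact: hcar0 HN.
  by congr pair; apply/funext => z; exact: mulr0.
move=> a _ _ [f Hf <-] [g Hg <-]; exists (a *: f + g); first exact: HL.2.
congr pair; apply/funext => z /=; rewrite -[(a *: f + g) z]/(a * f z + g z).
  by rewrite mulrDr mulrCA.
by rewrite mulrDr mulrCA.
Qed.

(** The corona condition says that sqrt(e) f is dominated by t1 f and t2 f together, which is the
    hypothesis of [nrm2_dom]. *)
Lemma ranM_low : exists2 e : R, 0 < e & forall f, hcar H f ->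
  e * n2 f <= n2 (fun z => t1 z * f z) + n2 (fun z => t2 z * f z).
Proof.
have [e e0 He] := ct; exists e => // f Hf.
have s0 := sqrtr_ge0 e.
have -> : e * n2 f = n2 ((Num.sqrt e)%:C *: f).
  by rewrite (nrm2Z HP)// modulus_real ger0_norm// sqr_sqrtr// ltW.
have [h z0 _] := lin_closedZ (Num.sqrt e)%:C HL Hf.
apply: (nrm2_dom HN h z0 _ _ _).2; try exact: hcar_bounded_mul.
move=> z z1; rewrite -[(_ *: f) z]/((Num.sqrt e)%:C * f z) !modulusM.
rewrite modulus_real ger0_norm// !exprMn sqr_sqrtr ?(ltW e0)// -mulrDl.
by rewrite ler_wpM2r ?sqr_ge0// He.
Qed.

(** [ranM_low] pulls a Cauchy sequence of the range back to one in H; boundedness of t1 and t2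
    pushes its limit forward. *)
Lemma ranM_complete : ip_complete T (ranM H t1 t2).
Proof.
move=> s Ss Cs; have [e e0 He] := ranM_low.
have /choice[f Hf] : forall n, exists f, hcar H f /\
    (fun z => t1 z * f z, fun z => t2 z * f z) = s n.
  by move=> n; have [f Hf fE] := Ss n; exists f.
have mulB t g h : (fun z => t z * g z) - (fun z => t z * h z) =
    (fun z => t z * (g - h) z) :> (C -> C).
  by apply/funext => z; rewrite -[(g - h) z]/(g z - h z) mulrBr.
have E g h : nrm2 T ((fun z => t1 z * g z, fun z => t2 z * g z) -
      (fun z => t1 z * h z, fun z => t2 z * h z)) =
    n2 (fun z => t1 z * (g - h) z) + n2 (fun z => t2 z * (g - h) z).
  by rewrite nrm2_tensorC2 /= !mulB.
have [|l Hl lim] := diag_complete HN (fun n => (Hf n).1).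
  move=> d d0; have ed0 : 0 < e * d by exact: mulr_gt0.
  have [k Hk] := Cs _ ed0; exists k => m n km kn.
  rewrite -(ler_pM2l e0); apply: le_trans (Hk m n km kn).
  rewrite -(Hf m).2 -(Hf n).2 E; apply: He.
  exact: lin_closedB HL (Hf m).1 (Hf n).1.
exists (fun z => t1 z * l z, fun z => t2 z * l z); first by exists l.
move=> d d0; have [h1 [B1 HB1]] := b1; have [h2 [B2 HB2]] := b2.
pose B := B1 ^+ 2 + B2 ^+ 2 + 1.
have B0 : 0 < B by rewrite /B ltr_wpDl// addr_ge0 ?sqr_ge0.
have dB : 0 < d / B by rewrite divr_gt0.
have [k Hk] := lim _ dB; exists k => n /Hk h.
rewrite -(Hf n).2 E.
have Hfl : hcar H (f n - l) by exact: lin_closedB HL (Hf n).1 Hl.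
apply: (le_trans (lerD (hcar_mul HN h1 HB1 Hfl).2 (hcar_mul HN h2 HB2 Hfl).2)).
rewrite -mulrDl; apply: (@le_trans _ _ (B * n2 (f n - l))).
  by rewrite ler_wpM2r ?(nrm2_ge0 HP)// lerDl.
by rewrite -ler_pdivlMl// mulrC.
Qed.

End Range.

(* At [z], up to a scalar, the only character of the quotient by the range of [M_(t1, t2)]. *)
Definition wedge (t1 t2 : C -> C) z (F : (C -> C) * (C -> C)) : C :=
  t2 z * F.1 z - t1 z * F.2 z.

Lemma wedge_lin t1 t2 z a F G :
  wedge t1 t2 z (a *: F + G) = a * wedge t1 t2 z F + wedge t1 t2 z G.
Proof.
case: F G => f1 f2 [g1 g2]; rewrite /wedge.
change (t2 z * (a * f1 z + g1 z) - t1 z * (a * f2 z + g2 z) =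
  a * (t2 z * f1 z - t1 z * f2 z) + (t2 z * g1 z - t1 z * g2 z)).
by ring.
Qed.

Lemma wedge_ran t1 t2 z F : ranM H t1 t2 F -> wedge t1 t2 z F = 0.
Proof. by move=> [f _ <-]; rewrite /wedge /=; ring. Qed.

Lemma wedge_hact t1 t2 z p F : wedge t1 t2 z (hact T p F) = p.[z] * wedge t1 t2 z F.
Proof. by rewrite /wedge /=; ring. Qed.

Lemma wedge_le t1 t2 z F : modulus (wedge t1 t2 z F) ^+ 2 <=
  mod2 t1 t2 z * (modulus (F.1 z) ^+ 2 + modulus (F.2 z) ^+ 2).
Proof.
rewrite /wedge /mod2; move: (t1 z) (t2 z) (F.1 z) (F.2 z) => a b x y.
apply: (@le_trans _ _ ((modulus b * modulus x + modulus a * modulus y) ^+ 2)).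
  rewrite lerXn2r ?nnegrE ?addr_ge0 ?mulr_ge0 ?modulus_ge0//.
  by rewrite (le_trans (le_modulusB _ _))// !modulusM.
have := sqr_ge0 (modulus b * modulus y - modulus a * modulus x).
nra.
Qed.

Lemma wedge_bound t1 t2 z (K : R) F : (forall f, hcar H f -> modulus (f z) ^+ 2 <= K * n2 f) ->
  hcar T F -> modulus (wedge t1 t2 z F) ^+ 2 <= mod2 t1 t2 z * (K * nrm2 T F).
Proof.
move=> HK [F1 F2]; apply: (le_trans (wedge_le _ _ _ _)).
rewrite ler_wpM2l ?addr_ge0 ?sqr_ge0// nrm2_tensorC2 mulrDr.
by apply: lerD; exact: HK.
Qed.

(* These vectors are the ones on which [wedge t1 t2 z] is extremal. *)
Definition wedge_test (t1 t2 : C -> C) z f : (C -> C) * (C -> C) :=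
  (conjc (t2 z) *: f, - conjc (t1 z) *: f).

Lemma wedge_testE t1 t2 z f :
  modulus (wedge t1 t2 z (wedge_test t1 t2 z f)) ^+ 2 =
  mod2 t1 t2 z ^+ 2 * modulus (f z) ^+ 2.
Proof.
rewrite /wedge /wedge_test /= -[(_ *: f) z]/(conjc (t2 z) * f z).
rewrite -[(- _ *: f) z]/(- conjc (t1 z) * f z).
have -> : t2 z * (conjc (t2 z) * f z) - t1 z * (- conjc (t1 z) * f z) =
    (t1 z * conjc (t1 z) + t2 z * conjc (t2 z)) * f z by ring.
rewrite !mul_conj -rmorphD modulusM modulus_real exprMn real_normK ?num_real//.
Qed.

Lemma wedge_test_hcar t1 t2 z f : hcar H f -> hcar T (wedge_test t1 t2 z f).
Proof. by move=> Hf; split; exact: lin_closedZ. Qed.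

Lemma wedge_test_nrm2 t1 t2 z f : hcar H f ->
  nrm2 T (wedge_test t1 t2 z f) = mod2 t1 t2 z * n2 f.
Proof.
move=> Hf; rewrite nrm2_tensorC2 /= !(nrm2Z HP)// modulusN !modulus_conj.
by rewrite -mulrDl addrC.
Qed.

(** * From an isomorphism of quotients to the vanishing Laplacian *)

Section Isomorphism.
Variables t1 t2 p1 p2 : C -> C.
Hypotheses (bt1 : bounded_holomorphic t1) (bt2 : bounded_holomorphic t2)
  (bp1 : bounded_holomorphic p1) (bp2 : bounded_holomorphic p2)
  (ct : corona t1 t2) (cp : corona p1 p2).
Local Notation St := (ranM H t1 t2).
Local Notation Sp := (ranM H p1 p2).
Local Notation Kt := (orthocomplement T St).
Local Notation Kp := (orthocomplement T Sp).
Local Notation Pt := (orthproj T Kt).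
Local Notation Pp := (orthproj T Kp).
Variable X : (C -> C) * (C -> C) -> (C -> C) * (C -> C).
Hypotheses (Xbij : set_bij Kt Kp X)
  (Xlin : forall (a : C) F G, Kt F -> Kt G -> X (a *: F + G) = a *: X F + X G)
  (Xip : forall F G, Kt F -> Kt G -> hip T (X F) (X G) = hip T F G)
  (Xact : forall (q : {poly C}) F, Kt F -> X (Pt (hact T q F)) = Pp (hact T q (X F))).

Let StH := ranM_sub bt1 bt2.
Let SpH := ranM_sub bp1 bp2.
Let StL := ranM_lin t1 t2.
Let SpL := ranM_lin p1 p2.
Let StC := ranM_complete bt1 bt2 ct.
Let SpC := ranM_complete bp1 bp2 cp.
Let KX F : Kt F -> Kp (X F). Proof. by case: Xbij => XK _ _ /XK. Qed.
Let hactT q F : hcar T F -> hcar T (hact T q F).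
Proof. by move=> [F1 F2]; split; exact: (hcar_hact HN). Qed.
Let PtK F : hcar T F -> Kt (Pt F).
Proof. by move=> HF; exact (orthproj_in TP StH StL StC HF). Qed.

(* The character of the second quotient at [z], transported to the first one by [X]. *)
Definition pull z F := wedge p1 p2 z (X (Pt F)).

Lemma wedge_proj z G : hcar T G -> wedge p1 p2 z (Pp G) = wedge p1 p2 z G.
Proof.
move=> HG; have D := orthproj_diff TP SpH SpL SpC HG.
have -> : wedge p1 p2 z G = wedge p1 p2 z (1 *: Pp G + (G - Pp G)).
  by rewrite scale1r addrC subrK.
by rewrite wedge_lin mul1r (wedge_ran z D) addr0.
Qed.

Lemma pull_lin z a F G : hcar T F -> hcar T G ->
  pull z (a *: F + G) = a * pull z F + pull z G.
Proof.
move=> HF HG; rewrite /pull (orthproj_lin TP StH StL StC)// Xlin ?wedge_lin//.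
  exact: PtK.
exact: PtK.
Qed.

Lemma nrm2_X F : Kt F -> nrm2 T (X F) = nrm2 T F.
Proof. by move=> KF; rewrite /nrm2 Xip. Qed.

Lemma pull_bound z (K : R) F : 0 <= K ->
  (forall f, hcar H f -> modulus (f z) ^+ 2 <= K * n2 f) ->
  hcar T F -> modulus (pull z F) ^+ 2 <= mod2 p1 p2 z * (K * nrm2 T F).
Proof.
move=> K0 HK HF; have KF := PtK HF.
apply: (le_trans (wedge_bound _ _ HK (KX KF).1)).
rewrite nrm2_X// !ler_wpM2l ?addr_ge0 ?sqr_ge0//.
exact (nrm2_orthproj TP StH StL StC HF).
Qed.

(** The range of M_Theta is a submodule, so projecting before acting changes nothing after
    projection. X intertwines the compressions, and [wedge] does not see the second projection since
    it kills the range of M_Phi. *)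
Lemma pull_hact z q F : hcar T F -> pull z (hact T q F) = q.[z] * pull z F.
Proof.
move=> HF; have KF := PtK HF.
have E : Pt (hact T q F) = Pt (hact T q (Pt F)).
  have D := orthproj_diff TP StH StL StC HF.
  apply: (orthproj_unique TP StH (hactT q HF)).
    by apply: PtK; apply: hactT; case: KF.
  have -> : hact T q F - Pt (hact T q (Pt F)) =
      (hact T q (F - Pt F)) + (hact T q (Pt F) - Pt (hact T q (Pt F))).
    rewrite addrA; congr (_ - _).
    by congr pair; apply/funext => x /=;
      rewrite -[(_ + _) x]/(_ x + _ x) /= -[(_ - _) x]/(_ x - _ x) mulrBr subrK.
  apply: (lin_closedD StL).
    have [f Hf fE] := D; rewrite -fE; exists (hact H q f); first exact: (hcar_hact HN).
    by congr pair; apply/funext => x /=; rewrite mulrCA.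
  apply: (orthproj_diff TP StH StL StC); apply: hactT; exact: KF.1.
by rewrite {1}/pull E Xact// wedge_proj ?wedge_hact//; apply: hactT; exact: (KX KF).1.
Qed.

Lemma pull_ran z F : St F -> pull z F = 0.
Proof.
move=> SF; rewrite /pull (orthproj_eq0 TP StH)//.
have K0 : Kt 0 by exact: (orthocomplement_lin TP StH).1.
have -> : X 0 = 0.
  have := Xlin (-1) K0 K0; rewrite scaler0 addr0 => ->.
  by rewrite scaleN1r addNr.
by rewrite /wedge /= -[0 z]/(0 : C) !mulr0 subr0.
Qed.

Local Notation one := (@disk1 R).

Lemma pull_rep z F : disk z -> hcar T F ->
  pull z F = F.1 z * pull z (one, 0) + F.2 z * pull z (0, one).
Proof.
move=> z1 [F1 F2]; have H0 := hcar0 HN; have H1 := hcar_disk1 HN.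
have [K [K0 HK _]] := point_sup z1.
(* The + 1 makes the constant strictly positive at once, as [disk_functional] asks. *)
have K'0 : 0 < (mod2 p1 p2 z + 1) * K.
  by rewrite mulr_gt0// ltr_wpDl// addr_ge0 ?sqr_ge0.
have bd F' f : hcar T F' -> nrm2 T F' = n2 f ->
    modulus (pull z F') ^+ 2 <= (mod2 p1 p2 z + 1) * K * n2 f.
  move=> HF' E; apply: (le_trans (pull_bound (ltW K0) HK HF')).
  rewrite -mulrA -E ler_wpM2r ?lerDl// mulr_ge0 ?(ltW K0)//.
  exact: nrm2_ge0 TP _ HF'.
have FE : F = 1 *: (F.1, 0) + (0, F.2).
  by rewrite scale1r [LHS]surjective_pairing; congr pair; rewrite ?addr0 ?add0r.
rewrite {1}FE pull_lin// mul1r; congr (_ + _).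
  apply: (@disk_functional (fun f => pull z (f, 0)) z _ z1 K'0) => //.
  - move=> a f g Hf Hg.
    by rewrite pair_lin1; apply: pull_lin.
  - by move=> f Hf; apply: bd => //; rewrite nrm2_tensorC2 /= (nrm20 HN) addr0.
  - move=> p f Hf; rewrite -(pull_hact z p (conj Hf H0 : hcar T (f, 0))) hact_pair1.
    by [].
apply: (@disk_functional (fun f => pull z (0, f)) z _ z1 K'0) => //.
- move=> a f g Hf Hg.
  by rewrite pair_lin2; apply: pull_lin.
- by move=> f Hf; apply: bd => //; rewrite nrm2_tensorC2 /= (nrm20 HN) add0r.
- move=> p f Hf; rewrite -(pull_hact z p (conj H0 Hf : hcar T (0, f))) hact_pair2.
  by [].
Qed.

(** The pair of coefficients of [pull z] is orthogonal to Theta(z), hence c (t2, -t1) for one c;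
    pairing with (t2, -t1) and dividing by |Theta(z)|^2 solves for c. *)
Definition multiplier z := (pull z (one, 0) * conjc (t2 z) -
  pull z (0, one) * conjc (t1 z)) / (mod2 t1 t2 z)%:C.

(** Theta times the constant 1 lies in the range of M_Theta, on which [pull] vanishes. *)
Lemma pull_relation z : disk z ->
  pull z (one, 0) * t1 z + pull z (0, one) * t2 z = 0.
Proof.
move=> z1; have S1 : St (fun x => t1 x * one x, fun x => t2 x * one x).
  by exists one => //; exact: (hcar_disk1 HN).
have := pull_rep z1 (StH S1); rewrite pull_ran// => /= ->.
by rewrite /disk1 z1 !mulr1 mulrC [X in _ + X]mulrC.
Qed.

Lemma pull_multiplier z F : disk z -> hcar T F ->
  pull z F = multiplier z * wedge t1 t2 z F.
Proof.
move=> z1 HF; rewrite pull_rep//.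
have E := pull_relation z1.
have [e e0 He] := ct.
have m0 : (mod2 t1 t2 z)%:C != 0 :> C.
  by rewrite fmorph_eq0 gt_eqF// (lt_le_trans e0)// He.
apply: (mulfI m0); rewrite /multiplier /wedge [RHS]mulrA [_ * (_ / _)]mulrC divfK//.
rewrite /mod2 rmorphD /= -!mul_conj.
move: (pull z (one, 0)) (pull z (0, one)) E => al be E.
apply/eqP; rewrite -subr_eq0; apply/eqP.
rewrite (_ : _ - _ = (al * t1 z + be * t2 z) *
  (conjc (t1 z) * F.1 z + conjc (t2 z) * F.2 z)); last by ring.
by rewrite E mul0r.
Qed.

(** Two applications of the sharpness in [point_sup]. A test vector for Phi, pulled back through X,
    gives one inequality; a test vector for Theta gives the other. *)
Lemma mod2_multiplier z : disk z ->
  mod2 p1 p2 z = modulus (multiplier z) ^+ 2 * mod2 t1 t2 z.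
Proof.
move=> z1; have [K [K0 HK Ksup]] := point_sup z1.
have gt0 q1 q2 : corona q1 q2 -> 0 < mod2 q1 q2 z.
  by move=> [e e0 He]; rewrite (lt_le_trans e0)// He.
have mt := gt0 _ _ ct; have mp := gt0 _ _ cp.
set c2 := modulus (multiplier z) ^+ 2; have c0 : 0 <= c2 by exact: sqr_ge0.
apply/eqP; rewrite eq_le; apply/andP; split.
  rewrite -(ler_pM2l mp) -expr2; apply: Ksup; rewrite ?sqr_ge0//.
    by rewrite !mulr_ge0 ?(ltW mp) ?(ltW mt).
  move=> f Hf; rewrite -wedge_testE.
  set G := wedge_test _ _ _ _; have HG : hcar T G by exact: wedge_test_hcar.
  have KG := orthproj_in TP SpH SpL SpC HG.
  (* Surjectivity of X provides the preimage; its norm is that of Pp G, at most that of G. *)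
  have [F KF XF] : exists2 F, Kt F & X F = Pp G by case: Xbij => _ _ /(_ _ KG)[F KF XF]; exists F.
  have -> : wedge p1 p2 z G = multiplier z * wedge t1 t2 z F.
    rewrite -pull_multiplier//; last exact: KF.1.
    rewrite /pull (@orthproj_unique _ _ _ TP _ StH F F)//; last 2 first.
    - exact: KF.1.
    - by rewrite subrr; exact: StL.1.
    by rewrite XF wedge_proj.
  rewrite modulusM exprMn -/c2.
  have -> : mod2 p1 p2 z * (c2 * mod2 t1 t2 z) * K * n2 f =
    c2 * (mod2 t1 t2 z * (K * (mod2 p1 p2 z * n2 f))) by ring.
  rewrite ler_wpM2l// -wedge_test_nrm2// -/G.
  apply: (le_trans (wedge_bound _ _ HK KF.1)).
  rewrite !ler_wpM2l ?(ltW mt) ?(ltW K0)// -nrm2_X// XF.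
  exact (nrm2_orthproj TP SpH SpL SpC HG).
rewrite -(ler_pM2r mt); apply: Ksup.
- by rewrite !mulr_ge0 ?(ltW mt).
- by rewrite mulr_ge0 ?(ltW mt) ?(ltW mp).
move=> f Hf; have HF := wedge_test_hcar t1 t2 z Hf.
have := pull_bound (ltW K0) HK HF; rewrite pull_multiplier// modulusM exprMn.
rewrite wedge_testE wedge_test_nrm2// -/c2 => h.
move: h; rewrite expr2 !mulrA => h; apply: (le_trans h).
by rewrite [leLHS](_ : _ = mod2 p1 p2 z * mod2 t1 t2 z * K * n2 f)//; ring.
Qed.

Lemma pull_holomorphic F : hcar T F -> holomorphic (fun z => pull z F).
Proof.
move=> HF; have [[[h1 _ _] [h2 _ _]] _] := KX (PtK HF); apply: wd_holomorphic => z z1.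
have [u Hu] := derivable_wd (h1 z z1); have [v Hv] := derivable_wd (h2 z z1).
have [a Ha] := derivable_wd (bp1.1 z z1); have [b Hb] := derivable_wd (bp2.1 z z1).
have := wdB (wdM Hb Hu) (wdM Ha Hv).
by rewrite !mul0r !mulr0 !addr0 subr0 => H'; eexists; exact: H'.
Qed.

Lemma isomorphic_laplacian z : disk z ->
  laplacian (fun x => ln (mod2 t1 t2 x / mod2 p1 p2 x)) z = 0.
Proof.
have H0 := hcar0 HN; have H1 := hcar_disk1 HN.
have mh : holomorphic multiplier.
  have f1h := @pull_holomorphic (one, 0) (conj H1 H0).
  have f2h := @pull_holomorphic (0, one) (conj H0 H1).
  exact: (holomorphic_factor bt1.1 bt2.1 f1h f2h ct pull_relation).
have m0 x : disk x -> multiplier x != 0.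
  move=> x1; have := mod2_gt0 cp x1; rewrite (mod2_multiplier x1).
  by apply: contraTneq => ->; rewrite modulus0 expr0n mul0r ltxx.
(* The inverse appears because the ratio has Theta in the numerator. *)
apply: (@laplacian_ln_modulus _ (fun x => (multiplier x)^-1)).
- exact (holomorphicV mh m0).
- by move=> x x1; rewrite invr_eq0 m0.
- move=> x x1; congr ln; rewrite modulusV exprVn (mod2_multiplier x1) invfM.
  rewrite mulrCA mulfV ?mulr1// gt_eqF//; exact: mod2_gt0.
Qed.

End Isomorphism.

(** * From a holomorphic factor to an isomorphism of quotients *)

Section Transport.
Variables t1 t2 p1 p2 : C -> C.
Hypotheses (bt1 : bounded_holomorphic t1) (bt2 : bounded_holomorphic t2)
  (bp1 : bounded_holomorphic p1) (bp2 : bounded_holomorphic p2)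
  (ct : corona t1 t2) (cp : corona p1 p2).
Variable G : C -> C.
Hypotheses (Gh : holomorphic G) (G0 : forall z, G z != 0)
  (GE : forall z, disk z -> mod2 t1 t2 z = modulus (G z) ^+ 2 * mod2 p1 p2 z).
Local Notation St := (ranM H t1 t2).
Local Notation Sp := (ranM H p1 p2).
Local Notation Kt := (orthocomplement T St).
Local Notation Kp := (orthocomplement T Sp).

Lemma mod2_bounded q1 q2 : bounded_holomorphic q1 -> bounded_holomorphic q2 ->
  exists B : R, forall z, disk z -> mod2 q1 q2 z <= B.
Proof.
move=> [_ [B1 H1]] [_ [B2 H2]]; exists (B1 ^+ 2 + B2 ^+ 2) => z z1.
have sq (x y : R) : 0 <= x -> x <= y -> x ^+ 2 <= y ^+ 2.
  by move=> x0 xy; rewrite lerXn2r ?nnegrE// (le_trans x0).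
by apply: lerD; apply: sq; rewrite ?modulus_ge0 ?H1 ?H2.
Qed.

(** |g|^2 is a quotient with bounded numerator and a denominator bounded below by the corona
    condition. Used for G and, with the pairs exchanged, for 1/G. *)
Lemma bounded_factor q1 q2 r1 r2 g : bounded_holomorphic q1 -> bounded_holomorphic q2 ->
  corona r1 r2 -> holomorphic g ->
  (forall z, disk z -> mod2 q1 q2 z = modulus (g z) ^+ 2 * mod2 r1 r2 z) ->
  bounded_holomorphic g.
Proof.
move=> b1 b2 [e e0 He] gh gE; split=> //.
have [B HB] := mod2_bounded b1 b2; exists (B / e + 1) => z z1.
have h : modulus (g z) ^+ 2 <= B / e.
  rewrite ler_pdivlMr//; apply: le_trans (HB z z1); rewrite gE//.
  by rewrite ler_wpM2l ?sqr_ge0// He.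
by apply: (sqr_le_add1 _ h); apply: le_trans h; exact: sqr_ge0.
Qed.

Lemma hcar_mul_div f : hcar H f ->
  hcar H (fun z => G z * f z) /\ hcar H (fun z => (G z)^-1 * f z).
Proof.
move=> Hf; split; apply: (hcar_bounded_mul _ Hf).
  exact (bounded_factor bt1 bt2 cp Gh GE).
apply: (bounded_factor bp1 bp2 ct).
  by apply: (holomorphicV Gh) => z _; exact: G0.
move=> z z1; rewrite GE// modulusV exprVn mulKf// expf_neq0// modulus_eq0.
exact: G0.
Qed.

Lemma transport_isomorphic : isomorphic (quotient_module H t1 t2) (quotient_module H p1 p2).
Proof.
have Gp k : bounded_holomorphic k -> holomorphic (fun z => G z * k z).
  by move=> [kh _]; exact: holomorphicM.
have E z : disk z -> mod2 t1 t2 z = mod2 (fun x => G x * p1 x) (fun x => G x * p2 x) z.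
  by move=> z1; rewrite GE// /mod2 !modulusM !exprMn mulrDr.
have [a [b [c [d [r1 r2 r3 [c1 c2 c3 U]]]]]] :=
  unitary_of_mod2 bt1.1 bt2.1 (Gp _ bp1) (Gp _ bp2) ct E.
have r3' : c * conjc a + d * conjc b = 0.
  by have := congr1 conjc r3; rewrite conjc0 conjcD !conjcM !conjcK mulrC [X in _ + X]mulrC.
have c3' : conjc b * a + conjc d * c = 0.
  by have := congr1 conjc c3; rewrite conjc0 conjcD !conjcM !conjcK mulrC [X in _ + X]mulrC.
(* With U the unitary matrix such that Theta = U G Phi, this is the adjoint of U acting on the C^2
   factor, and [Y] is U itself. *)
pose X (F : (C -> C) * (C -> C)) : (C -> C) * (C -> C) :=
  (conjc a *: F.1 + conjc c *: F.2, conjc b *: F.1 + conjc d *: F.2).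
pose Y (F : (C -> C) * (C -> C)) : (C -> C) * (C -> C) :=
  (a *: F.1 + b *: F.2, c *: F.1 + d *: F.2).
have HZ := lin_closedZ _ HL; have HD := lin_closedD HL.
have XH F : hcar T F -> hcar T (X F) by move=> [F1 F2]; split; apply: HD; exact: HZ.
have YH F : hcar T F -> hcar T (Y F) by move=> [F1 F2]; split; apply: HD; exact: HZ.
have XY F : X (Y F) = F.
  case: F => f1 f2; rewrite /X /Y /=; apply: injective_projections => /=;
    rewrite !scalerDr !scalerA addrACA -!scalerDl.
    by rewrite c1 c3 scale1r scale0r addr0.
  by rewrite c2 c3' scale1r scale0r add0r.
have YX F : Y (X F) = F.
  case: F => f1 f2; rewrite /X /Y /=; apply: injective_projections => /=;
    rewrite !scalerDr !scalerA addrACA -!scalerDl.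
    by rewrite r1 r3 scale1r scale0r addr0.
  by rewrite r2 r3' scale1r scale0r add0r.
have Xlin k F K : X (k *: F + K) = k *: X F + X K.
  case: F K => f1 f2 [g1 g2]; rewrite /X /=; apply: injective_projections => /=;
  by rewrite !scalerDr !scalerA addrACA ![conjc _ * k]mulrC.
have Xip F K : hcar T F -> hcar T K -> hip T (X F) (X K) = hip T F K.
  move=> [F1 F2] [K1 K2].
  change (hip H (conjc a *: F.1 + conjc c *: F.2) (conjc a *: K.1 + conjc c *: K.2) +
    hip H (conjc b *: F.1 + conjc d *: F.2) (conjc b *: K.1 + conjc d *: K.2) =
    hip H F.1 K.1 + hip H F.2 K.2).
  rewrite !(ip_comb _ _ HP)// !conjcK.
  transitivity ((a * conjc a + b * conjc b) * hip H F.1 K.1 +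
    (c * conjc a + d * conjc b) * hip H F.1 K.2 +
    (a * conjc c + b * conjc d) * hip H F.2 K.1 +
    (c * conjc c + d * conjc d) * hip H F.2 K.2); first by ring.
  by rewrite r1 r2 r3 r3' !mul0r !mul1r !addr0.
(* The adjoint of U sends Theta f to Phi (G f). Outside the disk, where nothing is known of t1 and
   t2, both sides vanish with f. *)
have Xran f z : hcar H f -> conjc a * (t1 z * f z) + conjc c * (t2 z * f z) = p1 z * (G z * f z) /\
    conjc b * (t1 z * f z) + conjc d * (t2 z * f z) = p2 z * (G z * f z).
  move=> [_ f0 _]; have [z1|z1] := pselect (disk z); last by rewrite f0// !mulr0 addr0.
  have [-> ->] := U z z1; split.
    transitivity ((conjc a * a + conjc c * c) * (p1 z * (G z * f z)) +
      (conjc a * b + conjc c * d) * (p2 z * (G z * f z))); first by ring.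
    by rewrite c1 c3 mul1r mul0r addr0.
  transitivity ((conjc b * a + conjc d * c) * (p1 z * (G z * f z)) +
    (conjc b * b + conjc d * d) * (p2 z * (G z * f z))); first by ring.
  by rewrite c2 c3' mul1r mul0r add0r.
have XS F : St F -> Sp (X F).
  move=> [f Hf <-]; exists (fun z => G z * f z); first exact (hcar_mul_div Hf).1.
  by apply: injective_projections; apply/funext => z; case: (Xran f z Hf).
have YS F : Sp F -> St (Y F).
  move=> [f Hf <-]; have Hg := (hcar_mul_div Hf).2.
  exists (fun z => (G z)^-1 * f z) => //; rewrite -[LHS]YX; congr Y.
  apply: injective_projections; apply/funext => z; have [h1 h2] := Xran _ z Hg.
    by apply: etrans h1 _; rewrite mulVKf.
  by apply: etrans h2 _; rewrite mulVKf.
have XK F : Kt F -> Kp (X F).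
  move=> [HF OF]; split; first exact: XH.
  move=> s Ss; have HYs := YH _ (ranM_sub bp1 bp2 Ss).
  by rewrite -[s]XY Xip// OF//; exact: YS.
have YK F : Kp F -> Kt (Y F).
  move=> [HF OF]; split; first exact: YH.
  move=> s Ss; rewrite -Xip ?XY; [|exact: YH|exact: (ranM_sub bt1 bt2 Ss)].
  by rewrite OF//; exact: XS.
exists X; split.
- split=> //.
  + by move=> F K _ _ e; rewrite -[F]YX e YX.
  + by move=> F KF; exists (Y F); [exact: YK|exact: XY].
- by move=> k F K _ _; exact: Xlin.
- by move=> F K [HF _] [HK _]; exact: Xip.
- move=> q F [HF _]; have StH := ranM_sub bt1 bt2; have SpH := ranM_sub bp1 bp2.
  have Hq : hcar T (hact T q F) by case: HF => *; split; exact: (hcar_hact HN).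
  have XA : hact T q (X F) = X (hact T q F).
    apply: injective_projections; apply/funext => z.
      change (q.[z] * (conjc a * F.1 z + conjc c * F.2 z) =
        conjc a * (q.[z] * F.1 z) + conjc c * (q.[z] * F.2 z)); ring.
    change (q.[z] * (conjc b * F.1 z + conjc d * F.2 z) =
      conjc b * (q.[z] * F.1 z) + conjc d * (q.[z] * F.2 z)); ring.
  have StC := ranM_complete bt1 bt2 ct; have StL := ranM_lin t1 t2.
  have KP := orthproj_in TP StH StL StC Hq.
  have SP := orthproj_diff TP StH StL StC Hq.
  change (X (orthproj T Kt (hact T q F)) = orthproj T Kp (hact T q (X F))).
  (* X commutes with the uncompressed action and respects both ranges and complements, so it carries
     one projection to the other. *)
  rewrite XA; apply: esym; apply: (orthproj_unique TP SpH (XH _ Hq) (XK _ KP)).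
  rewrite [X in Sp X](_ : _ = X (hact T q F - orthproj T Kt (hact T q F))).
    exact: XS.
  by rewrite addrC -scaleN1r -Xlin scaleN1r addrC.
Qed.

End Transport.
End QuotientModules.

Theorem theorem4p4 (R : realType) (H : hmod (R[i] -> R[i])%type)
    (theta1 theta2 phi1 phi2 : R[i] -> R[i])
    (HH : [\/ H = hardy, H = bergman |
              exists2 alpha : R, -1 < alpha & H = weighted_bergman alpha])
    (Htheta1 : bounded_holomorphic theta1)
    (Htheta2 : bounded_holomorphic theta2)
    (Hphi1 : bounded_holomorphic phi1)
    (Hphi2 : bounded_holomorphic phi2)
    (Ctheta : corona theta1 theta2)
    (Cphi : corona phi1 phi2) :
  isomorphic (quotient_module H theta1 theta2) (quotient_module H phi1 phi2)
  <->
  forall z : R[i], disk z ->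
    laplacian (fun w =>
      ln ((modulus (theta1 w) ^+ 2 + modulus (theta2 w) ^+ 2) /
          (modulus (phi1 w) ^+ 2 + modulus (phi2 w) ^+ 2))) z = 0.
Proof.
(* From here on the three kinds of modules are treated alike through [diag_norm]; the Bergman module
   is the case alpha = 0. *)
have [N [w [HN ->]]] : exists N w, diag_norm N w /\ H = function_module N.
  have bergmanP (alpha : R) : -1 < alpha -> H = weighted_bergman alpha ->
      exists N w, diag_norm N w /\ H = function_module N.
    move=> a1 ->; have [v Hv] := bergman_diag_norm a1.
    by exists (bergman_norm2 alpha), v.
  case: HH => [->|/bergmanP|[alpha a1 /bergmanP]]; last 2 first.
  - by apply; rewrite ltrN10.
  - exact.
  - by exists (@hardy_norm2 R), (fun=> 1); split=> //; exact: hardy_diag_norm.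
split=> [[X [Xbij Xlin Xip Xact]] z|lap0].
  exact: (isomorphic_laplacian HN Htheta1 Htheta2 Hphi1 Hphi2 Ctheta Cphi Xbij Xlin Xip Xact).
have [G [Gh G0 GE]] := laplacian_eq0_factor Htheta1.1 Htheta2.1 Hphi1.1 Hphi2.1
  Ctheta Cphi lap0.
exact: (transport_isomorphic HN Htheta1 Htheta2 Hphi1 Hphi2 Ctheta Cphi Gh G0 GE).
Qed.
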